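(* Let $X$ be a $\sigma$-finite measure space, $H_i:=H_0:=L^2(X)$ and $V_i:=V_0\hookrightarrow H_0$ (continuously and densely) for all $i\in I$, $H=\bigoplus_{i\in I}H_i$, $V=\bigoplus_{i\in I}V_i$. Fix a closed linear subspace $Y\subset\ell^2(I)$ and let $\mathcal Y:=\{\psi\in H:\psi(x)\in Y\text{ for almost every }x\in X\}$. Assume that $a=(a_{ij})_{i,j\in I}:V\times V\to\mathbb C$ is a continuous and $H$-elliptic form. Then for all Hilbert bases $(v_i)_{i\in I}$ of $\ell^2(I)$ such that $(v_\ell)_{\ell\in I'}$ is a Hilbert basis of $Y$ and $(v_k)_{k\in I''}$ is a Hilbert basis of $Y^\perp$ (where $I=I'\cup I''$, $I'\cap I''=\emptyset$), the following assertions are equivalent. (a) The subspace $\mathcal Y$ is invariant under the action of $(e^{ta})_{t\ge0}$, i.e. $e^{ta}\mathcal Y\subset\mathcal Y$ for all $t\ge0$. (b) The identity $$\sum_{i,j\in I}\sum_{\ell\in I'}\sum_{k\in I''}(v_\ell)_j\,\overline{(v_k)_i}\,a_{ij}(\psi_\ell,\psi'_k)=0$$ holds for all $\psi_\ell,\psi'_k\in V_0$.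
   Context: $I=\{1,\dots,m\}$ or $I=\mathbb N$; direct sums are Hilbert space direct sums; $H$ is identified with $L^2(X,\ell^2(I))$ via $\psi(x)=(\psi_i(x))_{i\in I}$. Writing $a=(a_{ij})_{i,j\in I}$ means $a(\psi,\psi')=\sum_{i,j\in I}a_{ij}(\psi_j,\psi'_i)$ with sesquilinear mappings $a_{ij}:V_j\times V_i\to\mathbb C$ obtained by evaluating $a$ on vectors supported only in components $j$ and $i$, respectively. $(a,V)$ is continuous if there is $M$ with $|a(\psi,\psi')|\le M\|\psi\|_V\|\psi'\|_V$ for all $\psi,\psi'\in V$, and $H$-elliptic if there are $\alpha>0,\omega\in\mathbb R$ with $\mathrm{Re}\,a(\psi,\psi)+\omega\|\psi\|_H^2\ge\alpha\|\psi\|_V^2$ for all $\psi\in V$. $(e^{ta})_{t\ge0}$ is the analytic semigroup on $H$ generated by the operator $A$ associated with $a$: $D(A)=\{\psi\in V:\exists f\in H\ \forall\psi'\in V:a(\psi,\psi')=(f\mid\psi')_H\}$, $A\psi=-f$. $(v)_j$ is the $j$-th coordinate of $v\in\ell^2(I)$, and $Y^\perp$ is the orthogonal complement of $Y$ in $\ell^2(I)$.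
   Formalization: In (b), the families of ψ_ℓ (ℓ ∈ I') and ψ'_k (k ∈ I'') in V_0 are taken square-summable (automatic for finite I), since for I = ℕ the sum may diverge for arbitrary families; the sum is read as iterated unordered sums over i, j, ℓ, k. *)

(* Defs.v *)
From HB Require Import structures.
From mathcomp Require Import all_boot all_order all_algebra finmap.
From mathcomp Require Import sesquilinear complex.
From mathcomp Require Import mathcomp_extra boolp classical_sets functions reals.
From mathcomp Require Import ereal topology normedtype sequences.
From mathcomp Require Import measure measurable_realfun lebesgue_measure.
From mathcomp Require Import lebesgue_integral hoelder.
From mathcomp.analysis Require Import summability.

Set Implicit Arguments.
Unset Strict Implicit.
Unset Printing Implicit Defensive.

Import Order.TTheory GRing.Theory Num.Theory.
Import numFieldNormedType.Exports.

Local Open Scope classical_set_scope.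
Local Open Scope ring_scope.

(* {dot V for conj} is linear in the first argument and conjugate-linear in
   the second one. *)
HB.mixin Record isInnerProduct (R : realType) V & @NormedModule R[i] V := {
  dotp : {dot V for (@Num.conj R[i])} ;
  dotp_norm : forall x : V, dotp x x = `|x| ^+ 2
}.

#[short(type="preHilbertType")]
HB.structure Definition PreHilbert (R : realType) :=
  {V of @NormedModule R[i] V & isInnerProduct R V}.

#[short(type="hilbertType")]
HB.structure Definition Hilbert (R : realType) :=
  {V of PreHilbert R V & @CompleteNormedModule R[i] V}.

Section CauchySchwarz.
Context {C : numClosedFieldType} {U : lmodType C}.
Variable f : {dot U for (@Num.conj C)}.

Lemma dot_cauchy_schwarz x y : `|f x y| ^+ 2 <= f x x * f y y.
Proof.
have [->|y0] := eqVneq y 0; first by rewrite !linear0r normr0 expr0n/= mulr0.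
have yy : 0 < f y y by exact: neq0_dnorm_gt0.
pose a := f x y / f y y; pose z := x - a *: y.
have oz : f z y = 0.
  by rewrite /z linearBl/= linearZl_LR/= divfK ?subrr// gt_eqF.
have -> : x = z + a *: y by rewrite /z subrK.
rewrite linearDl/= oz add0r linearZl_LR/= normrM (ger0_norm (ltW yy)).
rewrite exprMn [f y y ^+ 2]expr2 mulrA [f (z + _) (z + _)]hnormDd/=; last first.
  by rewrite linearZr_LR/= oz mulr0.
rewrite dnormZ; apply: ler_wpM2r; first exact: ltW.
by rewrite lerDr dnorm_ge0.
Qed.

Lemma dot_triangle x y :
  sqrtC (f (x + y) (x + y)) <= sqrtC (f x x) + sqrtC (f y y).
Proof.
have sp z : 0 <= sqrtC (f z z) by rewrite sqrtC_ge0 dnorm_ge0.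
rewrite -ler_sqr ?nnegrE ?addr_ge0// sqrrD !sqrtCK addrAC dnormD lerD2l.
have le : `|f x y| <= sqrtC (f x x) * sqrtC (f y y).
  rewrite -ler_sqr ?nnegrE ?mulr_ge0// exprMn !sqrtCK.
  exact: dot_cauchy_schwarz.
apply: le_trans (lerD le le).
rewrite (le_trans (real_ler_norm _))//.
  by rewrite CrealE rmorphD/= conjCK addrC.
by rewrite (le_trans (ler_normD _ _))// norm_conjC.
Qed.

End CauchySchwarz.

HB.factory Record Lmodule_isPreHilbert (R : realType) V
    & GRing.Lmodule R[i] V := {
  dot : V -> V -> R[i] ;
  dot_linear : forall y, linear_for *%R (dot^~ y) ;
  dot_conj : forall x y, dot x y = (dot y x)^* ;
  dot_gt0 : forall x, x != 0 -> 0 < dot x x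
}.

HB.builders Context (R : realType) V & Lmodule_isPreHilbert R V.

Let dot_bilinear : bilinear_for *%R (@Num.conj R[i] \; *%R) dot.
Proof.
split; first exact: dot_linear.
move=> y c u v; rewrite dot_conj dot_linear rmorphD rmorphM/=.
by rewrite -!dot_conj.
Qed.

HB.instance Definition _ := bilinear_isBilinear.Build _ _ _ _ _ _ dot dot_bilinear.

Let dot_hermitian x y : dot x y = (-1) ^+ false * (dot y x)^*.
Proof. by rewrite expr0 mul1r -dot_conj. Qed.

HB.instance Definition _ :=
  isHermitianSesquilinear.Build _ _ _ _ dot dot_hermitian.

HB.instance Definition _ := isDotProduct.Build _ _ dot dot_gt0.

Let nrm x := sqrtC (dot x x).

Let nrmD x y : nrm (x + y) <= nrm x + nrm y.
Proof. exact: dot_triangle. Qed.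

Let nrmZ (c : R[i]) x : nrm (c *: x) = `|c| * nrm x.
Proof.
rewrite /nrm (dnormZ dot) sqrtCM ?nnegrE ?exprn_ge0 ?dnorm_ge0//.
by rewrite sqrCK.
Qed.

Let nrm_eq0 x : nrm x = 0 -> x = 0.
Proof. by move=> /eqP; rewrite sqrt_dnorm_eq0 => /eqP. Qed.

HB.instance Definition _ := Lmodule_isNormed.Build R[i] V nrmD nrmZ nrm_eq0.

Let dot_norm x : dot x x = `|x| ^+ 2.
Proof. by rewrite -[LHS]sqrtCK. Qed.

HB.instance Definition _ := isInnerProduct.Build R V dot_norm.

HB.end.

Section Scalars.
Variable R : realType.

Definition mulconj (x y : R[i]^o) : R[i] := (x : R[i]) * (y : R[i])^*.

Let mulconj_bilinear :
  bilinear_for *%R (@Num.conj R[i] \; *%R) mulconj.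
Proof.
split=> y c u v; first by rewrite /mulconj mulrDl -mulrA.
by rewrite /mulconj/= rmorphD rmorphM mulrDr mulrCA.
Qed.

HB.instance Definition _ :=
  bilinear_isBilinear.Build _ _ _ _ _ _ mulconj mulconj_bilinear.

Let mulconj_hermitian x y : mulconj x y = (-1) ^+ false * (mulconj y x)^*.
Proof. by rewrite expr0 mul1r /mulconj rmorphM/= conjCK mulrC. Qed.

HB.instance Definition _ :=
  isHermitianSesquilinear.Build _ _ _ _ mulconj mulconj_hermitian.

Let mulconj_gt0 x : x != 0 -> 0 < mulconj x x.
Proof. by rewrite /mulconj mul_conjC_gt0. Qed.

HB.instance Definition _ := isDotProduct.Build _ _ mulconj mulconj_gt0.

Let mulconj_norm (x : R[i]^o) : mulconj x x = `|x| ^+ 2.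
Proof. by rewrite /mulconj -normCK. Qed.

HB.instance Definition _ := isInnerProduct.Build R R[i]^o mulconj_norm.

End Scalars.

#[global] Existing Instance totally_filter.

Section Summation.
Context {R : realType} {I : choiceType}.

Definition psum (J : set I) (f : I -> R[i]) (A : {fset I}) : R[i]^o :=
  \sum_(i <- A | i \in J) f i.

(* Sum over J of a family of complex numbers, as the limit along the directed
   set of finite subsets of I; this is the usual (unordered) sum when the
   family is summable, and an unspecified value otherwise. *)
Definition usum (J : set I) (f : I -> R[i]) : R[i] :=
  lim (psum J f A @[A --> totally]).

Definition usummable (J : set I) (f : I -> R[i]) :=
  cvg (psum J f A @[A --> totally]).

Lemma usumP J f l : psum J f A @[A --> totally] --> (l : R[i]^o) -> usum J f = l.
Proof. by move=> fl; exact: (@cvg_lim R[i]^o (@norm_hausdorff _ _)). Qed.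

Lemma eq_usummable J f g : f =1 g -> usummable J f -> usummable J g.
Proof. by move=> /funext ->. Qed.

Lemma cvg_usumD J f g (l m : R[i]^o) : psum J f A @[A --> totally] --> l ->
  psum J g A @[A --> totally] --> m ->
  psum J (fun i => f i + g i) A @[A --> totally] --> l + m.
Proof.
move=> fl gm; rewrite (_ : psum J _ = psum J f + psum J g); first exact: cvgD.
by apply/funext => A; rewrite /psum big_split.
Qed.

Lemma cvg_usumZ J f c (l : R[i]^o) : psum J f A @[A --> totally] --> l ->
  psum J (fun i => c * f i) A @[A --> totally] --> c *: l.
Proof.
move=> fl; rewrite (_ : psum J _ = c \*: psum J f); first exact: cvgZl_tmp.
by apply/funext => A; rewrite /psum/= -mulr_sumr.
Qed.

Lemma cvg_usum_conj J f (l : R[i]^o) : psum J f A @[A --> totally] --> l ->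
  psum J (fun i => (f i)^*) A @[A --> totally] --> (((l : R[i])^*) : R[i]^o).
Proof.
move=> /cvgrPdist_lt fl; apply/cvgrPdist_lt => e /fl.
apply: filterS => A; rewrite /psum -rmorph_sum -rmorphB.
by rewrite norm_conjC.
Qed.

Lemma le_psum (J : set I) (f : I -> R) (A B : {fset I}) :
  (forall i, J i -> 0 <= f i) -> (A `<=` B)%fset ->
  \sum_(i <- A | i \in J) f i <= \sum_(i <- B | i \in J) f i.
Proof.
move=> f0 AB; rewrite [leLHS]big_mkcond [leRHS]big_mkcond/=.
pose g i := if i \in A then if i \in J then f i else 0 else 0.
have -> : \sum_(i <- A) (if i \in J then f i else 0) = \sum_(i <- A) g i.
  by apply: eq_big_seq => i iA; rewrite /g iA.
have -> : \sum_(i <- A) g i = \sum_(i <- B) g i.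
  by apply: big_fset_incl => // i _; rewrite /g => /negbTE ->.
apply: ler_sum => i _; rewrite /g; case: (i \in A) => //.
by case: ifPn => // /set_mem; exact: f0.
Qed.

Lemma cvg_nneg_usum (J : set I) (f : I -> R) :
  (forall i, J i -> 0 <= f i) ->
  (exists M, forall A : {fset I}, \sum_(i <- A | i \in J) f i <= M) ->
  psum J (fun i => (f i)%:C%C) A @[A --> totally] -->
  ((sup (range (fun A : {fset I} => \sum_(i <- A | i \in J) f i)))%:C%C : R[i]^o).
Proof.
move=> f0 [M fM].
pose s (A : {fset I}) := \sum_(i <- A | i \in J) f i; rewrite -/s.
have supS : has_sup (range s).
  by split; [exists (s fset0), fset0|exists M => _ [A _ <-]; exact: fM].
apply/cvgrPdist_lt => e e0.
have [er ere] : exists r : R, e = r%:C%C.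
  by exists (complex.Re e); rewrite RRe_real// gtr0_real.
move: e0; rewrite {}ere ltcR => e0.
have [_ [A _ <-]] := sup_adherent e0 supS.
move=> sA; exists A => //= B AB.
rewrite /psum -(rmorph_sum (real_complex R)) -rmorphB/= normc_def/=.
rewrite expr0n/= addr0 sqrtr_sqr ltcR.
have sB : s B <= sup (range s).
  by apply: ub_le_sup; [exact: supS.2|exists B].
rewrite ger0_norm ?subr_ge0// ltrBlDr -ltrBlDl (lt_le_trans sA)//.
exact: le_psum.
Qed.

Lemma nneg_usummable (J : set I) (f : I -> R) :
  (forall i, J i -> 0 <= f i) ->
  (exists M, forall A : {fset I}, \sum_(i <- A | i \in J) f i <= M) ->
  usummable J (fun i => (f i)%:C%C).
Proof. by move=> f0 fM; apply: cvgP; exact: cvg_nneg_usum. Qed.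

Lemma abs_usummable (J : set I) (f : I -> R[i]) :
  (exists M : R, forall A : {fset I},
    \sum_(i <- A | i \in J) `|f i| <= M%:C%C) -> usummable J f.
Proof.
move=> [M fM].
have bnd (g : I -> R) : (forall i, `|(g i)%:C%C| <= `|f i|) ->
    usummable J (fun i => (g i)%:C%C).
  move=> gf.
  have pm (s : R) : `|s| <= 1 -> usummable J (fun i => (`|g i| + s * g i)%:C%C).
    move=> s1; apply: nneg_usummable.
      move=> i _; rewrite -lerBlDr sub0r (le_trans (ler_norm _))// normrN normrM.
      by rewrite ler_piMl.
    exists (2 * M) => A.
    rewrite (@le_trans _ _ (2 * \sum_(i <- A | i \in J) `|g i|))//.
      rewrite mulr_sumr; apply: ler_sum => i _.
      rewrite mulrDl mul1r lerD2l (le_trans (ler_norm _))// normrM.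
      by rewrite ler_piMl.
    rewrite ler_pM2l// -lecR (le_trans _ (fM A))//.
    rewrite (rmorph_sum (real_complex R)) ler_sum// => i _.
    by rewrite (le_trans _ (gf i))// normc_def/= expr0n/= addr0 sqrtr_sqr.
  have pm1 := pm 1 (eq_ind_r (fun x => is_true (x <= 1)) (lexx _) (normr1 _)).
  have pm0 := pm 0 (eq_ind_r (fun x => is_true (x <= 1)) ler01 (normr0 _)).
  apply: eq_usummable (cvgP _ (cvg_usumD pm1 (cvg_usumZ (c := -1) pm0))) => i.
  by rewrite mulN1r -rmorphB/= mul1r mul0r addr0 addrAC subrr add0r.
have re i : `|(complex.Re (f i))%:C%C| <= `|f i|.
  rewrite !normc_def lecR ler_wsqrtr//= expr0n addr0 lerDl; exact: sqr_ge0.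
have im i : `|(complex.Im (f i))%:C%C| <= `|f i|.
  rewrite !normc_def lecR ler_wsqrtr//= expr0n addr0 lerDr; exact: sqr_ge0.
have cre := bnd _ re; have cim := bnd _ im.
apply: eq_usummable (cvgP _ (cvg_usumD cre (cvg_usumZ (c := 'i%C) cim))) => i.
by rewrite /= [RHS]complexE.
Qed.

End Summation.

Section SquareSummable.
Context {R : realType} {I : choiceType} {E : normedModType R[i]}.

Definition square_summable (J : set I) (f : I -> E) :=
  exists M : R, forall A : {fset I},
    \sum_(i <- A | i \in J) `|f i| ^+ 2 <= M%:C%C.

Lemma square_summable0 J : square_summable J (fun=> 0).
Proof. by exists 0 => A; rewrite big1// => i _; rewrite normr0 expr0n. Qed.

Lemma square_summableD J f g : square_summable J f -> square_summable J g ->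
  square_summable J (fun i => f i + g i).
Proof.
move=> [M fM] [N gN]; exists ((M + N) *+ 2) => A.
rewrite rmorphMn rmorphD -mulr_natl.
apply: (@le_trans _ _ (\sum_(i <- A | i \in J) 2 * (`|f i| ^+ 2 + `|g i| ^+ 2))).
  apply: ler_sum => i _.
  rewrite (@le_trans _ _ ((`|f i| + `|g i|) ^+ 2))//.
    by rewrite ler_pXn2r ?nnegrE ?addr_ge0// ler_normD.
  rewrite sqrrD addrAC mulr_natl [leRHS]mulr2n lerD2l.
  have r (x : E) : `|x| \is Num.real by exact: ger0_real.
  by rewrite -subr_ge0 addrAC -sqrrB real_exprn_even_ge0// rpredB.
by rewrite -mulr_sumr big_split/= ler_wpM2l// lerD.
Qed.

Lemma square_summableZ J c f : square_summable J f ->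
  square_summable J (fun i => c *: f i).
Proof.
move=> [M fM].
have [r rE] : exists r : R, `|c| ^+ 2 = r%:C%C.
  by exists (complex.Re (`|c| ^+ 2)); rewrite RRe_real ?ger0_real ?exprn_ge0.
exists (r * M) => A; rewrite (_ : (r * M)%:C%C = `|c| ^+ 2 * M%:C%C); last first.
  by rewrite rE; exact: rmorphM.
under eq_bigr do rewrite normrZ exprMn.
by rewrite -mulr_sumr ler_wpM2l ?exprn_ge0.
Qed.

End SquareSummable.

Section HilbertSum.
Context {R : realType} {I : choiceType} {E : preHilbertType R}.

Definition hsum_pred : {pred I -> E} :=
  mem [set f | square_summable setT f].

Lemma hsum_predP f : reflect (square_summable setT f) (f \in hsum_pred).
Proof. by apply: (iffP idP); rewrite inE. Qed.

Lemma hsum_submod_closed : submod_closed hsum_pred.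
Proof.
split=> [|c f g /hsum_predP sf /hsum_predP sg]; apply/hsum_predP.
  exact: square_summable0.
by apply: square_summableD => //; exact: square_summableZ.
Qed.

HB.instance Definition _ :=
  GRing.isSubmodClosed.Build _ _ hsum_pred hsum_submod_closed.

(* The Hilbert space direct sum of copies of E indexed by I. *)
Record hsum := Hsum { hsum_fun :> I -> E ; _ : hsum_fun \in hsum_pred }.

HB.instance Definition _ := [isSub for hsum_fun].
HB.instance Definition _ := [Choice of hsum by <:].
HB.instance Definition _ := [SubChoice_isSubLmodule of hsum by <:].

Lemma hsumP (f : hsum) : square_summable setT f.
Proof. exact/hsum_predP/(valP f). Qed.

Definition hsum_dot (f g : hsum) : R[i] :=
  usum setT (fun i => dotp (f i) (g i)).

Lemma normr_dotp (x y : E) : `|dotp x y| <= `|x| * `|y|.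
Proof.
rewrite -ler_sqr ?nnegrE ?mulr_ge0// exprMn -!dotp_norm.
exact: dot_cauchy_schwarz.
Qed.

Lemma hsum_dot_cvg (f g : hsum) :
  psum setT (fun i => dotp (f i) (g i)) A @[A --> totally] -->
  (hsum_dot f g : R[i]^o).
Proof.
suff : usummable setT (fun i => dotp (f i) (g i)) by [].
apply: abs_usummable.
have [M fM] := hsumP f; have [N gN] := hsumP g; exists (M + N) => A.
rewrite rmorphD/=; apply: le_trans (lerD (fM A) (gN A)).
rewrite -big_split/=; apply: ler_sum => i _.
apply: le_trans (normr_dotp _ _) _.
have r (x : E) : `|x| \is Num.real by exact: ger0_real.
have := real_exprn_even_ge0 (n := 2) (rpredB (r (f i)) (r (g i))) isT.
rewrite sqrrB -addrAC subr_ge0; apply: le_trans.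
by rewrite mulr2n lerDl mulr_ge0.
Qed.

Let hsum_dot_linear (h : hsum) : linear_for *%R (hsum_dot^~ h).
Proof.
move=> c f g; apply: usumP.
rewrite (_ : (fun i => _) =
    fun i => c * dotp (f i) (h i) + dotp (g i) (h i)); last first.
  by apply/funext => i /=; rewrite linearDl/= linearZl_LR.
exact: cvg_usumD (cvg_usumZ (c := c) (@hsum_dot_cvg f h)) (@hsum_dot_cvg g h).
Qed.

Let hsum_dot_conj f g : hsum_dot f g = (hsum_dot g f)^*.
Proof.
apply: usumP; rewrite (_ : (fun i => _) = fun i => (dotp (g i) (f i))^*).
  exact: cvg_usum_conj (@hsum_dot_cvg g f).
by apply/funext => i; rewrite [LHS]hermC expr0 mul1r.
Qed.

Let hsum_dot_gt0 (f : hsum) : f != 0 -> 0 < hsum_dot f f.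
Proof.
move=> f0; have [M fM] := hsumP f.
pose r i : R := complex.Re (`|f i| ^+ 2).
have rE i : (r i)%:C%C = `|f i| ^+ 2.
  by rewrite /r RRe_real ?ger0_real ?exprn_ge0.
have r0 i : 0 <= r i by rewrite -lecR rE exprn_ge0.
have rM (A : {fset I}) : \sum_(i <- A | i \in setT) r i <= M.
  rewrite -lecR (rmorph_sum (real_complex R)) (le_trans _ (fM A))//.
  by apply: ler_sum => i _; rewrite -rE.
have rs := @cvg_nneg_usum R I setT r (fun i _ => r0 i) (ex_intro _ M rM).
rewrite /hsum_dot (_ : (fun i => _) = fun i => (r i)%:C%C); last first.
  by apply/funext => i; rewrite rE dotp_norm.
rewrite (usumP rs) ltcR.
have [j fj] : exists j, f j != 0.
  apply: contrapT => /forallNP fj; move/eqP: f0; apply.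
  apply/val_inj/funext => j /=.
  by apply/eqP; move: (fj j) => /negP; rewrite negbK.
apply: (@lt_le_trans _ _ (r j)).
  by rewrite -ltcR rE exprn_gt0// normr_gt0.
apply: ub_le_sup; first by exists M => _ [A _ <-]; exact: rM.
exists [fset j]%fset => //=; under eq_bigl do rewrite in_setT.
exact: big_seq_fset1.
Qed.

HB.instance Definition _ := Lmodule_isPreHilbert.Build R hsum
  hsum_dot_linear hsum_dot_conj hsum_dot_gt0.

Lemma hsum_dotpE (f g : hsum) :
  dotp f g = usum setT (fun i => dotp (f i) (g i)).
Proof. by []. Qed.

End HilbertSum.
Arguments hsum {R} I E.

Section L2.
Context {d : measure_display} {X : measurableType d} {R : realType}.
Variable mu : {measure set X -> \bar R}.

(* Measurability and square integrability of a complex function are those of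
   its real and imaginary parts. *)
Definition L2fun_pred : {pred X -> R[i]^o} :=
  [pred f | ((fun x => complex.Re (f x)) \in Lfun mu 2%:E) &&
            ((fun x => complex.Im (f x)) \in Lfun mu 2%:E)].

Lemma L2fun_submod_closed : submod_closed L2fun_pred.
Proof.
have p1 : (1 <= 2%:E :> \bar R)%E by rewrite lee_fin ler1n.
have [L0 Ll] := @Lfun_submod_closed _ X R mu _ p1.
split=> [|c f g /andP[rf imf] /andP[rg img]]; first by apply/andP; split; exact: L0.
apply/andP; split.
- rewrite (_ : (fun x => _) = complex.Re c *: (fun x => complex.Re (f x)) +
      (- complex.Im c *: (fun x => complex.Im (f x)) + (fun x => complex.Re (g x)))).
    by apply: (Ll) => //; exact: (Ll).
  apply/funext => x /=; rewrite !fctE/=.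
  by case: c (f x) (g x) => [a b] [p q] [r s]/=; rewrite addrA -[- b *: q]/(- b * q) mulNr.
- rewrite (_ : (fun x => _) = complex.Re c *: (fun x => complex.Im (f x)) +
      (complex.Im c *: (fun x => complex.Re (f x)) + (fun x => complex.Im (g x)))).
    by apply: (Ll) => //; exact: (Ll).
  apply/funext => x /=; rewrite !fctE/=.
  by case: c (f x) (g x) => [a b] [p q] [r s]/=; rewrite addrA.
Qed.

HB.instance Definition _ :=
  GRing.isSubmodClosed.Build _ _ L2fun_pred L2fun_submod_closed.

Record L2fun := MkL2fun { L2fun_fun :> X -> R[i]^o ; _ : L2fun_fun \in L2fun_pred }.

HB.instance Definition _ := [isSub for L2fun_fun].
HB.instance Definition _ := [Choice of L2fun by <:].
HB.instance Definition _ := [SubChoice_isSubLmodule of L2fun by <:].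

Definition ae_eq_L2 (f g : L2fun) : bool :=
  `[< {ae mu, forall x, f x = g x} >].

Let ae_eq_L2_refl : reflexive ae_eq_L2.
Proof. by move=> f; apply/asboolP; exact: nearW. Qed.

Let ae_eq_L2_sym : symmetric ae_eq_L2.
Proof.
by move=> f g; apply/asboolP/asboolP; apply: filterS => x.
Qed.

Let ae_eq_L2_trans : transitive ae_eq_L2.
Proof.
move=> g f h /asboolP fg /asboolP gh; apply/asboolP.
by apply: filterS2 fg gh => x -> ->.
Qed.

Canonical ae_eq_L2_equiv :=
  EquivRel ae_eq_L2 ae_eq_L2_refl ae_eq_L2_sym ae_eq_L2_trans.

Local Open Scope quotient_scope.

Definition L2 : Type := {eq_quot ae_eq_L2}.
HB.instance Definition _ := Choice.on L2.
HB.instance Definition _ := EqQuotient.on L2.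

Definition L2_to_fun (f : L2) : X -> R[i] := repr f.
Coercion L2_to_fun : L2 >-> Funclass.

Lemma L2_eqP (f g : L2fun) :
  reflect {ae mu, forall x, f x = g x} (\pi_L2 f == \pi_L2 g).
Proof. by rewrite eqquotE; exact: asboolP. Qed.

Lemma repr_L2 (f : L2fun) : {ae mu, forall x, repr (\pi_L2 f) x = f x}.
Proof. by apply/L2_eqP; rewrite reprK. Qed.

Definition L2_add (f g : L2) : L2 := \pi_L2 (repr f + repr g).
Definition L2_opp (f : L2) : L2 := \pi_L2 (- repr f).
Definition L2_scale (c : R[i]) (f : L2) : L2 := \pi_L2 (c *: repr f).

Let addE (f g : L2fun) : L2_add (\pi_L2 f) (\pi_L2 g) = \pi_L2 (f + g).
Proof.
apply/eqP/L2_eqP; have := repr_L2 f; have := repr_L2 g.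
by apply: filterS2 => x /= gx fx; rewrite !fctE gx fx.
Qed.

Let oppE (f : L2fun) : L2_opp (\pi_L2 f) = \pi_L2 (- f).
Proof.
by apply/eqP/L2_eqP; apply: filterS (repr_L2 f) => x /= fx; rewrite !fctE fx.
Qed.

Let scaleE c (f : L2fun) : L2_scale c (\pi_L2 f) = \pi_L2 (c *: f).
Proof.
by apply/eqP/L2_eqP; apply: filterS (repr_L2 f) => x /= fx; rewrite !fctE fx.
Qed.

Let addA : associative L2_add.
Proof.
elim/quotW => f; elim/quotW => g; elim/quotW => h.
by rewrite (addE g h) (addE f g) !addE addrA.
Qed.

Let addC : commutative L2_add.
Proof. by elim/quotW => f; elim/quotW => g; rewrite (addE f g) addE addrC. Qed.

Let add0 : left_id (\pi_L2 0) L2_add.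
Proof. by elim/quotW => f; rewrite addE add0r. Qed.

Let addN : left_inverse (\pi_L2 0) L2_opp L2_add.
Proof. by elim/quotW => f; rewrite (oppE f) addE addNr. Qed.

HB.instance Definition _ := GRing.isZmodule.Build L2 addA addC add0 addN.

Let scaleA a b f : L2_scale a (L2_scale b f) = L2_scale (a * b) f.
Proof. by elim/quotW: f => f; rewrite (scaleE b f) !scaleE scalerA. Qed.

Let scale1 : left_id 1 L2_scale.
Proof. by elim/quotW => f; rewrite scaleE scale1r. Qed.

Let scaleDr : right_distributive L2_scale +%R.
Proof.
move=> c; elim/quotW => f; elim/quotW => g.
rewrite -[_ + _]/(L2_add _ _) -[RHS]/(L2_add _ _) (addE f g) (scaleE c f).
by rewrite (scaleE c g) addE scaleE scalerDr.
Qed.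

Let scaleDl f : {morph L2_scale^~ f : a b / a + b}.
Proof.
move=> a b; elim/quotW: f => f.
by rewrite -[RHS]/(L2_add _ _) (scaleE a f) (scaleE b f) addE scaleE scalerDl.
Qed.

HB.instance Definition _ :=
  GRing.Zmodule_isLmodule.Build R[i] L2 scaleA scale1 scaleDr scaleDl.

Lemma L2_piD (f g : L2fun) : \pi_L2 (f + g) = \pi_L2 f + \pi_L2 g.
Proof. by rewrite -[RHS]/(L2_add _ _) addE. Qed.

Lemma L2_piZ c (f : L2fun) : \pi_L2 (c *: f) = c *: \pi_L2 f :> L2.
Proof. by rewrite -[RHS]/(L2_scale _ _) scaleE. Qed.

End L2.

Section Cintegral.
Context {d : measure_display} {X : measurableType d} {R : realType}.
Variable mu : {measure set X -> \bar R}.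
Implicit Types f g : X -> R[i].

Definition cintegral f : R[i] :=
  Complex (\int[mu]_x complex.Re (f x)) (\int[mu]_x complex.Im (f x)).

Definition cintegrable f :=
  mu.-integrable setT (EFin \o (fun x => complex.Re (f x))) /\
  mu.-integrable setT (EFin \o (fun x => complex.Im (f x))).

Lemma cintegralD f g : cintegrable f -> cintegrable g ->
  cintegral (fun x => f x + g x) = cintegral f + cintegral g.
Proof.
move=> [rf imf] [rg img]; rewrite /cintegral.
rewrite -[RHS]/(Complex _ _); congr Complex.
- rewrite -RintegralD//; apply: eq_Rintegral => x _.
  by case: (f x) (g x) => [a b] [p q].
- rewrite -RintegralD//; apply: eq_Rintegral => x _.
  by case: (f x) (g x) => [a b] [p q].
Qed.

Lemma cintegralZ c f : cintegrable f ->
  cintegral (fun x => c * f x) = c * cintegral f.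
Proof.
move=> [rf imf]; rewrite /cintegral.
case: c => a b; rewrite -[RHS]/(Complex _ _)/=; congr Complex.
- rewrite -!RintegralZl// -RintegralB//.
  + by apply: eq_Rintegral => x _; case: (f x).
  + by rewrite [X in integrable _ _ X](_ : _ = (fun x => a%:E * (EFin \o (fun x => complex.Re (f x))) x)%E)//; exact: integrableZl.
  + by rewrite [X in integrable _ _ X](_ : _ = (fun x => b%:E * (EFin \o (fun x => complex.Im (f x))) x)%E)//; exact: integrableZl.
- rewrite -!RintegralZl// -RintegralD//.
  + by apply: eq_Rintegral => x _; case: (f x).
  + by rewrite [X in integrable _ _ X](_ : _ = (fun x => a%:E * (EFin \o (fun x => complex.Im (f x))) x)%E)//; exact: integrableZl.
  + by rewrite [X in integrable _ _ X](_ : _ = (fun x => b%:E * (EFin \o (fun x => complex.Re (f x))) x)%E)//; exact: integrableZl.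
Qed.

Lemma cintegralJ f : cintegrable f ->
  cintegral (fun x => (f x)^*) = (cintegral f)^*.
Proof.
move=> [rf imf]; rewrite /cintegral -[RHS]/(Complex _ _); congr Complex.
  by apply: eq_Rintegral => x _; case: (f x).
rewrite -[RHS]mulN1r -RintegralZl//; apply: eq_Rintegral => x _.
by rewrite mulN1r; case: (f x).
Qed.

Lemma ae_eq_cintegral f g : cintegrable f -> cintegrable g ->
  {ae mu, forall x, f x = g x} -> cintegral f = cintegral g.
Proof.
move=> [rf imf] [rg img] fg; congr Complex; congr fine.
- apply: ae_eq_integral => //; try exact: (measurable_int mu).
  by apply: filterS fg => x -> _.
- apply: ae_eq_integral => //; try exact: (measurable_int mu).
  by apply: filterS fg => x -> _.
Qed.

End Cintegral.

Section L2_inner.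
Context {d : measure_display} {X : measurableType d} {R : realType}.
Variable mu : {measure set X -> \bar R}.
Implicit Types f g h : L2fun mu.

Lemma L2fun_Lfun f : (fun x => complex.Re (f x)) \in Lfun mu 2%:E /\
  (fun x => complex.Im (f x)) \in Lfun mu 2%:E.
Proof. exact/andP/(valP f). Qed.

Lemma cintegrable_L2fun f g : cintegrable mu (fun x => f x * (g x)^*).
Proof.
have [rf imf] := L2fun_Lfun f; have [rg img] := L2fun_Lfun g.
have H u v : u \in Lfun mu 2%:E -> v \in Lfun mu 2%:E ->
    mu.-integrable setT (EFin \o (u \* v)).
  by move=> u2 v2; apply/Lfun1_integrable; exact: Lfun2_mul_Lfun1.
pose rF x := complex.Re (f x); pose iF x := complex.Im (f x).
pose rG x := complex.Re (g x); pose iG x := complex.Im (g x).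
split.
- rewrite (_ : EFin \o _ =
    (EFin \o (rF \* rG)%R) \+ (EFin \o (iF \* iG)%R))%E.
    by apply: integrableD => //; exact: H.
  apply/funext => x /=; rewrite -EFinD /rF /rG /iF /iG; congr EFin.
  by case: (f x) (g x) => [a b] [p q] /=; rewrite mulrN opprK.
- rewrite (_ : EFin \o _ =
    (EFin \o (iF \* rG)%R) \- (EFin \o (rF \* iG)%R))%E.
    by apply: integrableB => //; exact: H.
  apply/funext => x /=; rewrite -EFinB /rF /rG /iF /iG; congr EFin.
  by case: (f x) (g x) => [a b] [p q] /=; rewrite mulrN addrC.
Qed.

Definition L2_dot (f g : L2 mu) : R[i] := cintegral mu (fun x => f x * (g x)^*).

Local Open Scope quotient_scope.

Let dotE f g :
  L2_dot (\pi_(L2 mu) f) (\pi_(L2 mu) g) = cintegral mu (fun x => f x * (g x)^*).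
Proof.
apply: ae_eq_cintegral; [exact: cintegrable_L2fun..|].
by apply: filterS2 (repr_L2 f) (repr_L2 g) => x <- <-.
Qed.

Let L2_dot_linear (h : L2 mu) : linear_for *%R (L2_dot^~ h).
Proof.
move=> c f g; elim/quotW: f => f; elim/quotW: g => g; elim/quotW: h => h.
have -> : c *: \pi_(L2 mu) f + \pi_(L2 mu) g = \pi_(L2 mu) (c *: f + g).
  by rewrite L2_piD L2_piZ.
rewrite !dotE -cintegralZ; last exact: cintegrable_L2fun.
have ci : cintegrable mu (fun x => c * (f x * (h x)^*)).
  rewrite (_ : (fun x => _) = fun x => (c *: f) x * (h x)^*).
    exact: cintegrable_L2fun.
  by apply/funext => x; rewrite mulrA.
rewrite -cintegralD//; last exact: cintegrable_L2fun.
congr cintegral; apply/funext => x.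
by rewrite mulrA -mulrDl.
Qed.

Let L2_dot_conj (f g : L2 mu) : L2_dot f g = (L2_dot g f)^*.
Proof.
rewrite /L2_dot -cintegralJ; last exact: cintegrable_L2fun.
congr cintegral; apply/funext => x.
by rewrite rmorphM/= conjCK mulrC.
Qed.

Let L2_dot_gt0 (f : L2 mu) : f != 0 -> 0 < L2_dot f f.
Proof.
elim/quotW: f => f; rewrite dotE => f0.
have [rf imf] := cintegrable_L2fun f f.
pose n x := complex.Re (f x) ^+ 2 + complex.Im (f x) ^+ 2.
have nE x : complex.Re (f x * (f x)^*) = n x.
  by rewrite /n; case: (f x) => a b /=; rewrite mulrN opprK.
have n0 x : 0 <= n x by rewrite addr_ge0 ?sqr_ge0.
rewrite ltcE/=; apply/andP; split.
  rewrite (_ : (fun x => _) = cst 0); last first.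
    by apply/funext => x; case: (f x) => a b /=; rewrite mulrN mulrC addNr.
  by rewrite /Rintegral integral0_eq.
rewrite lt_neqAle Rintegral_ge0 ?andbT; last by move=> x _; rewrite nE.
apply/negP => /eqP int0; move/negP: f0; apply.
apply/L2_eqP.
have : (\int[mu]_x (n x)%:E = 0)%E.
  move: int0; rewrite /Rintegral => int0.
  have /fineK fi := integrable_fin_num (@measurableT _ X) rf.
  transitivity (\int[mu]_x (EFin \o (fun x => complex.Re (f x * (f x)^*)%R)) x)%E.
    by apply: eq_integral => x _ /=; rewrite nE.
  by rewrite -fi -[fine _]int0.
move=> int0'.
have mn : measurable_fun setT (EFin \o n : X -> \bar R).
  rewrite (_ : n = fun x => complex.Re (f x * (f x)^*)).
    exact: (measurable_int mu).
  by apply/funext => x; rewrite nE.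
have /(ae_eq_integral_abs mu measurableT mn) : (\int[mu]_x `|(EFin \o n) x| = 0)%E.
  by rewrite -int0'; apply: eq_integral => x _ /=; rewrite ger0_norm.
apply: filterS => x /= /(_ I) [] /eqP.
rewrite paddr_eq0 ?sqr_ge0// !sqrf_eq0 => /andP[/eqP rx /eqP ix].
by case: (f x) rx ix => a b /= -> ->.
Qed.

HB.instance Definition _ := Lmodule_isPreHilbert.Build R (L2 mu)
  L2_dot_linear L2_dot_conj L2_dot_gt0.

Lemma L2_dotpE (f g : L2 mu) :
  dotp f g = cintegral mu (fun x => L2_to_fun f x * (L2_to_fun g x)^*).
Proof. by []. Qed.

End L2_inner.

Section HilbertSumMaps.
Context {R : realType} {I : choiceType}.

Lemma hsum_single_subproof (E : preHilbertType R) (j : I) (u : E) :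
  (fun i => if i == j then u else 0) \in hsum_pred.
Proof.
apply/hsum_predP.
have [r rE] : exists r : R, `|u| ^+ 2 = r%:C%C.
  by exists (complex.Re (`|u| ^+ 2)); rewrite RRe_real ?ger0_real ?exprn_ge0.
exists r => A; rewrite -rE.
under eq_bigl do rewrite in_setT.
have [jA|jA] := boolP (j \in A).
  rewrite (big_fsetD1 j)//= eqxx big1_fset ?addr0// => i.
  by rewrite !inE => /andP[/negbTE -> _] _; rewrite normr0 expr0n.
rewrite big1_fset ?exprn_ge0// => i iA _.
case: eqVneq => [ij|_]; last by rewrite normr0 expr0n.
by move: jA; rewrite -ij iA.
Qed.

Definition hsum_single (E : preHilbertType R) (j : I) (u : E) : hsum I E :=
  Hsum (hsum_single_subproof j u).

Lemma hsum_map_subproof (E F : preHilbertType R) (f : {linear E -> F})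
    (fc : continuous f) (psi : hsum I E) :
  (fun i => f (psi i)) \in hsum_pred.
Proof.
have [r r0 fr] : exists2 r : R[i], 0 < r & forall x, `|f x| <= r * `|x|.
  have /linear_boundedP/pinfty_ex_gt0[r r0 fr] :=
    (linear_bounded_continuous f).2 fc.
  by exists r.
have [s sE] : exists s : R, r ^+ 2 = s%:C%C.
  by exists (complex.Re (r ^+ 2)); rewrite RRe_real// ger0_real// exprn_ge0// ltW.
apply/hsum_predP; have [M psiM] := hsumP psi; exists (s * M) => A.
rewrite (_ : (s * M)%:C%C = r ^+ 2 * M%:C%C); last by rewrite sE; exact: rmorphM.
apply: le_trans (ler_wpM2l _ (psiM A)); last by rewrite exprn_ge0// ltW.
rewrite mulr_sumr; apply: ler_sum => i _.
by rewrite -exprMn ler_pXn2r ?nnegrE ?mulr_ge0// ltW.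
Qed.

Definition hsum_map (E F : preHilbertType R) (f : {linear E -> F})
    (fc : continuous f) (psi : hsum I E) : hsum I F :=
  Hsum (hsum_map_subproof fc psi).

End HilbertSumMaps.

Notation ell2 R I := (hsum I R[i]^o).

Section HilbertBases.
Context {R : realType} {E : preHilbertType R}.

Definition orthocomplement (Y : set E) : set E :=
  [set z | forall y, Y y -> dotp z y = 0].

Definition hilbert_basis {I : choiceType} (J : set I) (v : I -> E) (Y : set E) :=
  (forall i j, J i -> J j -> dotp (v i) (v j) = (i == j)%:R) /\
  closure [set x | exists (A : {fset I}) (c : I -> R[i]),
                     x = \sum_(i <- A | i \in J) c i *: v i] = Y.

End HilbertBases.

Section Semigroups.
Context {R : realType} {H : normedModType R[i]}.

(* T t is only relevant for 0 <= t. *)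
Record C0_semigroup (T : R -> H -> H) : Prop := {
  semigroup_linear : forall t, 0 <= t -> linear (T t) ;
  semigroup_bounded : forall t, 0 <= t -> continuous (T t) ;
  semigroup0 : forall x, T 0 x = x ;
  semigroupD : forall s t x, 0 <= s -> 0 <= t -> T (s + t) x = T s (T t x) ;
  semigroup_cvg : forall x, T t x @[t --> 0^'+] --> x
}.

(* Unbounded operators are represented by their graphs. *)
Definition generator (T : R -> H -> H) : set (H * H) :=
  [set xy | (t^-1)%:C%C *: (T t xy.1 - xy.1) @[t --> 0^'+] --> xy.2].

End Semigroups.

Notation sesquilinear_form R V :=
  {bilinear V -> V -> R[i] | *%R & (@Num.conj R[i] \; *%R)}.

(* V is continuously embedded in H by emb. *)
Section Forms.
Context {R : realType} {V H : preHilbertType R}.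
Variables (emb : V -> H) (a : V -> V -> R[i]).

Definition form_continuous :=
  exists M : R, forall psi psi', `|a psi psi'| <= M%:C%C * `|psi| * `|psi'|.

Definition form_elliptic :=
  exists2 alpha : R, 0 < alpha & exists omega : R, forall psi,
    alpha%:C%C * `|psi| ^+ 2 <= 'Re (a psi psi) + omega%:C%C * `|emb psi| ^+ 2.

Definition form_operator : set (H * H) :=
  [set xy | exists psi f, [/\ xy.1 = emb psi,
    forall psi', a psi psi' = dotp f (emb psi') & xy.2 = - f]].

End Forms.

(* a_ij(u, v), where u is in the j-th summand and v in the i-th one. *)
Definition form_entry {R : realType} {I : choiceType} {V0 : preHilbertType R}
    (a : hsum I V0 -> hsum I V0 -> R[i]) (i j : I) (u v : V0) : R[i] :=
  a (hsum_single j u) (hsum_single i v).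

(* As the index set I is countable in all uses, this does not depend on the
   representatives of the classes psi i. *)
Definition pointwise_in {d} {X : measurableType d} {R : realType}
    (mu : {measure set X -> \bar R}) {I : choiceType} (Y : set (ell2 R I)) :
    set (hsum I (L2 mu)) :=
  [set psi : hsum I (L2 mu) |
    {ae mu, forall x, exists2 y, Y y & forall i, y i = L2_to_fun (psi i) x}].
Arguments pointwise_in {d X R} mu {I} Y.

(* The index sets {1, ..., n} with 1 <= n (as Some n.-1), and N (as None). *)
Definition index_type (m : option nat) : countType :=
  if m is Some m then 'I_m.+1 : countType else nat.

(* Main.v *)
(* Fixing the basis v, a function psi in H lies in the space of Y-valued
   functions if and only if it is orthogonal to all products v_k (x) g with k in
   I'', and H is the orthogonal sum of this space P and of Q, defined likewise by
   I'; the same holds in V, and the embedding of V in H respects the two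
   decompositions. Expanding vectors of V along v identifies the iterated sum
   in (b) with a(w, w'), where w and w' range over the P- and Q-parts of V.

   If a vanishes there, then for x in the domain of the generator the component
   z(t) of T(t)x in Q satisfies (|z|^2)' <= 2 omega |z|^2 by ellipticity, so
   |z(t)| <= e^(omega t) |z(0)|; as the domain is dense by the Lax-Milgram lemma,
   T(t) leaves P invariant. Conversely, if P is invariant, the solutions u_lam of
   a(u_lam, v) + lam (u_lam | v) = lam (w | v) for w in P lie in P, whence
   a(u_lam, w') = lam (w - u_lam | w') = 0 for w' in Q, and u_lam tends weakly to
   w in V as lam tends to infinity.

   No integral of the semigroup is needed, but its local boundedness is: this is
   where the completeness of L2 and the uniform boundedness principle enter. *)
Require Import Defs.
From HB Require Import structures.
From mathcomp Require Import all_boot all_order all_algebra finmap.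
From mathcomp Require Import sesquilinear complex.
From mathcomp Require Import mathcomp_extra boolp classical_sets functions reals.
From mathcomp Require Import ereal topology normedtype sequences.
From mathcomp Require Import measure measurable_realfun lebesgue_measure.
From mathcomp Require Import lebesgue_integral hoelder.
From mathcomp.analysis Require Import summability.
From mathcomp Require Import exp ring lra.

Set Implicit Arguments.
Unset Strict Implicit.
Unset Printing Implicit Defensive.

Import Order.TTheory GRing.Theory Num.Theory.
Import numFieldNormedType.Exports.

Local Open Scope classical_set_scope.
Local Open Scope ring_scope.

(** * Norms and inner products with real values *)

(** Having values in Y must make sense in V, whose norm knows nothing of points of X. Tested against
    products, membership passes from V to H because a test vector g of L2 can be replaced by its
    image under the adjoint of the embedding, which Riesz provides.

    The generator is a limit from the right only, so orbits have just right derivatives. The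
    differential inequalities therefore rest on a monotonicity criterion that also asks for
    continuity from the left, and this is one use of the local bound on the semigroup; the other is
    to carry estimates from the dense domain to all of H.

    That the resolvent preserves P is usually read off from the Laplace transform; here growth rates
    are compared instead. The weak limit is replaced by norm limits of near-minimisers in convex
    sets. *)

Section RealNorm.
Context {R : realType}.

(* The norm of a normed module over R[i] takes its values in R[i]; [rnorm] and
   [cabs] are the same numbers in R, where [lra] and [nra] apply. *)
Definition rnorm {V : normedModType R[i]} (x : V) : R := complex.Re `|x|.

Definition cabs (z : R[i]) : R := complex.Re `|z|.

Lemma cabsE z : (cabs z)%:C%C = `|z|.
Proof. by rewrite /cabs RRe_real. Qed.

Lemma cabs_ge0 z : 0 <= cabs z.
Proof. by rewrite -lecR cabsE normr_ge0. Qed.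

Lemma rnormE (V : normedModType R[i]) (x : V) : (rnorm x)%:C%C = `|x|.
Proof. by rewrite /rnorm RRe_real. Qed.

Lemma rnorm_ge0 (V : normedModType R[i]) (x : V) : 0 <= rnorm x.
Proof. by rewrite -lecR rnormE normr_ge0. Qed.

Lemma rnormD (V : normedModType R[i]) (x y : V) : rnorm (x + y) <= rnorm x + rnorm y.
Proof. by rewrite -lecR rmorphD/= !rnormE ler_normD. Qed.

Lemma rnormN (V : normedModType R[i]) (x : V) : rnorm (- x) = rnorm x.
Proof. by rewrite /rnorm normrN. Qed.

Lemma rnorm0 (V : normedModType R[i]) : rnorm (0 : V) = 0.
Proof. by rewrite /rnorm normr0. Qed.

Lemma rnorm_eq0 (V : normedModType R[i]) (x : V) : rnorm x = 0 -> x = 0.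
Proof. by move=> x0; apply/eqP; rewrite -normr_eq0 -rnormE x0. Qed.

Lemma rnorm_distC (V : normedModType R[i]) (x y : V) : rnorm (x - y) = rnorm (y - x).
Proof. by rewrite -rnormN opprB. Qed.

Lemma rnorm_dist (V : normedModType R[i]) (x y z : V) :
  rnorm (x - z) <= rnorm (x - y) + rnorm (y - z).
Proof. by rewrite (le_trans _ (rnormD _ _))// addrA subrK. Qed.

Lemma rnorm_leB (V : normedModType R[i]) (x y : V) :
  `|rnorm x - rnorm y| <= rnorm (x - y).
Proof.
have h (u w : V) : rnorm u - rnorm w <= rnorm (u - w).
  by rewrite lerBlDr (le_trans _ (rnormD _ _))// subrK.
by rewrite ler_norml h andbT lerNl opprB rnorm_distC h.
Qed.

Lemma rnormZ (V : normedModType R[i]) (c : R[i]) (x : V) :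
  rnorm (c *: x) = cabs c * rnorm x.
Proof.
have : (rnorm (c *: x))%:C%C = (cabs c * rnorm x)%:C%C.
  by rewrite rnormE normrZ -cabsE -rnormE; exact/esym/rmorphM.
by case.
Qed.

Lemma cabsM (c z : R[i]) : cabs (c * z) = cabs c * cabs z.
Proof. exact: (@rnormZ R[i]^o c z). Qed.

Lemma cabs_real (r : R) : cabs (r%:C%C) = `|r|.
Proof. by rewrite /cabs normc_def/= expr0n/= addr0 sqrtr_sqr. Qed.

Lemma cabs0 : cabs 0 = 0.
Proof. by rewrite /cabs normr0. Qed.

Lemma cabs_conj (z : R[i]) : cabs (z^*) = cabs z.
Proof. by rewrite /cabs norm_conjC. Qed.

Lemma rnormZr (V : normedModType R[i]) (r : R) (x : V) :
  rnorm (r%:C%C *: x) = `|r| * rnorm x.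
Proof. by rewrite rnormZ cabs_real. Qed.

Lemma rnorm_sum (V : normedModType R[i]) (I : Type) (s : seq I) (P : pred I) (f : I -> V) :
  rnorm (\sum_(i <- s | P i) f i) <= \sum_(i <- s | P i) rnorm (f i).
Proof.
elim/big_rec2: _ => [|i y x _ xy]; first by rewrite rnorm0.
by rewrite (le_trans (rnormD _ _))// lerD2l.
Qed.

Lemma Re_le_cabs (z : R[i]) : `|complex.Re z| <= cabs z.
Proof. by rewrite -lecR cabsE normc_ge_Re. Qed.

Lemma cabs_sqrE (z : R[i]) : cabs z ^+ 2 = complex.Re z ^+ 2 + complex.Im z ^+ 2.
Proof.
have : (cabs z ^+ 2)%:C%C = (complex.Re z ^+ 2 + complex.Im z ^+ 2)%:C%C.
  by rewrite add_Re2_Im2 -cabsE; exact: rmorphXn.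
by case.
Qed.

Lemma cvg_rnormP (T : Type) (F : set_system T) {FF : Filter F}
    (V : normedModType R[i]) (f : T -> V) (l : V) :
  f @ F --> l <-> forall e : R, 0 < e -> \forall x \near F, rnorm (l - f x) < e.
Proof.
split=> [/cvgrPdist_lt fl e e0|fl].
  have := fl e%:C%C; rewrite ltcR => /(_ e0).
  by apply: filterS => x; rewrite -rnormE ltcR.
apply/cvgrPdist_lt => e e0.
have eE : e = (complex.Re e)%:C%C by rewrite RRe_real// gtr0_real.
move: e0; rewrite eE ltcR => /fl.
by apply: filterS => x; rewrite -rnormE ltcR.
Qed.

Lemma cvg_rnorm (T : Type) (F : set_system T) {FF : Filter F}
    (V : normedModType R[i]) (f : T -> V) (l : V) :
  f @ F --> l -> rnorm (f x) @[x --> F] --> rnorm l.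
Proof.
move=> /cvg_rnormP fl; apply/cvgrPdist_lt => e /fl.
by apply: filterS => x; apply: le_lt_trans; exact: rnorm_leB.
Qed.

Lemma cvg_le_rnorm (T : Type) (F : set_system T) {FF : Filter F}
    (V : normedModType R[i]) (f : T -> V) (l : V) (g : T -> R) :
  (\forall x \near F, rnorm (l - f x) <= g x) -> g @ F --> (0 : R) -> f @ F --> l.
Proof.
move=> fg /cvgrPdist_lt g0; apply/cvg_rnormP => e /g0.
apply: filterS2 fg => x fg; rewrite sub0r normrN => ge.
by rewrite (le_lt_trans fg)// (le_lt_trans (ler_norm _)).
Qed.

(** A predicate rather than a structure: completeness of [L2] and of [hsum] is proved below and
    passed on as a hypothesis, with real epsilons. *)
Definition seq_complete (V : normedModType R[i]) := forall u : nat -> V,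
  (forall e : R, 0 < e -> exists N, forall n m, (N <= n)%N -> (N <= m)%N ->
    rnorm (u n - u m) < e) -> cvg (u n @[n --> \oo]).

Lemma complete_seq_complete (V : completeNormedModType R[i]) : seq_complete V.
Proof.
move=> u uc; apply: cauchy_cvg; apply/cauchy_ballP => e e0.
have eE : e = (complex.Re e)%:C%C by rewrite RRe_real// gtr0_real.
move: e0; rewrite eE ltcR => /uc[N Ne].
exists (u @` [set n | (N <= n)%N], u @` [set n | (N <= n)%N]) => /=.
  by split; exists N => // n Nn; exists n.
move=> [_ _] /= [[n Nn <-] [m Nm <-]].
by rewrite -ball_normE /ball_/= -rnormE ltcR; exact: Ne.
Qed.

Lemma cvg_cauchy_seq (V : normedModType R[i]) (u : nat -> V) (l : V) :
  u n @[n --> \oo] --> l ->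
  forall e : R, 0 < e -> exists N, forall n m, (N <= n)%N -> (N <= m)%N ->
    rnorm (u n - u m) < e.
Proof.
move=> ul e e0; have e2 : 0 < e / 2 by rewrite divr_gt0.
have /cvg_rnormP/(_ _ e2)[N _ NP] := ul; exists N => n m /NP /= nl /NP /= ml.
rewrite (le_lt_trans (rnorm_dist _ l _))// rnorm_distC; lra.
Qed.

(** Needed for limits along finite subsets. Sets on which f oscillates by less than 1/(n+1) are
    intersected to decreasing ones; points chosen in them give a Cauchy sequence, whose limit is
    that of the net. *)
Lemma seq_complete_net (V : normedModType R[i]) (T : Type) (F : set_system T)
    {FF : ProperFilter F} (f : T -> V) : seq_complete V ->
  (forall e : R, 0 < e ->
     exists2 A, F A & forall x y, A x -> A y -> rnorm (f x - f y) < e) ->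
  cvg (f x @[x --> F]).
Proof.
move=> Vc fc.
have /choice[A AP] n : exists A, F A /\
    forall x y, A x -> A y -> rnorm (f x - f y) < n.+1%:R^-1.
  have n0 : (0 : R) < n.+1%:R^-1 by rewrite invr_gt0.
  by have [A ? ?] := fc _ n0; exists A.
pose B n := \bigcap_(k in `I_n.+1) A k.
have FB n : F (B n).
  elim: n => [|n ih].
    rewrite /B (_ : `I_1 = [set 0%N]) ?bigcap_set1; first by have [] := AP 0%N.
    by apply/seteqP; split => k /=; rewrite ltnS leqn0 => /eqP.
  apply: filterS (filterI ih (AP n.+1).1) => x [Bx Ax] k /=.
  by rewrite ltnS leq_eqVlt => /predU1P[->//|kn]; exact: Bx.
have BA k n x : (k <= n)%N -> B n x -> A k x by move=> kn; apply; rewrite /= ltnS.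
have /choice[x Bx] n : exists x, B n x by exact: filter_ex (FB n).
have small (e : R) : 0 < e -> exists N, forall n, (N <= n)%N -> n.+1%:R^-1 < e.
  move=> e0; have /cvgrPdist_lt/(_ _ e0)[N _ NP] := @cvg_harmonic R.
  exists N => n /NP; rewrite /harmonic/= sub0r normrN ger0_norm//.
have /cvg_ex[l ul] : cvg (f (x n) @[n --> \oo]).
  apply: Vc => e /small[N NP]; exists N => n m Nn Nm.
  rewrite (lt_trans _ (NP _ (leqnn N)))//; apply: (AP N).2.
    exact: BA (Bx n).
  exact: BA (Bx m).
apply/cvg_ex; exists l; apply/cvg_rnormP => e e0.
have e2 : 0 < e / 2 by rewrite divr_gt0.
have [N NP] := small _ e2; have /cvg_rnormP/(_ _ e2)[M _ MP] := ul.
apply: filterS (FB N) => y By.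
have := MP (maxn N M) (leq_maxr _ _); rewrite /= => lx.
have xy := (AP N).2 (x (maxn N M)) y (BA _ _ _ (leq_maxl _ _) (Bx _)) (BA _ _ _ (leqnn _) By).
rewrite (le_lt_trans (rnorm_dist _ (f (x (maxn N M))) _))// [e]splitr ltrD//.
exact: lt_trans xy (NP N (leqnn _)).
Qed.

Lemma cvg_unique_norm (T : Type) (F : set_system T) {FF : ProperFilter F}
    (V : normedModType R[i]) (f : T -> V) (l k : V) :
  f @ F --> l -> f @ F --> k -> l = k.
Proof.
by move=> fl fk; exact: (cvg_unique (@norm_hausdorff _ _) fl fk).
Qed.

Lemma continuous_linear_rnorm (V W : normedModType R[i]) (f : V -> W) :
  linear f -> continuous f -> exists2 M : R, 0 < M & forall x, rnorm (f x) <= M * rnorm x.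
Proof.
move=> fl fc.
pose g : {linear V -> W} := HB.pack f (GRing.isLinear.Build _ _ _ _ _ fl).
have /linear_boundedP/pinfty_ex_gt0[r r0 fr] :=
    (linear_bounded_continuous g).2 fc.
have rE : r = (complex.Re r)%:C%C by rewrite RRe_real// gtr0_real.
move: r0 fr; rewrite rE ltcR => r0 fr.
exists (complex.Re r) => // x; rewrite -lecR rnormE (le_trans (fr x))//.
by rewrite -rnormE [leRHS]rmorphM.
Qed.

Lemma rnorm_continuous_linear (V W : normedModType R[i]) (f : V -> W) (M : R) :
  (forall x y, f (x - y) = f x - f y) ->
  (forall x, rnorm (f x) <= M * rnorm x) -> continuous f.
Proof.
move=> fB fM x; apply: (@cvg_le_rnorm _ _ _ _ _ _ (fun y => M * rnorm (x - y))).
  by apply: nearW => y; rewrite -fB.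
rewrite -[X in _ --> X](mulr0 M); apply: cvgMr.
have -> : (0 : R) = rnorm (x - x) by rewrite subrr rnorm0.
by apply: cvg_rnorm; apply: cvgB; [exact: cvg_cst|exact: cvg_id].
Qed.

Lemma cvg_le_rnorm_bound (T : Type) (F : set_system T) {FF : ProperFilter F}
    (V : normedModType R[i]) (f : T -> V) (l : V) (M : R) :
  f @ F --> l -> (\forall x \near F, rnorm (f x) <= M) -> rnorm l <= M.
Proof.
move=> /cvg_rnorm fl fM; have <- := cvg_lim (@Rhausdorff R) fl.
by apply: limr_le => //; apply: cvgP fl.
Qed.

End RealNorm.

Section RealDot.
Context {R : realType} {W : preHilbertType R}.
Implicit Types x y z : W.

Definition rdot x y : R := complex.Re (dotp x y).

Lemma dotpDl x y z : dotp (x + y) z = dotp x z + dotp y z.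
Proof. exact: linearDl. Qed.
Lemma dotpDr x y z : dotp x (y + z) = dotp x y + dotp x z.
Proof. exact: linearD. Qed.
Lemma dotpBl x y z : dotp (x - y) z = dotp x z - dotp y z.
Proof. exact: linearBl. Qed.
Lemma dotpBr x y z : dotp x (y - z) = dotp x y - dotp x z.
Proof. exact: linearB. Qed.
Lemma dotpZl c x z : dotp (c *: x) z = c * dotp x z.
Proof. exact: linearZl_LR. Qed.
Lemma dotpZr c x z : dotp x (c *: z) = c^* * dotp x z.
Proof. exact: linearZr_LR. Qed.
Lemma dotp0l z : dotp 0 z = 0 :> R[i].
Proof. exact: linear0l. Qed.
Lemma dotp0r z : dotp z 0 = 0 :> R[i].
Proof. exact: linear0r. Qed.
Lemma dotpC x y : dotp x y = (dotp y x)^*.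
Proof. by rewrite [LHS]hermC expr0 mul1r. Qed.

Lemma dotp_eq0C x y : dotp x y = 0 -> dotp y x = 0.
Proof. by move=> xy; rewrite dotpC xy rmorph0. Qed.

Lemma dotp_suml (I : Type) (s : seq I) (P : pred I) (f : I -> W) z :
  dotp (\sum_(i <- s | P i) f i) z = \sum_(i <- s | P i) dotp (f i) z.
Proof.
by elim/big_rec2: _ => [|i y x _ <-]; rewrite ?dotp0l ?dotpDl.
Qed.

Lemma rdotDl x y z : rdot (x + y) z = rdot x z + rdot y z.
Proof. by rewrite /rdot dotpDl; case: (dotp x z) (dotp y z) => ? ? []. Qed.

Lemma rdotC x y : rdot x y = rdot y x.
Proof. by rewrite /rdot dotpC; case: (dotp y x). Qed.

Lemma rdotDr x y z : rdot x (y + z) = rdot x y + rdot x z.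
Proof. by rewrite rdotC rdotDl !(rdotC x). Qed.

Lemma rdotZl (r : R) x y : rdot (r%:C%C *: x) y = r * rdot x y.
Proof. by rewrite /rdot dotpZl; case: (dotp x y) => a b /=; rewrite mul0r subr0. Qed.

Lemma rdotZr (r : R) x y : rdot x (r%:C%C *: y) = r * rdot x y.
Proof. by rewrite rdotC rdotZl rdotC. Qed.

Lemma rdotNl x y : rdot (- x) y = - rdot x y.
Proof. by have := rdotZl (-1) x y; rewrite rmorphN rmorph1 scaleN1r mulN1r. Qed.

Lemma rdotNr x y : rdot x (- y) = - rdot x y.
Proof. by rewrite rdotC rdotNl rdotC. Qed.

Lemma rdotxx x : rdot x x = rnorm x ^+ 2.
Proof.
have : (rdot x x)%:C%C = (rnorm x ^+ 2)%:C%C.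
  rewrite (rmorphXn (real_complex R)) /= rnormE -dotp_norm /rdot.
  by rewrite RRe_real// dotp_norm rpredX// ger0_real.
by case.
Qed.

Lemma dotpxx x : dotp x x = (rnorm x ^+ 2)%:C%C :> R[i].
Proof. by rewrite (rmorphXn (real_complex R)) /= rnormE dotp_norm. Qed.

Lemma rnorm_sqrD x y :
  rnorm (x + y) ^+ 2 = rnorm x ^+ 2 + 2 * rdot x y + rnorm y ^+ 2.
Proof. by rewrite -!rdotxx !rdotDl !rdotDr (rdotC y x); ring. Qed.

Lemma rnorm_sqrB x y :
  rnorm (x - y) ^+ 2 = rnorm x ^+ 2 - 2 * rdot x y + rnorm y ^+ 2.
Proof. by rewrite rnorm_sqrD rdotNr rnormN; ring. Qed.

Lemma cabs_dotp x y : cabs (dotp x y) <= rnorm x * rnorm y.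
Proof.
by rewrite -lecR cabsE rmorphM/= !rnormE; exact: normr_dotp.
Qed.

Lemma ler_rdot x y : `|rdot x y| <= rnorm x * rnorm y.
Proof. by rewrite (le_trans (Re_le_cabs _))// cabs_dotp. Qed.

Lemma dotp_cvgl (T : Type) (F : set_system T) {FF : Filter F} (f : T -> W) l z :
  f @ F --> l -> dotp (f t) z @[t --> F] --> (dotp l z : R[i]^o).
Proof.
move=> fl; have c : continuous (fun x => dotp x z : R[i]^o).
  apply: (@rnorm_continuous_linear _ _ _ _ (rnorm z)) => [x y|x].
    exact: dotpBl.
  by rewrite mulrC; exact: cabs_dotp.
exact: (cvg_comp _ _ fl (c l)).
Qed.

Lemma dotp_eq0 x : (forall y, dotp x y = 0 :> R[i]) -> x = 0.
Proof.
move=> x0; apply: rnorm_eq0; apply/eqP.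
by rewrite -sqrf_eq0 -rdotxx /rdot x0.
Qed.

End RealDot.

(** * Hilbert spaces *)

Section HilbertSpace.
Context {R : realType}.

Lemma rnorm_sqr_midpoint (W : preHilbertType R) (x y : W) :
  rnorm (x - y) ^+ 2 = 2 * (rnorm x ^+ 2 + rnorm y ^+ 2)
    - 4 * rnorm ((2^-1 : R)%:C%C *: (x + y)) ^+ 2.
Proof.
rewrite rnormZr exprMn rnorm_sqrB rnorm_sqrD ger0_norm ?invr_ge0//.
by rewrite exprVn; field.
Qed.

(* Near-minimisers of the norm in decreasing midpoint-convex sets form a Cauchy
   sequence, by the parallelogram identity; the sets need not be closed. *)
Lemma nested_minimizer (W : preHilbertType R) (C : nat -> set W) (B : R) :
  seq_complete W ->
  (forall n m, (n <= m)%N -> C m `<=` C n) ->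
  (forall n x y, C n x -> C n y -> C n ((2^-1 : R)%:C%C *: (x + y))) ->
  (forall n, exists2 x, C n x & rnorm x <= B) ->
  exists x : nat -> W, [/\ forall n, C n (x n),
    forall n z, C n z -> rnorm (x n) ^+ 2 <= rnorm z ^+ 2 + n.+1%:R^-1 &
    cvg (x n @[n --> \oo])].
Proof.
move=> Wc Cdec Cmid CB.
pose D n := [set rnorm x ^+ 2 | x in C n].
have infD n : has_inf (D n).
  have [x Cx _] := CB n; split; first by exists (rnorm x ^+ 2), x.
  by exists 0 => _ [y _ <-]; exact: sqr_ge0.
have inf_le n z : C n z -> inf (D n) <= rnorm z ^+ 2.
  by move=> Cz; apply: ge_inf; [exact: (infD n).2|exists z].
have infB n : inf (D n) <= B ^+ 2.
  have [x Cx xB] := CB n; rewrite (le_trans (inf_le _ _ Cx))//.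
  by rewrite ler_sqr ?nnegrE ?rnorm_ge0// (le_trans _ xB)// rnorm_ge0.
have infnd n m : (n <= m)%N -> inf (D n) <= inf (D m).
  move=> nm; apply: lb_le_inf; first exact: (infD m).1.
  by move=> _ [z Cz <-]; apply: inf_le; exact: Cdec Cz.
have /choice[x xP] n : exists x, C n x /\ rnorm x ^+ 2 < inf (D n) + n.+1%:R^-1.
  have e0 : (0 : R) < n.+1%:R^-1 by rewrite invr_gt0.
  by have [_ [x Cx <-]] := inf_adherent e0 (infD n); exists x.
have dd n m : (n <= m)%N ->
    rnorm (x n - x m) ^+ 2 <= 2 * (inf (D m) - inf (D n)) + 4 * n.+1%:R^-1.
  move=> nm; have [Cn xn] := xP n; have [Cm xm] := xP m.
  have := inf_le _ _ (Cmid _ _ _ Cn (Cdec _ _ nm _ Cm)).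
  have : (m.+1%:R^-1 : R) <= n.+1%:R^-1 by rewrite lef_pV2 ?posrE// ler_nat.
  rewrite rnorm_sqr_midpoint; move: xn xm.
  move: (inf (D n)) (inf (D m)) (rnorm (x n) ^+ 2) (rnorm (x m) ^+ 2) => a b p q.
  by move: (rnorm _ ^+ 2) (n.+1%:R^-1) (m.+1%:R^-1) => *; lra.
pose s := sup (range (fun n => inf (D n))).
have sups : has_sup (range (fun n => inf (D n))).
  by split; [exists (inf (D 0)), 0|exists (B ^+ 2) => _ [n _ <-]; exact: infB].
exists x; split=> [n|n z Cz|].
- by have [] := xP n.
- have [_ /ltW xn] := xP n; rewrite (le_trans xn)// lerD2r; exact: inf_le.
- apply: Wc => e e0.
  (* The infima increase to s, so beyond N they differ by less than e^2/8, and [dd] stays below 2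
     (e^2/8) + 4 (e^2/16) = e^2/2. *)
  have e2 : 0 < e ^+ 2 / 8 by rewrite divr_gt0// exprn_gt0.
  have e4 : 0 < e ^+ 2 / 16 by rewrite divr_gt0// exprn_gt0.
  have [_ [N _ <-] sN] := sup_adherent e2 sups.
  have /cvgrPdist_lt/(_ _ e4)[M _ MP] := @cvg_harmonic R.
  have key n m : (maxn N M <= n)%N -> (n <= m)%N -> rnorm (x n - x m) < e.
    move=> n1 nm; rewrite -ltr_sqr ?nnegrE ?rnorm_ge0 ?ltW//.
    rewrite (le_lt_trans (dd _ _ nm))//.
    have Nn : (N <= n)%N by rewrite (leq_trans (leq_maxl _ _) n1).
    have h1 := infnd _ _ Nn.
    have h2 : inf (D m) <= s by apply: ub_le_sup; [exact: sups.2|exists m].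
    have := MP n (leq_trans (leq_maxr _ _) n1).
    rewrite /harmonic/= sub0r normrN ger0_norm ?invr_ge0//.
    move: e2 sN h1 h2; rewrite -/s => {e4 MP}.
    move: (inf (D n)) (inf (D m)) (inf (D N)) (n.+1%:R^-1) (e ^+ 2) s {sups}.
    by move=> *; lra.
  exists (maxn N M) => n m n1 m1; have [nm|/ltnW mn] := leqP n m; first exact: key.
  by rewrite rnorm_distC; exact: key.
Qed.

(** Testing with i k as well as k recovers the imaginary part. *)
Lemma real_orthogonal (W : preHilbertType R) (K : set W) (l : W) :
  (forall c x, K x -> K (c *: x)) -> (forall k, K k -> rdot l k = 0) ->
  forall k, K k -> dotp l k = 0.
Proof.
move=> KZ l0 k Kk; have := l0 _ (KZ 'i%C _ Kk); have := l0 _ Kk.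
rewrite /rdot dotpZr; case: (dotp l k) => a b /= ->.
by rewrite mul0r sub0r => /eqP; rewrite mulN1r opprK => /eqP ->.
Qed.

Lemma projection (W : preHilbertType R) (K : set W) (x : W) :
  seq_complete W -> K 0 -> (forall c x y, K x -> K y -> K (c *: x + y)) ->
  (forall (u : nat -> W) l, (forall n, K (u n)) -> u n @[n --> \oo] --> l -> K l) ->
  exists2 p, K p & forall k, K k -> dotp (x - p) k = 0.
Proof.
move=> Wc K0 Kl Kc; pose C (n : nat) : set W := [set x - k | k in K].
have KZ c k : K k -> K (c *: k) by move=> Kk; rewrite -[_ *: _]addr0; exact: Kl.
have [|||u [Cu umin /cvg_ex[l ul]]] := nested_minimizer (C := C) (B := rnorm x) Wc.
- by move=> n m _ z.
- move=> n _ _ [k Kk <-] [h Kh <-].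
  exists ((2^-1 : R)%:C%C *: (k + h)).
    by apply: (KZ); rewrite -[k]scale1r; exact: Kl.
  rewrite addrACA -opprD scalerBr; congr (_ - _).
  rewrite scalerDr -scalerDl -rmorphD/= (_ : 2^-1 + 2^-1 = 1 :> R); last by field.
  by rewrite rmorph1 scale1r.
- by move=> n; exists x => //; exists 0; rewrite ?subr0.
have xl : K (x - l).
  have c : x - u n @[n --> \oo] --> x - l by apply: cvgB ul; exact: cvg_cst.
  apply: Kc c => n.
  by have [k Kk <-] := Cu n; rewrite subKr.
exists (x - l) => //; rewrite subKr; apply: real_orthogonal => // k Kk.
have lmin z : C 0%N z -> rnorm l ^+ 2 <= rnorm z ^+ 2.
  move=> Cz; have cl : rnorm (u n) ^+ 2 @[n --> \oo] --> rnorm l ^+ 2.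
    by rewrite expr2; apply: cvgM; exact: cvg_rnorm.
  have cr : rnorm z ^+ 2 + n.+1%:R^-1 @[n --> \oo] --> rnorm z ^+ 2 + 0.
    by apply: cvgD; [exact: cvg_cst|exact: cvg_harmonic].
  rewrite -[leRHS]addr0; apply: ler_cvg_to cl cr _.
  by apply: nearW => n; exact: umin.
have q t : 0 <= - (2 * t * rdot l k) + t ^+ 2 * rnorm k ^+ 2.
  have : C 0%N (l - t%:C%C *: k).
    exists (t%:C%C *: k + (x - l)); first exact: Kl.
    by rewrite opprD opprB addrCA [x + _]addrC subrK addrC.
  move=> /lmin; rewrite rnorm_sqrB rdotZr rnormZr exprMn real_normK ?num_real//.
  by move=> *; lra.
(* The minimising t would be Re(l | k) / |k|^2; adding 1 to the denominator covers k = 0 and still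
   leaves a negative multiple of the square of Re(l | k). *)
have s0 : 0 < rnorm k ^+ 2 + 1 by rewrite ltr_wpDl// sqr_ge0.
have := q (rdot l k / (rnorm k ^+ 2 + 1)).
have -> : - (2 * (rdot l k / (rnorm k ^+ 2 + 1)) * rdot l k) +
    (rdot l k / (rnorm k ^+ 2 + 1)) ^+ 2 * rnorm k ^+ 2 =
    - (rdot l k ^+ 2) * ((rnorm k ^+ 2 + 2) / (rnorm k ^+ 2 + 1) ^+ 2).
  by field; rewrite gt_eqF.
rewrite pmulr_lge0; last by rewrite divr_gt0 ?exprn_gt0// ltr_wpDl// sqr_ge0.
by rewrite oppr_ge0 => h; apply/eqP; rewrite -sqrf_eq0 eq_le h sqr_ge0.
Qed.

Lemma riesz (W : preHilbertType R) (phi : W -> R[i]) (M : R) :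
  seq_complete W -> linear_for *%R phi -> (forall x, cabs (phi x) <= M * rnorm x) ->
  exists z, forall x, phi x = dotp x z.
Proof.
move=> Wc phil phiM.
have phi0 : phi 0 = 0 by have := phil (- 1) 0 0; rewrite scaler0 addr0 mulN1r addNr.
have [all0|] := pselect (forall x, phi x = 0).
  by exists 0 => x; rewrite all0 dotp0r.
move=> /existsNP[x0 /eqP x00].
have phiB x y : phi (x - y) = phi x - phi y.
  by rewrite [x - y]addrC -[- y]scaleN1r phil mulN1r addrC.
have phic : continuous (phi : W -> R[i]^o) by exact: (@rnorm_continuous_linear _ W R[i]^o phi M).
have [|||p p0 pP] := projection (K := [set x | phi x = 0]) x0 Wc.
- exact: phi0.
- by move=> c x y /= x1 y1; rewrite phil x1 y1 mulr0 add0r.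
- move=> u l /= u0 ul.
  apply: (@cvg_unique_norm R nat \oo _ R[i]^o (phi \o u)).
    exact: (cvg_comp _ _ ul (phic l)).
  rewrite (_ : _ \o _ = cst 0); first exact: cvg_cst.
  by apply/funext => n /=; rewrite u0.
set e := x0 - p in pP.
have phie : phi e != 0 by rewrite phiB p0 subr0.
have e0 : dotp e e != 0 :> R[i].
  apply: contra phie => /eqP; rewrite dotpxx => -[] /eqP.
  by rewrite sqrf_eq0 => /eqP/rnorm_eq0 ->; rewrite phi0.
exists ((phi e / dotp e e)^* *: e) => x; rewrite dotpZr conjCK.
have : phi (x - (phi x / phi e) *: e) = 0.
  by rewrite addrC -scaleNr phil mulNr divfK// addrC subrr.
move=> /pP/dotp_eq0C; rewrite dotpBl dotpZl => /eqP; rewrite subr_eq0 => /eqP ->.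
by field; rewrite phie.
Qed.

(** Riesz turns b into an operator B that is bounded below, so its range is closed; a vector
    orthogonal to the range vanishes by coercivity. *)
Lemma lax_milgram (V : preHilbertType R) (b : V -> V -> R[i]) (M alpha : R) :
  seq_complete V -> (forall v, linear_for *%R (b^~ v)) ->
  (forall u c v w, b u (c *: v + w) = c^* * b u v + b u w) ->
  (forall u v, cabs (b u v) <= M * rnorm u * rnorm v) ->
  0 < alpha -> (forall u, alpha * rnorm u ^+ 2 <= complex.Re (b u u)) ->
  forall z, exists u, forall v, b u v = dotp z v.
Proof.
move=> Vc bl br bM a0 ba z.
have /choice[B BP] u : exists w, forall v, b u v = dotp w v.
  have [||w wP] := riesz (phi := fun v => (b u v)^*) (M := M * rnorm u) Vc.
  - by move=> c v w; rewrite br rmorphD rmorphM/= conjCK.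
  - by move=> v; rewrite cabs_conj.
  by exists w => v; rewrite dotpC -wP conjCK.
have Bl c u v : B (c *: u + v) = c *: B u + B v.
  apply/eqP; rewrite -subr_eq0; apply/eqP/dotp_eq0 => y.
  by rewrite dotpBl dotpDl dotpZl -!BP bl subrr.
have BB u v : B (u - v) = B u - B v.
  by rewrite [u - v]addrC -[- v]scaleN1r Bl scaleN1r addrC.
have coer u : alpha * rnorm u <= rnorm (B u).
  have [->|/eqP u0] := eqVneq (rnorm u) 0; first by rewrite mulr0 rnorm_ge0.
  have {u0}u0 : 0 < rnorm u by rewrite lt_neqAle rnorm_ge0 andbT eq_sym; exact/eqP.
  rewrite -(ler_pM2r u0) -mulrA -expr2 (le_trans (ba u))// BP.
  by rewrite (le_trans (ler_norm _))// ler_rdot.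
have BM u : rnorm (B u) <= M * rnorm u.
  (* M is not assumed nonnegative: if B u = 0, the sign of M |u| is read off from [bM]. *)
  have [->|/eqP u0] := eqVneq (rnorm (B u)) 0.
    have [->|/eqP v0] := eqVneq (rnorm u) 0; first by rewrite mulr0.
    have {v0}v0 : 0 < rnorm u by rewrite lt_neqAle rnorm_ge0 andbT eq_sym; exact/eqP.
    by rewrite -(pmulr_lge0 _ v0) (le_trans _ (bM u u))// cabs_ge0.
  have {u0}u0 : 0 < rnorm (B u) by rewrite lt_neqAle rnorm_ge0 andbT eq_sym; exact/eqP.
  rewrite -(ler_pM2r u0) -expr2 -rdotxx /rdot -BP (le_trans _ (bM _ _))//.
  by rewrite (le_trans (ler_norm _))// Re_le_cabs.
have Bc : continuous B by exact: rnorm_continuous_linear BM.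
have [|||p [u _ <-] pP] := projection (K := range B) z Vc.
- by exists 0 => //; have := Bl (- 1) 0 0; rewrite scaler0 addr0 scaleN1r addNr.
- by move=> c _ _ [x _ <-] [y _ <-]; exists (c *: x + y); rewrite ?Bl.
- move=> u l uB ul.
  have /choice[x xu] n : exists y, B y = u n by have [y _ <-] := uB n; exists y.
  have : cvg (x n @[n --> \oo]).
    apply: Vc => e e0.
    have ae : 0 < alpha * e / 2 by rewrite divr_gt0// mulr_gt0.
    have /cvg_rnormP/(_ _ ae)[N _ NP] := ul.
    exists N => n m /NP nP /NP mP; rewrite -(ltr_pM2l a0) (le_lt_trans (coer _))//.
    rewrite BB !xu.
    rewrite (le_lt_trans (rnorm_dist _ l _))// rnorm_distC.
    by move: nP mP => /= *; lra.
  move=> /cvg_ex[k xk]; exists k => //.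
  apply: (@cvg_unique_norm R nat \oo _ V u) ul.
  rewrite (_ : u = B \o x); first exact: (cvg_comp _ _ xk (Bc k)).
  by apply/funext => n /=; rewrite xu.
exists u => v; rewrite BP; suff -> : B u = z by [].
apply/eqP; rewrite eq_sym -subr_eq0; apply/eqP.
set e := z - B u in pP *.
have := ba e; rewrite BP -/(rdot _ _) rdotC /rdot pP; last by exists e.
move=> /= ee; apply: rnorm_eq0; apply/eqP; rewrite -sqrf_eq0 eq_le sqr_ge0 andbT.
by rewrite -(pmulr_rle0 _ a0).
Qed.

(* Stands in for weak compactness: a bounded set that is small in H is weakly
   small in V. *)
Lemma weak_small (V : preHilbertType R) (H : normedModType R[i]) (emb : V -> H)
    (phi : V -> R[i]) (M B e : R) :
  seq_complete V -> linear emb -> continuous emb -> injective emb ->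
  linear_for *%R phi -> (forall x, cabs (phi x) <= M * rnorm x) -> 0 < e ->
  exists2 d : R, 0 < d & forall x,
    rnorm x <= B -> rnorm (emb x) <= d -> cabs (phi x) <= e.
Proof.
move=> Vc embl embc embi phil phiM e0; apply: contrapT => h0.
have h (d : R) : 0 < d ->
    exists x, [/\ rnorm x <= B, rnorm (emb x) <= d & e < cabs (phi x)].
  move=> d0; apply: contrapT => /forallNP g; apply: h0; exists d => // x xB xn.
  by rewrite leNgt; apply/negP => xe; apply: (g x).
have phi0 : phi 0 = 0 by have := phil (- 1) 0 0; rewrite scaler0 addr0 mulN1r addNr.
have emb0 : emb 0 = 0.
  by have := embl (- 1) 0 0; rewrite scaler0 addr0 scaleN1r addNr.
have phiZ c x : phi (c *: x) = c * phi x.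
  by have := phil c x 0; rewrite !addr0 phi0 addr0.
have embZ c x : emb (c *: x) = c *: emb x.
  by have := embl c x 0; rewrite !addr0 emb0 addr0.
have phiB x y : phi (x - y) = phi x - phi y.
  by rewrite [x - y]addrC -[- y]scaleN1r phil mulN1r addrC.
have phiD x y : phi (x + y) = phi x + phi y.
  by rewrite -[x]scale1r phil mul1r scale1r.
have embD x y : emb (x + y) = emb x + emb y.
  by rewrite -[x]scale1r embl !scale1r.
have phic : continuous (phi : V -> R[i]^o) by exact: (@rnorm_continuous_linear _ V R[i]^o phi M).
(* Fixing the value e of [phi], instead of bounding its modulus from below, makes these sets convex.
   Near-minimisers in them converge in norm to some l with emb l = 0 and phi l = e. *)
pose C n := [set x | rnorm (emb x) <= n.+1%:R^-1 /\ phi x = e%:C%C].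
have [|||x [Cx _ /cvg_ex[l xl]]] := nested_minimizer (C := C) (B := B) Vc.
- move=> n m nm x [xm pe]; split => //; rewrite (le_trans xm)//.
  by rewrite lef_pV2 ?posrE// ler_nat.
- move=> n x y [xn xe] [yn ye]; split.
    rewrite embZ rnormZr ger0_norm ?invr_ge0// embD.
    move: (rnormD (emb x) (emb y)) xn yn.
    move: (rnorm (emb x + emb y)) (rnorm (emb x)) (rnorm (emb y)) (n.+1%:R^-1) => *.
    by lra.
  rewrite phiZ phiD xe ye -rmorphD -rmorphM/=; congr (_%:C%C); by field.
- move=> n; have n0 : (0 : R) < n.+1%:R^-1 by rewrite invr_gt0.
  have [x [xB xn xe]] := h _ n0.
  have p0 : 0 < cabs (phi x) by rewrite (lt_trans e0).
  have px0 : phi x != 0 by apply: contraTneq p0 => ->; rewrite cabs0 ltxx.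
  (* The factor that brings phi x to the value e has modulus at most 1, so both bounds on x survive
     the rescaling. *)
  have c1 : cabs (e%:C%C / phi x) <= 1.
    rewrite -(ler_pM2r p0) -cabsM divfK// cabs_real gtr0_norm// mul1r.
    exact: ltW.
  exists ((e%:C%C / phi x) *: x); last first.
    by rewrite rnormZ (le_trans _ xB)// ler_piMl// rnorm_ge0.
  split; last by rewrite phiZ divfK.
  by rewrite embZ rnormZ (le_trans _ xn)// ler_piMl// rnorm_ge0.
have l0 : emb l = 0.
  apply: (@cvg_unique_norm R nat \oo _ H (emb \o x)).
    exact: (cvg_comp _ _ xl (embc l)).
  apply: (@cvg_le_rnorm _ _ _ _ _ _ _ (fun n => n.+1%:R^-1)); last exact: cvg_harmonic.
  by apply: nearW => n; rewrite sub0r rnormN; have [] := Cx n.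
have : phi l = e%:C%C.
  apply: (@cvg_unique_norm R nat \oo _ R[i]^o (phi \o x)).
    exact: (cvg_comp _ _ xl (phic l)).
  rewrite (_ : _ \o _ = cst (e%:C%C)); first exact: cvg_cst.
  by apply/funext => n /=; have [] := Cx n.
move: l0; rewrite -emb0 => /embi ->; rewrite phi0 => -[] /eqP.
by rewrite lt_eqF.
Qed.

End HilbertSpace.

(** * Uniform boundedness and right derivatives *)

Section UniformBoundedness.
Context {R : realType}.

(** Nested balls instead of Baire's theorem: without a uniform bound, each ball contains a smaller
    one on which some [T n] exceeds a prescribed k, and at the common point of these balls the
    sequence is unbounded. *)
Lemma banach_steinhaus (W V : normedModType R[i]) (T : nat -> W -> V) :
  seq_complete W -> (forall n, linear (T n)) -> (forall n, continuous (T n)) ->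
  (forall x, exists M, forall n, rnorm (T n x) <= M) ->
  exists M, forall n x, rnorm (T n x) <= M * rnorm x.
Proof.
move=> Wc Tl Tc Tb; apply: contrapT => /forallNP unb.
have TB n x y : T n (x - y) = T n x - T n y.
  by rewrite [x - y]addrC -[- y]scaleN1r Tl scaleN1r addrC.
have TD n x y : T n (x + y) = T n x + T n y.
  by rewrite -[x]scale1r Tl !scale1r.
have T0 n : T n 0 = 0 by rewrite -(subrr 0) TB subrr.
have TZ n c x : T n (c *: x) = c *: T n x.
  by have := Tl n c x 0; rewrite T0 !addr0.
(* A bound k on the ball of radius r / 2 around x would bound all [T n]: a vector rescaled to length
   r / 2 is the difference of two points of that ball. *)
have big x r k : 0 < r -> exists y n, rnorm (y - x) <= r / 2 /\ k < rnorm (T n y).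
  move=> r0; apply: contrapT => /forallNP h.
  have {}h y n : rnorm (y - x) <= r / 2 -> rnorm (T n y) <= k.
    move=> yx; rewrite leNgt; apply/negP => ky; apply: (h y).
    by exists n.
  apply: (unb (2 * k * (2 / r))) => n w.
  have [w0|/eqP w0] := eqVneq (rnorm w) 0.
    by rewrite w0 mulr0 (rnorm_eq0 w0) T0 rnorm0.
  have {}w0 : 0 < rnorm w by rewrite lt_neqAle rnorm_ge0 andbT eq_sym; exact/eqP.
  pose s := r / 2 / rnorm w.
  have s0 : 0 < s by rewrite !divr_gt0.
  have h1 : rnorm (T n (x + s%:C%C *: w)) <= k.
    apply: h; rewrite addrC addKr rnormZr gtr0_norm// /s.
    by rewrite divfK// gt_eqF.
  have h2 : rnorm (T n x) <= k.
    by apply: h; rewrite subrr rnorm0 ltW// divr_gt0.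
  have h3 : s * rnorm (T n w) <= 2 * k.
    rewrite -(gtr0_norm s0) -rnormZr -TZ -[_ *: w](addKr x) addrC TB.
    by rewrite (le_trans (rnormD _ _))// rnormN mulrDl !mul1r lerD.
  rewrite -(ler_pM2l s0) (le_trans h3)//.
  rewrite (_ : s * _ = 2 * k)// /s; field.
  by rewrite !gt_eqF.
have step (k : nat) (p : W * R) : exists q : W * R, 0 < p.2 ->
    [/\ 0 < q.2, q.2 <= p.2 / 2, rnorm (q.1 - p.1) <= p.2 / 2 &
      forall z, rnorm (z - q.1) <= q.2 -> exists n, k%:R < rnorm (T n z)].
  have [p0|p0] := ltP 0 p.2; last by exists p; rewrite ltNge p0.
  have [y [n [yp kn]]] := big p.1 p.2 k%:R p0.
  have [M M0 TM] := continuous_linear_rnorm (Tl n) (Tc n).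
  (* Within d of y, the value of [T n] moves by at most half of its excess over k. *)
  pose d := (rnorm (T n y) - k%:R) / (2 * M).
  have d0 : 0 < d by rewrite divr_gt0 ?subr_gt0// mulr_gt0.
  have p2 : 0 < p.2 / 2 by rewrite divr_gt0.
  exists (y, Num.min (p.2 / 2) d) => _; split => //=.
  - by rewrite lt_min p2 d0.
  - by rewrite ge_min lexx.
  - move=> z; rewrite le_min => /andP[_ zd]; exists n.
    have h1 : rnorm (T n (z - y)) <= (rnorm (T n y) - k%:R) / 2.
      rewrite (le_trans (TM _))// (_ : _ / 2 = M * d) ?ler_pM2l//.
      by rewrite /d; field; rewrite gt_eqF.
    have := rnorm_leB (T n z) (T n y); rewrite -TB ler_norml => /andP[h2 _].
    move: h1 h2 kn; move: (rnorm (T n (z - y))) (rnorm (T n y)) (rnorm (T n z)) => a b c.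
    by move: (k%:R) => ? *; lra.
have /choice[f fP] : forall kp : nat * (W * R), exists q : W * R, 0 < kp.2.2 ->
    [/\ 0 < q.2, q.2 <= kp.2.2 / 2, rnorm (q.1 - kp.2.1) <= kp.2.2 / 2 &
      forall z, rnorm (z - q.1) <= q.2 -> exists n, kp.1%:R < rnorm (T n z)].
  by move=> [k p]; exact: step.
pose g := fix g (k : nat) : W * R := if k is k'.+1 then f (k', g k') else (0, 1).
have g0 k : 0 < (g k).2.
  by elim: k => [//|k ih] /=; have [] := fP (k, g k) ih.
have gP k : [/\ (g k.+1).2 <= (g k).2 / 2, rnorm ((g k.+1).1 - (g k).1) <= (g k).2 / 2 &
    forall z, rnorm (z - (g k.+1).1) <= (g k.+1).2 -> exists n, k%:R < rnorm (T n z)].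
  by have [] := fP (k, g k) (g0 k).
have gr k : (g k).2 <= k.+1%:R^-1.
  elim: k => [|k ih] /=; first by rewrite invr1.
  have [h _ _] := gP k; rewrite (le_trans h)// (le_trans (ler_wpM2r _ ih)) ?invr_ge0//.
  rewrite -invfM lef_pV2 ?posrE ?mulr_gt0// -natrM ler_nat.
  by rewrite mulnC mul2n -addnn !addSn addnS !ltnS leq_addr.
(* The radii pay for the motion of the centres: a step moves the centre by at most half the radius,
   which is at most the radius lost. *)
have gd k m : rnorm ((g (k + m)%N).1 - (g k).1) <= (g k).2 - (g (k + m)%N).2.
  elim: m => [|m ih]; first by rewrite addn0 !subrr rnorm0.
  rewrite addnS (le_trans (rnorm_dist _ (g (k + m)%N).1 _))//.
  have [h1 h2 _] := gP (k + m)%N; move: ih h1 h2.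
  move: (rnorm _) (rnorm _) (g (k + m).+1).2 (g (k + m)%N).2 (g k).2.
  by move=> *; lra.
have gd' k n : (k <= n)%N -> rnorm ((g n).1 - (g k).1) <= (g k).2.
  move=> kn; rewrite -(subnKC kn) (le_trans (gd _ _))// lerBlDr lerDl.
  exact: ltW.
have /cvg_ex[l xl] : cvg ((g n).1 @[n --> \oo]).
  apply: Wc => e e0; have e2 : 0 < e / 2 by rewrite divr_gt0.
  have /cvgrPdist_lt/(_ _ e2)[N _ NP] := @cvg_harmonic R.
  have gN : (g N).2 < e / 2.
    rewrite (le_lt_trans (gr N))//.
    by have := NP N (leqnn _); rewrite /harmonic/= sub0r normrN ger0_norm.
  exists N => n m Nn Nm; rewrite (le_lt_trans (rnorm_dist _ (g N).1 _))// [e]splitr.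
  by rewrite ltrD// ?[rnorm (_ - (g m).1)]rnorm_distC (le_lt_trans (gd' _ _ _)).
have lg k : rnorm (l - (g k).1) <= (g k).2.
  apply: (@cvg_le_rnorm_bound _ nat \oo _ W (fun n => (g n).1 - (g k).1)).
    by apply: cvgB xl _; exact: cvg_cst.
  by exists k => // n; exact: gd'.
have [M TM] := Tb l.
have [k Mk] : exists k : nat, M < k%:R by exists (Num.truncn M).+1; exact: truncnS_gt.
have [_ _ /(_ _ (lg k.+1))[n]] := gP k.
by move=> /(lt_trans Mk)/lt_geF; rewrite TM.
Qed.

(* Only the behaviour of f to the right of each point is differential; to the
   left it suffices that f does not jump upwards. *)
Lemma right_dini_nonincreasing (f : R -> R) :
  (forall t e, 0 <= t -> 0 < e ->
    exists2 d, 0 < d & forall h, 0 < h -> h < d -> f (t + h) <= f t + e * h) ->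
  (forall t e, 0 < t -> 0 < e ->
    exists2 d, 0 < d & forall s, 0 <= s -> t - d < s -> s < t -> f t <= f s + e) ->
  forall t, 0 <= t -> f t <= f 0.
Proof.
move=> fr fl T T0; apply/ler_addgt0Pr => e e0.
wlog T1 : / 0 < T.
  move=> h; move: T0; rewrite le_eqVlt => /predU1P[<-|]; last exact: h.
  by rewrite lerDl ltW.
pose c := e / T; have c0 : 0 < c by rewrite divr_gt0.
rewrite (_ : e = c * T); last by rewrite /c divfK// gt_eqF.
(* Continuous induction: S consists of the times up to which f stays below a line of slope c. Its
   supremum satisfies the bound by the hypothesis on the left, and cannot be less than T by the one
   on the right. *)
pose S := [set t | 0 <= t <= T /\ forall s, 0 <= s -> s <= t -> f s <= f 0 + c * s].
have S0 : S 0.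
  split; first by rewrite lexx ltW.
  by move=> s s0 s1; rewrite (_ : s = 0) ?mulr0 ?addr0//; apply/eqP; rewrite eq_le s0 s1.
have supS : has_sup S by split; [exists 0|exists T => t [/andP[]]].
set t0 := sup S.
have t00 : 0 <= t0 by apply: ub_le_sup => //; exact: supS.2.
have t0T : t0 <= T by apply: ge_sup; [exact: supS.1|move=> t [/andP[]]].
have below s : 0 <= s -> s < t0 -> f s <= f 0 + c * s.
  move=> s0 st; have d0 : 0 < t0 - s by rewrite subr_gt0.
  have [t [_ tS] ht] := sup_adherent d0 supS; apply: tS => //.
  by move: ht; rewrite -/t0 subKr => /ltW.
have at0 : f t0 <= f 0 + c * t0.
  move: t00; rewrite le_eqVlt => /predU1P[<-|t1]; first by rewrite mulr0 addr0.
  apply/ler_addgt0Pr => h h0; have [d d0 dP] := fl _ _ t1 h0.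
  pose s := Num.max 0 (t0 - d / 2).
  have st : s < t0 by rewrite gt_max t1/= ltrBlDr ltrDl divr_gt0.
  have s0 : 0 <= s by rewrite le_max lexx.
  have sd : t0 - d < s by rewrite lt_max; apply/orP; right; lra.
  have h1 := dP _ s0 sd st; have h2 := below _ s0 st.
  have h3 : c * s <= c * t0 by rewrite ler_pM2l// ltW.
  by lra.
have uptot0 s : 0 <= s -> s <= t0 -> f s <= f 0 + c * s.
  by move=> s0; rewrite le_eqVlt => /predU1P[->//|]; exact: below.
move: t0T; rewrite le_eqVlt => /predU1P[<-//|t1].
have [d d0 dP] := fr _ _ t00 c0.
pose h := Num.min (d / 2) (T - t0).
have h0 : 0 < h by rewrite lt_min divr_gt0//= subr_gt0.
have hd : h < d by rewrite gt_min; apply/orP; left; lra.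
have : S (t0 + h).
  split; first by rewrite addr_ge0 ?(ltW h0)//= -lerBrDl ge_min lexx orbT.
  move=> s s0 sh; have [/uptot0|ts] := leP s t0; first exact.
  have q0 : 0 < s - t0 by rewrite subr_gt0.
  have qd : s - t0 < d by rewrite (le_lt_trans _ hd)// lerBlDl.
  by have := dP _ q0 qd; rewrite addrC subrK => q; lra.
move=> /(ub_le_sup supS.2); rewrite -/t0 gerDl leNgt h0.
by [].
Qed.

End UniformBoundedness.

(** * Hilbert sums *)

Section HilbertSums.
Context {R : realType} {I : choiceType}.

Lemma square_summableP (E : normedModType R[i]) (J : set I) (f : I -> E) :
  square_summable J f <->
  exists M : R, forall A : {fset I}, \sum_(i <- A | i \in J) rnorm (f i) ^+ 2 <= M.
Proof.
have e (A : {fset I}) : \sum_(i <- A | i \in J) `|f i| ^+ 2 =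
    (\sum_(i <- A | i \in J) rnorm (f i) ^+ 2)%:C%C.
  rewrite (rmorph_sum (real_complex R)); apply: eq_bigr => i _.
  by rewrite -rnormE -(rmorphXn (real_complex R)).
by split=> -[M fM]; exists M => A; have := fM A; rewrite e lecR.
Qed.

Lemma cvg_sum_seq (K T : Type) (F : set_system T) {FF : Filter F}
    (s : seq K) (f : K -> T -> R) (l : K -> R) :
  (forall k, f k t @[t --> F] --> l k) ->
  \sum_(k <- s) f k t @[t --> F] --> \sum_(k <- s) l k.
Proof.
move=> fl; elim: s => [|k s ih].
  rewrite big_nil (_ : (fun t => _) = cst 0); first exact: cvg_cst.
  by apply/funext => t; rewrite big_nil.
rewrite big_cons (_ : (fun t => _) = f k + (fun t => \sum_(k <- s) f k t)).
  exact: cvgD.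
by apply/funext => t; rewrite big_cons.
Qed.

Section OneSpace.
Context {E : preHilbertType R}.
Implicit Types (f g : hsum I E).

Lemma hsumDE f g i : (f + g) i = f i + g i. Proof. by []. Qed.
Lemma hsumZE (c : R[i]) f i : (c *: f) i = c *: f i. Proof. by []. Qed.
Lemma hsumBE f g i : (f - g) i = f i - g i. Proof. by []. Qed.

Lemma hsum_sumE (K : Type) (s : seq K) (P : pred K) (f : K -> hsum I E) i :
  (\sum_(k <- s | P k) f k) i = \sum_(k <- s | P k) f k i.
Proof. by elim/big_rec2: _ => // k y x _ <-. Qed.

Lemma hsum_ext f g : (forall i, f i = g i) -> f = g.
Proof. by move=> fg; apply/val_inj/funext. Qed.

Lemma hsum_norm_cvg f :
  (fun A : {fset I} => \sum_(i <- A) rnorm (f i) ^+ 2) @ totally --> rnorm f ^+ 2.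
Proof.
have fc := cvg_rnorm (@hsum_dot_cvg R I E f f).
have -> : rnorm f ^+ 2 = rnorm (hsum_dot f f : R[i]^o).
  by rewrite -[RHS]/(cabs (dotp f f)) dotpxx cabs_real ger0_norm// sqr_ge0.
suff -> : (fun A : {fset I} => \sum_(i <- A) rnorm (f i) ^+ 2) =
  (fun A => rnorm (psum setT (fun i => dotp (f i) (f i)) A)) by exact: fc.
apply/funext => A; rewrite /psum (eq_bigl _ _ (fun i => in_setT i)).
rewrite (_ : \sum_(i <- A) _ =
    (\sum_(i <- A) rnorm (f i) ^+ 2)%:C%C :> R[i]^o); last first.
  rewrite (rmorph_sum (real_complex R)); apply: eq_bigr => i _.
  by rewrite dotpxx.
rewrite -[RHS]/(cabs _) cabs_real ger0_norm// sumr_ge0// => i _.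
exact: sqr_ge0.
Qed.

Lemma hsum_sum_le f (A : {fset I}) :
  \sum_(i <- A) rnorm (f i) ^+ 2 <= rnorm f ^+ 2.
Proof.
have fc := @hsum_norm_cvg f; rewrite -(cvg_lim (@Rhausdorff R) fc).
apply: limr_ge; first exact: cvgP fc.
exists A => // B AB.
have := @le_psum R I setT (fun i => rnorm (f i) ^+ 2) A B (fun i _ => sqr_ge0 _) AB.
by rewrite !(eq_bigl _ _ (fun i => in_setT i)).
Qed.

Lemma hsum_norm_le f M : (forall A : {fset I}, \sum_(i <- A) rnorm (f i) ^+ 2 <= M) ->
  rnorm f ^+ 2 <= M.
Proof.
move=> fM; have fc := @hsum_norm_cvg f; rewrite -(cvg_lim (@Rhausdorff R) fc).
apply: limr_le; first exact: cvgP fc.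
exact: nearW.
Qed.

Lemma hsum_coord_le f i : rnorm (f i) <= rnorm f.
Proof.
rewrite -ler_sqr ?nnegrE ?rnorm_ge0// (le_trans _ (hsum_sum_le f [fset i]%fset))//.
by rewrite big_seq_fset1.
Qed.

Lemma hsum_coord_cvg (T : Type) (F : set_system T) {FF : Filter F}
    (f : T -> hsum I E) (l : hsum I E) i :
  f t @[t --> F] --> l -> f t i @[t --> F] --> l i.
Proof.
move=> /cvg_rnormP fl; apply/cvg_rnormP => e /fl.
apply: filterS => t; apply: le_lt_trans.
exact: (hsum_coord_le (l - f t)).
Qed.

Lemma hsum_complete : seq_complete E -> seq_complete (hsum I E).
Proof.
move=> Ec u uc.
have lim_ex i : exists l : E, u n i @[n --> \oo] --> l.
  apply/cvg_ex; apply: Ec => e /uc[N NP]; exists N => n m Nn Nm.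
  exact: le_lt_trans (hsum_coord_le (u n - u m) i) (NP _ _ Nn Nm).
have [f fP] := choice lim_ex.
(* Letting n tend to infinity in finite sums gives a bound independent of A. It yields both the
   square summability of the coordinatewise limit and the convergence in norm. *)
have lim_le (A : {fset I}) m M N :
    (forall n, (N <= n)%N -> rnorm (u n - u m) <= M) ->
    \sum_(i <- A) rnorm (f i - u m i) ^+ 2 <= M ^+ 2.
  move=> h; have c : \sum_(i <- A) rnorm (u n i - u m i) ^+ 2 @[n --> \oo] -->
      \sum_(i <- A) rnorm (f i - u m i) ^+ 2.
    apply: cvg_sum_seq => i; rewrite expr2.
    have ci : rnorm (u n i - u m i) @[n --> \oo] --> rnorm (f i - u m i).
      by apply: cvg_rnorm; apply: cvgB (fP i) _; exact: cvg_cst.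
    exact: cvgM.
  rewrite -(cvg_lim (@Rhausdorff R) c).
  apply: limr_le; first exact: cvgP c.
  exists N => // n Nn; rewrite (le_trans (hsum_sum_le (u n - u m) A))//.
  by rewrite ler_sqr ?nnegrE ?rnorm_ge0 ?(le_trans _ (h _ Nn)) ?rnorm_ge0//; exact: h.
have fs : f \in hsum_pred.
  have [N NP] := uc _ ltr01.
  apply/hsum_predP; rewrite (_ : f = (fun i => (f i - u N i) + u N i)); last first.
    by apply/funext => i; rewrite subrK.
  apply: square_summableD; last exact: hsumP.
  apply/square_summableP; exists (1 ^+ 2) => A.
  rewrite (eq_bigl _ _ (fun i => in_setT i)); apply: (lim_le _ _ _ N) => n Nn.
  exact/ltW/NP.
apply/cvg_ex; exists (Hsum fs); apply/cvg_rnormP => e e0.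
have e2 : 0 < e / 2 by rewrite divr_gt0.
have [N NP] := uc _ e2; exists N => // m /= Nm.
have ee : e / 2 < e by lra.
apply: (le_lt_trans _ ee); rewrite -ler_sqr ?nnegrE ?rnorm_ge0 ?(ltW e2)//.
apply: hsum_norm_le => A.
by apply: (lim_le _ _ _ N) => n Nn; exact/ltW/NP.
Qed.

End OneSpace.
End HilbertSums.

Lemma dotp_eq0_approx (R : realType) (W : preHilbertType R) (q y : W) :
  (forall e : R, 0 < e -> exists2 z, dotp q z = 0 & rnorm (y - z) < e) -> dotp q y = 0.
Proof.
move=> yP; apply: (@rnorm_eq0 R R[i]^o); apply/eqP; rewrite eq_le rnorm_ge0 andbT.
apply/ler_addgt0Pr => r r0; rewrite add0r.
have s0 : 0 < rnorm q + 1 by rewrite ltr_wpDl// rnorm_ge0.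
have [z z0 yz] := yP _ (divr_gt0 r0 s0).
rewrite -[X in rnorm (X : R[i]^o)]subr0 -z0 -dotpBr.
rewrite (le_trans (cabs_dotp _ _))// (le_trans (ler_wpM2l (rnorm_ge0 _) (ltW yz)))//.
by rewrite mulrCA ler_piMr ?(ltW r0)// ler_pdivrMr// mul1r lerDl.
Qed.

(** * Products of a square summable sequence and a vector *)

Section Tensor.
Context {R : realType} {I : choiceType} {E : preHilbertType R}.
Implicit Types (y z : ell2 R I) (g h : E) (f : hsum I E).

Lemma tensor_subproof y g : (fun i => (y i : R[i]) *: g) \in @hsum_pred R I E.
Proof.
apply/hsum_predP/square_summableP.
exists (rnorm y ^+ 2 * rnorm g ^+ 2) => A.
rewrite (eq_bigl _ _ (fun i => in_setT i)).
under eq_bigr do rewrite rnormZ exprMn.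
by rewrite -mulr_suml ler_wpM2r ?sqr_ge0//; exact: (@hsum_sum_le R I _ y A).
Qed.

(** For E = L2 this is the function x |-> g(x) y; the inner product of psi with it is the integral
    of (psi(x) | y) times the conjugate of g(x). *)
Definition tensor y g : hsum I E := Hsum (tensor_subproof y g).

Lemma tensorE y g i : tensor y g i = (y i : R[i]) *: g. Proof. by []. Qed.

Lemma tensor_linearl c y z g : tensor (c *: y + z) g = c *: tensor y g + tensor z g.
Proof. by apply: hsum_ext => i; rewrite tensorE scalerDl -scalerA. Qed.

Lemma tensor_linearr c y g h : tensor y (c *: g + h) = c *: tensor y g + tensor y h.
Proof.
apply: hsum_ext => i; rewrite hsumDE hsumZE !tensorE scalerDr !scalerA.
by rewrite mulrC.
Qed.

Lemma tensorBl y z g : tensor (y - z) g = tensor y g - tensor z g.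
Proof. by apply: hsum_ext => i; rewrite tensorE scalerBl. Qed.

Lemma hsum_dotp_cvg f (f' : hsum I E) :
  (fun A : {fset I} => \sum_(i <- A) dotp (f i) (f' i) : R[i]^o) @ totally -->
  (dotp f f' : R[i]^o).
Proof.
have fc := @hsum_dot_cvg R I E f f'.
suff -> : (fun A : {fset I} => \sum_(i <- A) dotp (f i) (f' i) : R[i]^o) =
  psum setT (fun i => dotp (f i) (f' i)) by exact: fc.
by apply/funext => A; rewrite /psum (eq_bigl _ _ (fun i => in_setT i)).
Qed.

Lemma dotp_tensor y z g h : dotp (tensor y g) (tensor z h) = dotp y z * dotp g h.
Proof.
apply: (@cvg_unique_norm R {fset I} totally _ R[i]^o _ _ _ (@hsum_dotp_cvg _ _)).
have c := @cvg_usumZ R I setT _ (dotp g h) _ (@hsum_dot_cvg R I _ y z).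
rewrite [dotp y z * _]mulrC.
rewrite (_ : (fun A : {fset I} => _) = psum setT
  (fun i => dotp g h * dotp (y i : R[i]^o) (z i))); first exact: c.
apply/funext => A; rewrite /psum (eq_bigl _ _ (fun i => in_setT i)).
apply: eq_bigr => i _; rewrite !tensorE dotpZl dotpZr mulrA mulrC.
by [].
Qed.

Lemma rnorm_tensor y g : rnorm (tensor y g) = rnorm y * rnorm g.
Proof.
apply/eqP; rewrite -(eqrXn2 (isT : 0 < 2)%N) ?mulr_ge0 ?rnorm_ge0// exprMn.
rewrite -!rdotxx /rdot dotp_tensor !dotpxx -rmorphM/=.
by rewrite -[X in X == _]/(rnorm y ^+ 2 * rnorm g ^+ 2).
Qed.

End Tensor.

Lemma big_fset_split (I : choiceType) (V : nmodType) (A B : {fset I}) (P : pred I)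
    (f : I -> V) : (A `<=` B)%fset ->
  \sum_(i <- B | P i) f i = \sum_(i <- (B `\` A)%fset | P i) f i + \sum_(i <- A | P i) f i.
Proof.
move=> AB; rewrite [LHS]big_mkcond [X in _ = X + _]big_mkcond [X in _ = _ + X]big_mkcond/=.
rewrite (big_fsetID _ (mem A))/= addrC; congr (_ + _).
- by apply: eq_fbigl => i; rewrite !inE andbC.
- apply: eq_fbigl => i; rewrite !inE/=.
  by case: (boolP (i \in A)) => [/(fsubsetP AB) ->|_]; rewrite ?andbF.
Qed.

Section Singles.
Context {R : realType} {I : choiceType} {E : preHilbertType R}.
Implicit Types (f : hsum I E) (g : E) (i j : I).

Lemma hsum_singleE i g j : hsum_single i g j = if j == i then g else 0.
Proof. by []. Qed.

Lemma hsum_single_linear i c g h :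
  hsum_single i (c *: g + h) = c *: hsum_single i g + hsum_single i h :> hsum I E.
Proof.
apply: hsum_ext => j; rewrite hsumDE hsumZE !hsum_singleE.
by case: ifP => // _; rewrite scaler0 addr0.
Qed.

Lemma rnorm_single i g : rnorm (hsum_single i g : hsum I E) <= rnorm g.
Proof.
rewrite -ler_sqr ?nnegrE ?rnorm_ge0//; apply: hsum_norm_le => A.
have [iA|iA] := boolP (i \in A).
  rewrite (big_fsetD1 i)//= eqxx big1_seq ?addr0// => j.
  by rewrite !inE => /andP[_ /andP[/negbTE -> _]]; rewrite rnorm0 expr0n.
rewrite big1_seq ?sqr_ge0// => j /andP[_ jA]; rewrite hsum_singleE.
case: eqP => [ji|_]; last by rewrite rnorm0 expr0n.
by move: iA; rewrite -ji jA.
Qed.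

Lemma dotp_single f i g : dotp f (hsum_single i g) = dotp (f i) g.
Proof.
apply: (@cvg_unique_norm R {fset I} totally _ R[i]^o _ _ _ (@hsum_dotp_cvg _ _ _ _ _)).
apply/cvg_rnormP => r r0; exists [fset i]%fset => [//|B iB].
rewrite /= (big_fsetD1 i)/=; last by rewrite (fsubsetP iB)// inE.
rewrite eqxx big1_seq ?addr0 ?subrr ?rnorm0// => j.
by rewrite !inE => /andP[_ /andP[/negbTE -> _]]; rewrite dotp0r.
Qed.

Lemma sum_singleE f (A : {fset I}) j :
  (\sum_(i <- A) hsum_single i (f i) : hsum I E) j = if j \in A then f j else 0.
Proof.
rewrite hsum_sumE; have [jA|jA] := boolP (j \in A).
  rewrite (big_fsetD1 j)//= eqxx big1_seq ?addr0// => i.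
  by rewrite !inE eq_sym => /andP[_ /andP[/negbTE -> _]].
rewrite big1_seq// => i /andP[_ iA]; rewrite hsum_singleE.
by case: eqP iA jA => // <- ->.
Qed.

Lemma hsum_single_cvg f :
  (fun A : {fset I} => \sum_(i <- A) hsum_single i (f i)) @ totally --> f.
Proof.
(* A finite sum over indices outside A, together with the sum over A, is again a finite sum, hence
   at most |f|^2. *)
have tail (A : {fset I}) (r : hsum I E) :
    (forall i, r i = if i \in A then 0 else f i) ->
    rnorm r ^+ 2 <= rnorm f ^+ 2 - \sum_(i <- A) rnorm (f i) ^+ 2.
  move=> co.
  apply: hsum_norm_le => B; rewrite lerBrDr.
  rewrite (le_trans _ (hsum_sum_le f (A `|` B)%fset))//.
  rewrite [leRHS](big_fset_split _ _ (fsubsetUl A B)) lerD2r.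
  rewrite big_mkcond/= [leRHS]big_mkcond/=.
  have -> : ((A `|` B) `\` A)%fset = (B `\` A)%fset.
    by apply/fsetP => i; rewrite !inE; case: (i \in A).
  rewrite (big_fset_split _ _ (fsubsetIr A B)) addrC big_seq big1 ?add0r.
    rewrite (_ : (B `\` (A `&` B))%fset = (B `\` A)%fset); last first.
      by apply/fsetP => i; rewrite !inE; case: (i \in A); rewrite //= andNb.
    rewrite le_eqVlt; apply/orP; left; apply/eqP; apply: eq_big_seq => i.
    rewrite !inE => /andP[iA _].
    by rewrite co (negbTE iA).
  by move=> i; rewrite !inE => /andP[iA _]; rewrite co iA rnorm0 expr0n.
apply/cvg_rnormP => e e0.
have /cvgrPdist_lt/(_ _ (exprn_gt0 2 e0))[A _ AP] := @hsum_norm_cvg _ _ _ f.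
exists A => // B /AP /= fB; rewrite -ltr_sqr ?nnegrE ?rnorm_ge0 ?ltW//.
rewrite (le_lt_trans (tail B _ _))//.
  by move=> i; rewrite hsumBE sum_singleE; case: ifP => _; rewrite ?subrr ?subr0.
by rewrite (le_lt_trans _ fB)// ler_norm.
Qed.

End Singles.

(** * Subspaces cut out by a basis, and expansions along it *)

Section Perp.
Context {R : realType} {I : choiceType} (v : I -> ell2 R I).

(* If [v] restricted to [J] is a basis of the orthogonal complement of Y, this
   is the space of all psi with values in Y, described without reference to
   pointwise values; it makes sense in V as well as in H. *)
Definition perp (J : set I) (E : preHilbertType R) : set (hsum I E) :=
  [set f | forall k g, J k -> dotp f (tensor (v k) g) = 0].
Arguments perp : clear implicits.

Lemma perp0 J E : perp J E 0.
Proof. by move=> k g _; rewrite dotp0l. Qed.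

Lemma perp_linear J E c f f' : perp J E f -> perp J E f' -> perp J E (c *: f + f').
Proof. by move=> f0 f'0 k g Jk; rewrite dotpDl dotpZl f0// f'0// mulr0 addr0. Qed.

Lemma perp_cvg J E (T : Type) (F : set_system T) {FF : ProperFilter F}
    (u : T -> hsum I E) l : (\forall t \near F, perp J E (u t)) -> u @ F --> l -> perp J E l.
Proof.
move=> uJ ul k g Jk.
apply: (@cvg_unique_norm R T F _ R[i]^o _ _ _ (dotp_cvgl (z := tensor (v k) g) ul)).
apply/cvg_rnormP => e e0; apply: filterS uJ => t /(_ k g Jk) ->.
by rewrite subrr rnorm0.
Qed.

(** Test vectors are pulled back by the adjoint: with h' from Riesz such that (f g | h) = (g | h'),
    pairing the image of w with v_k (x) h is pairing w with v_k (x) h'. *)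
Lemma perp_map J (E F : preHilbertType R) (f : {linear E -> F}) (fc : continuous f) w :
  seq_complete E -> perp J E w -> perp J F (hsum_map fc w).
Proof.
move=> Ec wJ k h Jk.
have [M M0 fM] := continuous_linear_rnorm (linearP f) fc.
have [||h' h'P] := riesz (phi := fun g => dotp (f g) h) (M := M * rnorm h) Ec.
- by move=> c x y; rewrite linearP dotpDl dotpZl.
- move=> x; rewrite (le_trans (cabs_dotp _ _))// mulrAC ler_wpM2r ?rnorm_ge0//.
rewrite -(wJ k h' Jk).
apply: (@cvg_unique_norm R {fset I} totally _ R[i]^o _ _ _ (@hsum_dotp_cvg _ _ _ _ _)).
have c := @hsum_dotp_cvg _ _ _ w (tensor (v k) h').
rewrite (_ : (fun A : {fset I} => _) = fun A : {fset I} =>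
   \sum_(i <- A) dotp (w i) (tensor (v k) h' i)); first exact: c.
apply/funext => A; apply: eq_bigr => i _.
by rewrite !tensorE !dotpZr h'P.
Qed.

Hypothesis v_basis : hilbert_basis setT v setT.

Lemma basis_orthonormal i j : dotp (v i) (v j) = (i == j)%:R :> R[i].
Proof. by have [+ _] := v_basis; exact. Qed.

(** Turns the closure in [hilbert_basis] into an induction principle. Closedness of Q is asked in
    the form that [dotp_eq0_approx] delivers for orthogonality conditions. *)
Lemma closure_span_ind (J : set I) (Q : ell2 R I -> Prop) :
  Q 0 -> (forall c y z, Q y -> Q z -> Q (c *: y + z)) ->
  (forall k, J k -> Q (v k)) ->
  (forall y, (forall e : R, 0 < e -> exists2 z, Q z & rnorm (y - z) < e) -> Q y) ->
  closure [set x | exists (A : {fset I}) (c : I -> R[i]),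
                     x = \sum_(i <- A | i \in J) c i *: v i] `<=` Q.
Proof.
move=> Q0 Ql Qv Qc y yc; apply: Qc => e e0.
have : nbhs y [set z | rnorm (y - z) < e].
  apply/nbhs_normP; exists e%:C%C => /=; first by rewrite ltcR.
  by move=> z /=; rewrite -rnormE ltcR.
move=> /yc[_ [[A [c ->]] /= ye]]; exists (\sum_(i <- A | i \in J) c i *: v i) => //.
elim/big_ind: _ => // [x z Qx Qz|i /set_mem Ji].
  by rewrite -[x]scale1r; exact: Ql.
by rewrite -[_ *: _]addr0; apply: Ql => //; exact: Qv.
Qed.

(** By density, f is orthogonal to y (x) g for every y in [ell2]; unit coordinate vectors y then
    give the coordinates of f. *)
Lemma perp_setT (E : preHilbertType R) (f : hsum I E) : perp setT E f -> f = 0.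
Proof.
move=> fT; apply: hsum_ext => i; apply: dotp_eq0 => g.
pose e : ell2 R I := hsum_single i (1 : R[i]^o).
have <- : dotp f (tensor e g) = dotp (f i) g.
  rewrite -dotp_single (_ : tensor e g = hsum_single i g)//.
  apply: hsum_ext => j; rewrite tensorE /e !hsum_singleE.
  by case: ifP => _; rewrite ?scale1r ?scale0r.
have [_ cl] := v_basis.
have : [set: ell2 R I] e by [].
rewrite -cl; apply: (@closure_span_ind setT (fun y => dotp f (tensor y g) = 0)) => //.
- rewrite (_ : tensor 0 g = 0) ?dotp0r//.
  by apply: hsum_ext => j; rewrite tensorE scale0r.
- by move=> c y z y0 z0; rewrite tensor_linearl dotpDr dotpZr y0 z0 mulr0 addr0.
- by move=> k _; exact: fT.
- move=> y yP; apply: dotp_eq0_approx => r r0.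
  have s0 : 0 < rnorm g + 1 by rewrite ltr_wpDl// rnorm_ge0.
  have [z z0 yz] := yP _ (divr_gt0 r0 s0); exists (tensor z g) => //.
  rewrite -tensorBl rnorm_tensor.
  rewrite (@le_lt_trans _ _ (rnorm (y - z) * (rnorm g + 1)))//.
    by rewrite ler_wpM2l ?rnorm_ge0// lerDl.
  by rewrite -ltr_pdivlMr.
Qed.

Lemma perp_cover (J J' : set I) (E : preHilbertType R) (f : hsum I E) :
  J `|` J' = setT -> perp J E f -> perp J' E f -> f = 0.
Proof.
move=> JJ fJ fJ'; apply: perp_setT => k g _.
have : setT k by []. 
by rewrite -JJ => -[Jk|J'k]; [exact: fJ|exact: fJ'].
Qed.

Lemma tensor_perp (J J' : set I) (E : preHilbertType R) k (g : E) :
  J `&` J' = set0 -> J k -> perp J' E (tensor (v k) g).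
Proof.
move=> JJ Jk l h J'l; rewrite dotp_tensor basis_orthonormal.
case: eqP => [kl|_]; last by rewrite mul0r.
have : (J `&` J') k by split => //; rewrite kl.
by rewrite JJ.
Qed.

(** Project on the closed subspace [perp J]. It contains v_k (x) g for k in J', and the remainder is
    orthogonal to these, which is membership in [perp J']. *)
Lemma perp_decomposition (J J' : set I) (E : preHilbertType R) (f : hsum I E) :
  seq_complete E -> J `&` J' = set0 ->
  exists p q, [/\ f = p + q, perp J E p, perp J' E q &
    forall h, perp J E h -> dotp q h = 0].
Proof.
move=> Ec JJ; have [|||p pJ pP] := projection (K := perp J E) f (hsum_complete Ec).
- exact: perp0.
- by move=> c x y; exact: perp_linear.
- move=> u l uJ; apply: perp_cvg; exact: nearW.
exists p, (f - p); split => //; first by rewrite addrC subrK.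
by move=> k g J'k; apply: pP; apply: tensor_perp J'k; rewrite setIC.
Qed.

(** Decompose f with J and J' exchanged: the part in [perp J'] differs from f by an element of
    [perp J], so it lies in both and vanishes. What remains is orthogonal to [perp J'] by
    construction. *)
Lemma perp_orthogonal (J J' : set I) (E : preHilbertType R) (f h : hsum I E) :
  seq_complete E -> J `|` J' = setT -> J `&` J' = set0 ->
  perp J E f -> perp J' E h -> dotp f h = 0.
Proof.
move=> Ec JuJ JnJ fJ hJ'.
have JnJ' : J' `&` J = set0 by rewrite setIC.
have [p [q [fE pJ' qJ qP]]] := perp_decomposition f Ec JnJ'.
suff p0 : p = 0 by rewrite fE p0 add0r; exact: qP.
apply: (perp_cover JuJ) pJ'.
rewrite (_ : p = -1 *: q + f); first exact: perp_linear.
by rewrite fE scaleN1r addrCA addNr addr0.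
Qed.

Definition partial_expansion (E : preHilbertType R) (J : set I) (psi : I -> E)
    (A : {fset I}) : hsum I E := \sum_(l <- A | l \in J) tensor (v l) (psi l).

Lemma dotp_expansion (E : preHilbertType R) (J : set I) (psi : I -> E) A k g :
  dotp (partial_expansion J psi A) (tensor (v k) g) =
  if (k \in A) && (k \in J) then dotp (psi k) g else 0.
Proof.
rewrite /partial_expansion dotp_suml.
have tt l : dotp (tensor (v l) (psi l)) (tensor (v k) g) =
    if l == k then dotp (psi k) g else 0.
  rewrite dotp_tensor basis_orthonormal.
  by case: eqP => [->|_]; rewrite ?mul1r ?mul0r.
under eq_bigr do rewrite tt.
have [kA|kA] := boolP (k \in A); last first.
  rewrite big1_seq// => l /andP[_ lA].
  by case: eqP lA kA => [-> ->|].
rewrite big_mkcond (big_fsetD1 k)//= eqxx big1_seq ?addr0// => l.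
by rewrite !inE => /andP[_ /andP[/negbTE -> _]]; case: ifP.
Qed.

Lemma rnorm_expansion (E : preHilbertType R) (J : set I) (psi : I -> E) (A : {fset I}) :
  rnorm (partial_expansion J psi A) ^+ 2 = \sum_(l <- A | l \in J) rnorm (psi l) ^+ 2.
Proof.
rewrite -rdotxx {2}/partial_expansion.
have -> : forall (s : seq I) (f : hsum I E),
    rdot f (\sum_(l <- s | l \in J) tensor (v l) (psi l)) =
    \sum_(l <- s | l \in J) rdot f (tensor (v l) (psi l)).
  move=> s f; elim/big_rec2: _ => [|l y x _ <-]; last by rewrite rdotDr.
  by rewrite /rdot dotp0r.
rewrite big_seq_cond [RHS]big_seq_cond; apply: eq_bigr => l /andP[lA lJ].
by rewrite /rdot dotp_expansion lA lJ -rdotxx.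
Qed.

(** By orthonormality, the squared distance between nested partial expansions is a difference of
    partial sums of |psi_l|^2, which increase to a finite supremum. *)
Lemma expansion_cvg (E : preHilbertType R) (J : set I) (psi : I -> E) :
  seq_complete E -> square_summable J psi ->
  cvg (partial_expansion J psi @ totally).
Proof.
move=> Ec /square_summableP[M psiM].
apply: seq_complete_net; first exact: hsum_complete.
move=> e e0.
pose s (A : {fset I}) := \sum_(i <- A | i \in J) rnorm (psi i) ^+ 2.
have sups : has_sup (range s).
  by split; [exists (s fset0), fset0|exists M => _ [A _ <-]; exact: psiM].
have e2 : 0 < (e / 2) ^+ 2 by rewrite exprn_gt0// divr_gt0.
have [_ [A _ <-] sA] := sup_adherent e2 sups.
have key (B : {fset I}) : (A `<=` B)%fset ->
    rnorm (partial_expansion J psi B - partial_expansion J psi A) < e / 2.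
  move=> AB; rewrite -ltr_sqr ?nnegrE ?rnorm_ge0 ?ltW ?divr_gt0//.
  have <- : partial_expansion J psi (B `\` A)%fset =
      partial_expansion J psi B - partial_expansion J psi A.
    apply/eqP; rewrite eq_sym subr_eq; apply/eqP.
    exact: big_fset_split.
  have sB : s B <= sup (range s) by apply: ub_le_sup; [exact: sups.2|exists B].
  have sBA : s B = s (B `\` A)%fset + s A.
    exact: big_fset_split.
  rewrite rnorm_expansion -/(s _); move: sA sB sBA.
  by move: (s A) (s B) (s _) (sup _) => *; lra.
exists [set B | (A `<=` B)%fset]; first by exists A.
move=> B C /= AB AC.
rewrite (le_lt_trans (rnorm_dist _ (partial_expansion J psi A) _))// [e]splitr.
by rewrite ltrD ?key// rnorm_distC key.
Qed.

Lemma expansion_perp (E : preHilbertType R) (J J' : set I) (psi : I -> E) w :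
  J `&` J' = set0 -> partial_expansion J psi @ totally --> w -> perp J' E w.
Proof.
move=> JJ'; apply: perp_cvg; apply: nearW => A k g J'k.
rewrite dotp_expansion; case: andP => // -[_ /set_mem Jk].
have : (J `&` J') k by []. by rewrite JJ'.
Qed.

(** The coefficient psi_l is the vector with (psi_l | g) = (w | v_l (x) g), and Bessel's inequality
    makes the family square summable. The sum w' of the expansion has the same coefficients, so w -
    w' lies in [perp J] as well as in [perp J']. *)
Lemma perp_expansion (E : preHilbertType R) (J J' : set I) w :
  seq_complete E -> J `|` J' = setT -> J `&` J' = set0 -> perp J' E w ->
  exists2 psi, square_summable J psi & partial_expansion J psi @ totally --> w.
Proof.
move=> Ec JuJ JnJ wJ'.
have /choice[psi psiP] l : exists c, forall g, dotp w (tensor (v l) g) = dotp c g.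
  have [||c cP] := riesz (phi := fun g => (dotp w (tensor (v l) g))^*)
      (M := rnorm w * rnorm (v l)) Ec.
  - by move=> c g h; rewrite tensor_linearr dotpDr dotpZr rmorphD rmorphM/= conjCK.
  - by move=> g; rewrite cabs_conj -mulrA -rnorm_tensor cabs_dotp.
  by exists c => g; rewrite [RHS]dotpC -cP conjCK.
have psis : square_summable J psi.
  apply/square_summableP; exists (rnorm w ^+ 2) => A.
  set S := partial_expansion J psi A.
  have SE : rdot w S = rnorm S ^+ 2.
    rewrite rnorm_expansion /S /partial_expansion.
    elim: (A : seq I) => [|l s ih]; first by rewrite !big_nil /rdot dotp0r.
    rewrite !big_cons; case: ifP => // _; rewrite rdotDr ih; congr (_ + _).
    by rewrite /rdot psiP -rdotxx.
  have := sqr_ge0 (rnorm (w - S)); rewrite rnorm_sqrB SE -rnorm_expansion -/S.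
  by move: (rnorm w ^+ 2) (rnorm S ^+ 2) => *; lra.
exists psi => //; have /cvg_ex[w' ww'] := expansion_cvg Ec psis.
suff -> : w = w' by [].
apply/eqP; rewrite eq_sym -subr_eq0; apply/eqP; apply: (perp_cover JuJ); last first.
  rewrite addrC -scaleN1r; apply: perp_linear => //.
  exact: expansion_perp ww'.
move=> k g Jk; rewrite dotpBl psiP.
suff -> : dotp w' (tensor (v k) g) = dotp (psi k) g by rewrite subrr.
apply: (@cvg_unique_norm R {fset I} totally _ R[i]^o _ _ _ (dotp_cvgl (z := tensor (v k) g) ww')).
apply/cvg_rnormP => e e0; exists [fset k]%fset => [//|A kA].
rewrite dotp_expansion (fsubsetP kA) ?inE ?eqxx// (mem_set Jk)/= subrr.
by rewrite rnorm0.
Qed.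

End Perp.
Arguments perp {R I} v J E _.

(** * The space L2 and pointwise membership *)

Section L2Complete.
Context {d : measure_display} {X : measurableType d} {R : realType}.
Variable mu : {measure set X -> \bar R}.
Local Open Scope quotient_scope.

Lemma ReB (z w : R[i]) : complex.Re (z - w) = complex.Re z - complex.Re w.
Proof. by case: z w => ? ? []. Qed.

Lemma ImB (z w : R[i]) : complex.Im (z - w) = complex.Im z - complex.Im w.
Proof. by case: z w => ? ? []. Qed.

(** By monotone convergence the pointwise limit is integrable, hence finite almost everywhere. *)
Lemma ae_bounded (g : nat -> X -> R) (M : R) :
  (forall n, measurable_fun setT (g n)) -> (forall n x, 0 <= g n x) ->
  (forall x n m, (n <= m)%N -> g n x <= g m x) ->
  (forall n, (\int[mu]_x (g n x)%:E <= M%:E)%E) ->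
  {ae mu, forall x, exists B, forall n, g n x <= B}.
Proof.
move=> mg g0 gnd gM.
have mge n : measurable_fun setT (fun x => (g n x)%:E) by exact/measurable_EFinP.
pose f x := limn (fun n => (g n x)%:E).
have gcvg x : cvgn (fun n => (g n x)%:E).
  by apply: ereal_nondecreasing_is_cvgn => n m nm; rewrite lee_fin gnd.
have gf n x : ((g n x)%:E <= f x)%E.
  apply: lime_ge (gcvg x) _; exists n => // m nm.
  by rewrite lee_fin gnd.
have mf : measurable_fun setT f.
  rewrite (_ : f = fun x => limn_esup (fun n => (g n x)%:E)).
    exact: measurable_fun_limn_esup.
  by apply/funext => x; rewrite is_cvg_limn_esupE.
have f0 x : (0 <= f x)%E by rewrite (le_trans _ (gf 0%N x))// lee_fin.
have fint : mu.-integrable setT f.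
  apply/integrableP; split => //.
  under eq_integral do rewrite gee0_abs//.
  rewrite monotone_convergence//; last 2 first.
  - by move=> n x _; rewrite lee_fin.
  - by move=> x _ n m nm; rewrite lee_fin gnd.
  apply: le_lt_trans (ltry M); apply: lime_le; last by apply: nearW => n.
  apply: ereal_nondecreasing_is_cvgn => n m nm.
  by apply: ge0_le_integral => // x _; rewrite lee_fin// gnd.
apply: filterS (integrable_ae measurableT fint) => x /(_ I) fx.
by exists (fine (f x)) => n; rewrite -lee_fin fineK.
Qed.

Lemma L2fun_measurable (f : L2fun mu) :
  measurable_fun setT (fun x => complex.Re (f x)) /\
  measurable_fun setT (fun x => complex.Im (f x)).
Proof.
by have [+ +] := L2fun_Lfun f; rewrite !inE => /andP[+ _] /andP[+ _]; rewrite !inE.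
Qed.

Lemma cabs_sqr_measurable (f : X -> R[i]) :
  measurable_fun setT (fun x => complex.Re (f x)) ->
  measurable_fun setT (fun x => complex.Im (f x)) ->
  measurable_fun setT (fun x => cabs (f x) ^+ 2).
Proof.
move=> mr mi; under eq_fun do rewrite cabs_sqrE.
by apply: measurable_funD; exact: measurable_funX.
Qed.

Lemma L2_normE (f : L2 mu) :
  (rnorm f ^+ 2)%:E = (\int[mu]_x (cabs (L2_to_fun f x) ^+ 2)%:E)%E.
Proof.
have [rf imf] := cintegrable_L2fun (repr f) (repr f).
rewrite -rdotxx /rdot L2_dotpE /cintegral/= /Rintegral fineK; last first.
  exact: integrable_fin_num rf.
apply: eq_integral => x _; congr EFin; rewrite cabs_sqrE /L2_to_fun.
by case: (repr f x) => a b /=; rewrite mulrN opprK.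
Qed.

Lemma L2_piE (f : L2fun mu) : {ae mu, forall x, L2_to_fun (\pi_(L2 mu) f) x = f x}.
Proof. exact: repr_L2. Qed.

Lemma L2_ext (f g : L2 mu) :
  {ae mu, forall x, L2_to_fun f x = L2_to_fun g x} -> f = g.
Proof.
move=> fg; rewrite -[f]reprK -[g]reprK; apply/eqP/L2_eqP; exact: fg.
Qed.

Lemma L2_DE (f g : L2 mu) :
  {ae mu, forall x, L2_to_fun (f + g) x = L2_to_fun f x + L2_to_fun g x}.
Proof. by apply: filterS (L2_piE (repr f + repr g)) => x ->. Qed.

Lemma L2_ZE c (f : L2 mu) :
  {ae mu, forall x, L2_to_fun (c *: f) x = c * L2_to_fun f x}.
Proof. by apply: filterS (L2_piE (c *: repr f)) => x ->. Qed.

Lemma L2_BE (f g : L2 mu) :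
  {ae mu, forall x, L2_to_fun (f - g) x = L2_to_fun f x - L2_to_fun g x}.
Proof.
rewrite -scaleN1r; apply: filterS2 (L2_DE f (-1 *: g)) (L2_ZE (-1) g) => x -> ->.
by rewrite mulN1r.
Qed.

Lemma L2_0E : {ae mu, forall x, L2_to_fun (0 : L2 mu) x = 0}.
Proof. by have := L2_ZE 0 0; rewrite scale0r; apply: filterS => x ->; rewrite mul0r. Qed.

Lemma Lfun2P (g : X -> R) : measurable_fun setT g ->
  (\int[mu]_x (g x ^+ 2)%:E < +oo)%E -> g \in Lfun mu 2%:E.
Proof.
move=> mg gi; rewrite inE; apply/andP; split; first by rewrite inE.
rewrite inE/= /finite_norm unlock; apply: poweR_lty.
rewrite (_ : (\int[mu]_x _)%E = (\int[mu]_x (g x ^+ 2)%:E)%E)//.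
apply: eq_integral => x _ /=.
by rewrite powR_mulrn// real_normK// num_real.
Qed.

Lemma L2fun_predP (g : X -> R[i]) :
  measurable_fun setT (fun x => complex.Re (g x)) ->
  measurable_fun setT (fun x => complex.Im (g x)) ->
  (\int[mu]_x (cabs (g x) ^+ 2)%:E < +oo)%E ->
  (g : X -> R[i]^o) \in L2fun_pred mu.
Proof.
move=> mr mi gi; have mg := cabs_sqr_measurable mr mi.
have key (f : X -> R) : measurable_fun setT f ->
    (forall x, f x ^+ 2 <= cabs (g x) ^+ 2) -> f \in Lfun mu 2%:E.
  move=> mf fg; apply: Lfun2P => //; apply: le_lt_trans gi.
  apply: ge0_le_integral; first exact: measurableT.
  - by move=> x _; rewrite lee_fin sqr_ge0.
  - by apply/measurable_EFinP; exact: measurable_funX.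
  - exact/measurable_EFinP.
  - by move=> x _; rewrite lee_fin.
apply/andP; split; apply: key => // x; rewrite cabs_sqrE.
  by rewrite lerDl sqr_ge0.
by rewrite lerDr sqr_ge0.
Qed.

Lemma cvg_complexP (u : nat -> R[i]) (l : R[i]) :
  u n @[n --> \oo] --> (l : R[i]^o) ->
  complex.Re (u n) @[n --> \oo] --> complex.Re l /\
  complex.Im (u n) @[n --> \oo] --> complex.Im l.
Proof.
move=> /(@cvg_rnormP R nat \oo _ R[i]^o u l) ul.
have re (z : R[i]) : `|complex.Re z| <= cabs z by exact: Re_le_cabs.
have im (z : R[i]) : `|complex.Im z| <= cabs z.
  rewrite -ler_sqr ?nnegrE ?cabs_ge0//.
  by rewrite cabs_sqrE real_normK ?num_real// lerDr sqr_ge0.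
split; apply/cvgrPdist_lt => e /ul; apply: filterS => n.
- by apply: le_lt_trans; rewrite -ReB; exact: re.
- by apply: le_lt_trans; rewrite -ImB; exact: im.
Qed.

(** Fatou's lemma for |u_m - u_n|^2 as n grows turns the Cauchy estimate into a bound on |u_m - h|.
    It serves for completeness and also to identify norm limits with almost everywhere limits. *)
Lemma L2_cvg_ae (u : nat -> L2 mu) (h : X -> R[i]) :
  (forall e : R, 0 < e -> exists N, forall n m, (N <= n)%N -> (N <= m)%N ->
    rnorm (u n - u m) < e) ->
  {ae mu, forall x, L2_to_fun (u n) x @[n --> \oo] --> (h x : R[i]^o)} ->
  exists2 l : L2 mu, u n @[n --> \oo] --> l &
    {ae mu, forall x, L2_to_fun l x = h x}.
Proof.
move=> uc uh.
pose ru n x := complex.Re (L2_to_fun (u n) x).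
pose iu n x := complex.Im (L2_to_fun (u n) x).
have mru n : measurable_fun setT (ru n) by have [] := L2fun_measurable (repr (u n)).
have miu n : measurable_fun setT (iu n) by have [] := L2fun_measurable (repr (u n)).
(* h itself need not be measurable; k is, and it equals h almost everywhere. *)
pose rk x := fine (limn_esup (fun n => (ru n x)%:E)).
pose ik x := fine (limn_esup (fun n => (iu n x)%:E)).
pose k x : R[i] := Complex (rk x) (ik x).
have mfine (f : nat -> X -> R) : (forall n, measurable_fun setT (f n)) ->
    measurable_fun setT (fun x => fine (limn_esup (fun n => (f n x)%:E))).
  move=> mf; apply: (measurableT_comp (fine_measurable measurableT)).
  by apply: measurable_fun_limn_esup => n; exact/measurable_EFinP.
have mrk : measurable_fun setT rk by exact: mfine.
have mik : measurable_fun setT ik by exact: mfine.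
have hk : {ae mu, forall x, k x = h x}.
  apply: filterS uh => x /cvg_complexP[rx ix].
  have e (f : nat -> R) (l : R) : f n @[n --> \oo] --> l ->
      fine (limn_esup (fun n => (f n)%:E)) = l.
    move=> fl; have fl' : (f n)%:E @[n --> \oo] --> l%:E.
      by apply: cvg_EFin => //; exact: nearW.
    by rewrite is_cvg_limn_esupE ?(cvg_lim _ fl')//; apply: cvgP fl'.
  by rewrite /k /rk /ik (e _ _ rx) (e _ _ ix); case: (h x).
pose phi m n x := (cabs (L2_to_fun (u m) x - L2_to_fun (u n) x) ^+ 2)%:E.
pose psi m x := (cabs (L2_to_fun (u m) x - k x) ^+ 2)%:E.
have mD m (f : X -> R[i]) : measurable_fun setT (fun x => complex.Re (f x)) ->
    measurable_fun setT (fun x => complex.Im (f x)) ->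
    measurable_fun setT (fun x => complex.Re (L2_to_fun (u m) x - f x)) /\
    measurable_fun setT (fun x => complex.Im (L2_to_fun (u m) x - f x)).
  move=> mr mi; split.
    rewrite (_ : (fun x => _) = (ru m \- (fun x => complex.Re (f x)))).
      exact: measurable_funB.
    by apply/funext => x; rewrite ReB.
  rewrite (_ : (fun x => _) = (iu m \- (fun x => complex.Im (f x)))).
    exact: measurable_funB.
  by apply/funext => x; rewrite ImB.
have mphi m n : measurable_fun setT (phi m n).
  have [a b] := mD m _ (mru n) (miu n).
  by apply/measurable_EFinP; exact: cabs_sqr_measurable.
have mpsi m : measurable_fun setT (psi m).
  have [a b] := mD m k mrk mik.
  by apply/measurable_EFinP; exact: cabs_sqr_measurable.
have phiE m n : (\int[mu]_x phi m n x = (rnorm (u m - u n) ^+ 2)%:E)%E.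
  rewrite L2_normE; apply: ae_eq_integral => //.
    have [a b] := L2fun_measurable (repr (u m - u n)).
    by apply/measurable_EFinP; exact: cabs_sqr_measurable a b.
  by apply: filterS (L2_BE (u m) (u n)) => x; rewrite /phi => <-.
have psi_le m M N : (forall n, (N <= n)%N -> rnorm (u m - u n) <= M) ->
    (\int[mu]_x psi m x <= (M ^+ 2)%:E)%E.
  move=> uM.
  have -> : (\int[mu]_x psi m x = \int[mu]_x limn_einf (phi m ^~ x))%E.
    apply: ae_eq_integral => //.
      rewrite /limn_einf; apply: measurableT_comp => //.
      by apply: measurable_fun_limn_esup => n; exact: measurableT_comp.
    apply: filterS2 uh hk => x ux hx _; rewrite /psi hx.
    have c : phi m n x @[n --> \oo] --> (cabs (L2_to_fun (u m) x - h x) ^+ 2)%:E.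
      apply: cvg_EFin; first exact: nearW.
      have c0 : cabs (L2_to_fun (u m) x - L2_to_fun (u n) x) @[n --> \oo] -->
          cabs (L2_to_fun (u m) x - h x).
        apply: (@cvg_rnorm R nat \oo _ R[i]^o).
        exact: (@cvgB _ R[i]^o _ _ _ (cst _) _ _ _ (cvg_cst _) ux).
      by rewrite expr2; exact: (cvgM c0 c0).
    by rewrite is_cvg_limn_einfE ?(cvg_lim _ c)//; apply: cvgP c.
  apply: (le_trans (fatou mu measurableT (mphi m) _)).
    by move=> n x _; rewrite lee_fin sqr_ge0.
  rewrite limn_einf_lim; apply: lime_le; first exact: is_cvg_einfs.
  exists N => // n /= Nn.
  have : (einfs (fun n => \int[mu]_x phi m n x) n <= \int[mu]_x phi m n x)%E.
    by apply: ereal_inf_lbound; exists n => /=.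
  move=> /le_trans; apply; rewrite phiE lee_fin ler_sqr ?nnegrE ?rnorm_ge0 ?uM//.
  by rewrite (le_trans (rnorm_ge0 _) (uM _ Nn)).
have [N NP] := uc _ ltr01.
(* Fatou controls only the difference u_N - k; k is recovered below as a difference of two square
   integrable functions. *)
have kd : (fun x => L2_to_fun (u N) x - k x : R[i]^o) \in L2fun_pred mu.
  have [a b] := mD N k mrk mik.
  apply: L2fun_predP => //.
  apply: (le_lt_trans (psi_le N 1 N _) (ltry _)) => n Nn.
  exact/ltW/NP.
pose kf : L2fun mu := repr (u N) - MkL2fun kd.
have kfE x : kf x = k x by rewrite /kf/= fctE/= subKr.
exists (\pi_(L2 mu) kf); last first.
  by apply: filterS2 (L2_piE kf) hk => x -> <-.
apply/cvg_rnormP => e e0; have e2 : 0 < e / 2 by rewrite divr_gt0.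
have [M MP] := uc _ e2; exists M => // m /= Mm.
have ee : e / 2 < e by lra.
rewrite rnorm_distC; apply: (le_lt_trans _ ee).
rewrite -ler_sqr ?nnegrE ?rnorm_ge0 ?(ltW e2)// -lee_fin L2_normE.
apply: le_trans (psi_le m _ M _); last by move=> n Mn; exact/ltW/MP.
rewrite le_eqVlt; apply/orP; left; apply/eqP; apply: ae_eq_integral => //.
  have [a b] := L2fun_measurable (repr (u m - \pi_(L2 mu) kf)).
  by apply/measurable_EFinP; exact: cabs_sqr_measurable a b.
apply: filterS2 (L2_BE (u m) (\pi_(L2 mu) kf)) (L2_piE kf) => x -> -> _.
by rewrite kfE.
Qed.

Lemma geometric_small (e : R) : 0 < e -> exists k : nat, (2^-1 : R) ^+ k < e.
Proof.
move=> e0; have h1 : `|2^-1 : R| < 1.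
  by rewrite ger0_norm ?invr_ge0// invf_lt1// ltr1n.
have /cvgrPdist_lt/(_ _ e0)[k _ kP] := cvg_expr h1.
exists k; have := kP k (leqnn _).
by rewrite /= sub0r normrN ger0_norm.
Qed.

Lemma real_cauchy_cvg (u : nat -> R) :
  (forall e : R, 0 < e -> exists N, forall n m, (N <= n)%N -> (N <= m)%N ->
    `|u n - u m| < e) -> cvg (u n @[n --> \oo]).
Proof.
move=> uc; apply: cauchy_cvg; apply/cauchy_ballP => e /uc[N Ne].
exists (u @` [set n | (N <= n)%N], u @` [set n | (N <= n)%N]) => /=.
  by split; exists N => // n Nn; exists n.
move=> [_ _] /= [[n Nn <-] [m Nm <-]].
by rewrite -ball_normE /ball_/=; exact: Ne.
Qed.

Lemma complex_seq_complete : seq_complete (R[i]^o : normedModType R[i]).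
Proof.
move=> u uc.
have re (z : R[i]) : `|complex.Re z| <= cabs z by exact: Re_le_cabs.
have im (z : R[i]) : `|complex.Im z| <= cabs z.
  rewrite -ler_sqr ?nnegrE ?cabs_ge0//.
  by rewrite cabs_sqrE real_normK ?num_real// lerDr sqr_ge0.
have /cvg_ex[a ua] : cvg (complex.Re (u n : R[i]) @[n --> \oo]).
  apply: real_cauchy_cvg => e /uc[N NP]; exists N => n m Nn Nm.
  by rewrite -ReB (le_lt_trans (re _))//; exact: NP.
have /cvg_ex[b ub] : cvg (complex.Im (u n : R[i]) @[n --> \oo]).
  apply: real_cauchy_cvg => e /uc[N NP]; exists N => n m Nn Nm.
  by rewrite -ImB (le_lt_trans (im _))//; exact: NP.
apply/cvg_ex; exists (Complex a b); apply/cvg_rnormP => e e0.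
have e2 : 0 < e / 2 by rewrite divr_gt0.
move/cvgrPdist_lt/(_ _ e2) : ua => ua; move/cvgrPdist_lt/(_ _ e2) : ub => ub.
apply: filterS2 ua ub => n an bn.
rewrite -[rnorm _]/(cabs ((Complex a b : R[i]) - u n)).
rewrite -ltr_sqr ?nnegrE ?cabs_ge0 ?ltW// cabs_sqrE ReB ImB.
rewrite -[X in X + _]real_normK ?num_real// -[X in _ + X]real_normK ?num_real//.
rewrite (@lt_trans _ _ ((e / 2) ^+ 2 + (e / 2) ^+ 2))//; last by nra.
by rewrite ltrD// ltr_sqr ?nnegrE ?normr_ge0 ?(ltW e2).
Qed.

(** Riesz-Fischer: terms w whose successive distances are at most 4^-k converge almost everywhere,
    [L2_cvg_ae] makes this a norm limit, and the Cauchy property extends it to the whole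
    sequence. *)
Lemma L2_complete : seq_complete (L2 mu).
Proof.
move=> u uc; pose q : R := 2^-1.
have q0 k : 0 < q ^+ k by rewrite exprn_gt0// invr_gt0.
have [N NP] := choice (fun k => uc _ (exprn_gt0 2 (q0 k))).
(* Partial sums of N provide indices that are nondecreasing in k and at least [N k]. *)
pose n_ k := (\sum_(j < k.+1) N j)%N.
have n_N k : (N k <= n_ k)%N by rewrite /n_ big_ord_recr/= leq_addl.
have n_nd k j : (k <= j)%N -> (n_ k <= n_ j)%N.
  move=> kj; rewrite -(subnK kj); elim: (j - k)%N => // i ih.
  by rewrite addSn (leq_trans ih)// /n_ [leqRHS]big_ord_recr/= leq_addr.
pose w k := u (n_ k); pose dw k := w k.+1 - w k.
have dw_le k : rnorm (dw k) <= (q ^+ k) ^+ 2.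
  by apply/ltW/NP; rewrite ?(leq_trans (n_N _))// n_nd.
(* The weights 4^k turn the a.e. bound on g into a geometric bound on dw. *)
pose g K x := \sum_(k < K) (q ^- k) ^+ 2 * cabs (L2_to_fun (dw k) x) ^+ 2.
have mdw k : measurable_fun setT (fun x => cabs (L2_to_fun (dw k) x) ^+ 2).
  by have [a b] := L2fun_measurable (repr (dw k)); exact: cabs_sqr_measurable a b.
have mg K : measurable_fun setT (g K).
  by apply: measurable_sum => k; exact: measurable_funM.
have g0 K x : 0 <= g K x.
  by apply: sumr_ge0 => k _; rewrite mulr_ge0// sqr_ge0.
have gnd x K L : (K <= L)%N -> g K x <= g L x.
  move=> KL; rewrite -(subnK KL); elim: (L - K)%N => // i ih.
  rewrite addSn (le_trans ih)// /g [leRHS]big_ord_recr/= lerDl.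
  by rewrite mulr_ge0// sqr_ge0.
have gint K : (\int[mu]_x (g K x)%:E <= 2%:E)%E.
  have -> : (\int[mu]_x (g K x)%:E =
      (\sum_(k < K) (q ^- k) ^+ 2 * rnorm (dw k) ^+ 2)%:E)%E.
    under eq_integral do rewrite /g -sumEFin.
    rewrite ge0_integral_sum//; last 2 first.
    - by move=> k; apply/measurable_EFinP; exact: measurable_funM.
    - by move=> k x _; rewrite lee_fin mulr_ge0// sqr_ge0.
    rewrite -sumEFin; apply: eq_bigr => k _.
    under eq_integral do rewrite EFinM.
    rewrite ge0_integralZl//; last 3 first.
    - exact/measurable_EFinP.
    - by move=> x _; rewrite lee_fin sqr_ge0.
    - by rewrite lee_fin sqr_ge0.
    by rewrite -L2_normE EFinM.
  (* The k-th term contributes at most 4^-k; the sharper bound 2 - 2 * 4^-K is the one that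
     induction carries. *)
  rewrite lee_fin (@le_trans _ _ (2 - 2 * (q ^+ K) ^+ 2))//; last first.
    by rewrite gerBl mulr_ge0// sqr_ge0.
  elim: K => [|K ih]; first by rewrite big_ord0 expr0 expr1n mulr1 subrr.
  rewrite big_ord_recr/= (le_trans (lerD ih (_ : _ <= (q ^+ K) ^+ 2)))//.
    rewrite (@le_trans _ _ ((q ^- K) ^+ 2 * ((q ^+ K) ^+ 2) ^+ 2))//.
      by rewrite ler_wpM2l ?sqr_ge0// ler_sqr ?nnegrE ?rnorm_ge0 ?sqr_ge0// dw_le.
    rewrite (_ : _ * _ = (q ^+ K) ^+ 2)//; field.
    by rewrite gt_eqF.
  rewrite [q ^+ K.+1]exprS exprMn.
  by have := sqr_ge0 (q ^+ K); move: ((q ^+ K) ^+ 2) => ?; rewrite /q; lra.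
have wc : {ae mu, forall x, cvg ((L2_to_fun (w k) x : R[i]^o) @[k --> \oo])}.
  have dwE : {ae mu, forall x, forall k,
      L2_to_fun (dw k) x = L2_to_fun (w k.+1) x - L2_to_fun (w k) x}.
    by apply: ae_foralln => k; exact: L2_BE.
  apply: filterS2 (ae_bounded mg g0 gnd gint) dwE => x [B gB] dE.
  have B0 : 0 <= B by rewrite (le_trans (g0 0%N x))// gB.
  (* B + 1 serves as an upper bound for the square root of B. *)
  have step k : cabs (L2_to_fun (w k.+1) x - L2_to_fun (w k) x) <= (B + 1) * q ^+ k.
    rewrite -dE -ler_sqr ?nnegrE ?cabs_ge0 ?mulr_ge0 ?addr_ge0 ?(ltW (q0 _))//.
    have : (q ^- k) ^+ 2 * cabs (L2_to_fun (dw k) x) ^+ 2 <= B.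
      rewrite (le_trans _ (gB k.+1))// /g big_ord_recr/= lerDr.
      by rewrite sumr_ge0// => j _; rewrite mulr_ge0// sqr_ge0.
    rewrite exprVn mulrC ler_pdivrMr ?(exprn_gt0 2 (q0 k))// => /le_trans; apply.
    by rewrite exprMn ler_wpM2r ?sqr_ge0//; nra.
  have far k j : cabs (L2_to_fun (w (k + j)%N) x - L2_to_fun (w k) x) <=
      (B + 1) * (2 * q ^+ k - 2 * q ^+ (k + j)).
    elim: j => [|j ih]; first by rewrite addn0 !subrr mulr0 cabs0.
    rewrite addnS.
    have := @rnorm_dist R R[i]^o (L2_to_fun (w (k + j).+1) x) (L2_to_fun (w (k + j)%N) x)
      (L2_to_fun (w k) x).
    move=> /le_trans; apply; rewrite (le_trans (lerD (step _) ih))//.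
    rewrite -mulrDr ler_wpM2l ?addr_ge0// exprS.
    by move: (q ^+ (k + j)) (q ^+ k) => *; rewrite /q; lra.
  apply: complex_seq_complete => e e0.
  have B1 : 0 < 4 * (B + 1) by rewrite mulr_gt0// ltr_wpDl.
  have [k ke] := geometric_small (divr_gt0 e0 B1); exists k.
  have near n : (k <= n)%N ->
      cabs (L2_to_fun (w n) x - L2_to_fun (w k) x) <= 2 * (B + 1) * q ^+ k.
    move=> kn; rewrite -(subnKC kn) (le_trans (far _ _))//.
    rewrite [2 * (B + 1)]mulrC -mulrA ler_wpM2l ?addr_ge0// gerBl.
    by rewrite mulr_ge0// ltW.
  move=> n m kn km.
  have := @rnorm_dist R R[i]^o (L2_to_fun (w n) x) (L2_to_fun (w k) x) (L2_to_fun (w m) x).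
  move=> /le_lt_trans; apply.
  rewrite [X in _ + X]rnorm_distC (le_lt_trans (lerD (near _ kn) (near _ km)))//.
  move: ke; rewrite -/q ltr_pdivlMr//; move: (q ^+ k) => *; nra.
have wcauchy (e : R) : 0 < e -> exists N, forall n m, (N <= n)%N -> (N <= m)%N ->
    rnorm (w n - w m) < e.
  move=> e0; have [k ke] := geometric_small e0.
  exists k => n m kn km; rewrite (lt_trans _ ke)//.
  rewrite (@lt_le_trans _ _ ((q ^+ k) ^+ 2))//.
    by apply: NP; rewrite (leq_trans (n_N k))// n_nd.
  rewrite expr2 ler_piMl ?(ltW (q0 _))// exprn_ile1 ?invr_ge0//.
  by rewrite invf_le1// ler1n.
have [l wl _] := @L2_cvg_ae w (fun x => lim ((L2_to_fun (w k) x : R[i]^o) @[k --> \oo]))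
  wcauchy wc.
apply/cvg_ex; exists l; apply/cvg_rnormP => e e0.
have e2 : 0 < e / 2 by rewrite divr_gt0.
have [M MP] := uc _ e2; move/cvg_rnormP/(_ _ e2) : wl => [K _ KP].
have [k ke] := geometric_small e2.
pose j := maxn K k; have := KP j (leq_maxl _ _); rewrite /= => lj.
exists (N j) => // n /= jn.
rewrite (le_lt_trans (rnorm_dist _ (w j) _))// [e]splitr ltrD//.
rewrite (lt_trans _ ke)// (@lt_le_trans _ _ ((q ^+ j) ^+ 2))//.
  exact: NP.
have q1 : q <= 1 by rewrite invf_le1// ler1n.
have q00 : 0 <= q by rewrite invr_ge0.
rewrite (@le_trans _ _ (q ^+ j))//.
  by rewrite expr2 ler_piMl ?(ltW (q0 _))// exprn_ile1.
by rewrite ler_wiXn2l// leq_maxr.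
Qed.

End L2Complete.

(** * Contractions and pointwise values *)

Section Contraction.
Context {R : realType} {I : choiceType} {E : preHilbertType R}.

(** For E = L2, c y is the function x |-> (psi(x) | y). Its weak description says that psi is
    orthogonal to all y (x) g precisely when c y = 0; the series gives access to its values at
    points. *)
Lemma tensor_contraction (psi : hsum I E) : seq_complete E ->
  exists c : ell2 R I -> E, forall y,
    (forall g, dotp psi (tensor y g) = dotp (c y) g) /\
    (fun A : {fset I} => \sum_(i <- A) (y i : R[i])^* *: psi i) @ totally --> c y.
Proof.
move=> Ec.
have /choice[c cP] (y : ell2 R I) : exists c, forall g, dotp psi (tensor y g) = dotp c g.
  have [||c cP] := riesz (phi := fun g => (dotp psi (tensor y g))^*)
      (M := rnorm psi * rnorm y) Ec.
  - by move=> c g h; rewrite tensor_linearr dotpDr dotpZr rmorphD rmorphM/= conjCK.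
  - by move=> g; rewrite cabs_conj -mulrA -rnorm_tensor cabs_dotp.
  by exists c => g; rewrite [RHS]dotpC -cP conjCK.
have cB y z : c (y - z) = c y - c z.
  apply/eqP; rewrite -subr_eq0; apply/eqP/dotp_eq0 => g.
  by rewrite 2!dotpBl -!cP -dotpBr -tensorBl subrr.
have c0 : c 0 = 0 by rewrite -(subrr 0) cB subrr.
have cD y z : c (y + z) = c y + c z.
  have cN w : c (- w) = - c w by rewrite -sub0r cB c0 sub0r.
  by rewrite -[z in LHS]opprK cB cN opprK.
have cM y : rnorm (c y) <= rnorm psi * rnorm y.
  have [->|/eqP n0] := eqVneq (rnorm (c y)) 0; first by rewrite mulr_ge0 ?rnorm_ge0.
  have {}n0 : 0 < rnorm (c y) by rewrite lt_neqAle rnorm_ge0 andbT eq_sym; exact/eqP.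
  rewrite -(ler_pM2r n0) -expr2 -rdotxx /rdot -cP -mulrA -rnorm_tensor.
  by rewrite (le_trans (ler_norm _))// (le_trans (Re_le_cabs _))// cabs_dotp.
exists c => y; split; first exact: cP.
have cc : continuous c by exact: rnorm_continuous_linear cM.
have := cvg_comp _ _ (@hsum_single_cvg _ _ R[i]^o y) (cc y).
rewrite (_ : c \o _ = (fun A : {fset I} => \sum_(i <- A) (y i : R[i])^* *: psi i))//.
apply/funext => A /=; elim: (A : seq I) => [|i s ih]; first by rewrite !big_nil.
rewrite !big_cons cD ih; congr (_ + _); apply/eqP; rewrite -subr_eq0.
apply/eqP/dotp_eq0 => g; rewrite dotpBl -cP dotpZl.
rewrite (_ : tensor _ g = hsum_single i ((y i : R[i]) *: g)).
  by rewrite dotp_single dotpZr subrr.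
apply: hsum_ext => j; rewrite tensorE !hsum_singleE.
by case: ifP => // _; rewrite scale0r.
Qed.

End Contraction.

Section Exhaustion.
Context {I : countType}.

(** A cofinal sequence of finite sets: it turns limits along finite subsets into limits of
    sequences, as required by statements valid almost everywhere. *)
Definition fset_upto (n : nat) : {fset I} :=
  seq_fset tt (pmap (@choice.unpickle I) (iota 0 n)).

Lemma fset_upto_mem (i : I) n : (choice.pickle i < n)%N -> i \in fset_upto n.
Proof.
move=> lein; rewrite seq_fsetE mem_pmap; apply/mapP; exists (choice.pickle i).
  by rewrite mem_iota.
by rewrite choice.pickleK.
Qed.

Lemma fset_upto_subset n m : (n <= m)%N -> (fset_upto n `<=` fset_upto m)%fset.
Proof.
move=> nm; apply/fsubsetP => i; rewrite !seq_fsetE !mem_pmap => /mapP[k + ->].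
rewrite mem_iota => /andP[_ kn]; apply: map_f.
by rewrite mem_iota/= (leq_trans kn).
Qed.

Lemma fset_upto_cofinal (A : {fset I}) : exists n, (A `<=` fset_upto n)%fset.
Proof.
exists (\max_(i <- A) (choice.pickle i)).+1; apply/fsubsetP => i iA.
by apply: fset_upto_mem; rewrite ltnS (big_rem i)//= leq_maxl.
Qed.

Lemma fset_upto_cvg : fset_upto n @[n --> \oo] --> (@totally I).
Proof.
move=> P [A _ AP]; have [N AN] := fset_upto_cofinal A.
exists N => // n /= Nn; apply: AP => /=.
exact: fsubset_trans AN (fset_upto_subset Nn).
Qed.

End Exhaustion.

Section Pointwise.
Context {d : measure_display} {X : measurableType d} {R : realType}.
Variable mu : {measure set X -> \bar R}.
Context {I : countType}.

Lemma L2_lincombE (s : seq I) (c : I -> R[i]) (f : I -> L2 mu) :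
  {ae mu, forall x, L2_to_fun (\sum_(i <- s) c i *: f i) x =
    \sum_(i <- s) c i * L2_to_fun (f i) x}.
Proof.
elim: s => [|i s ih].
  by rewrite big_nil; apply: filterS (L2_0E mu) => x ->; rewrite big_nil.
rewrite big_cons.
apply: filterS2 (L2_DE (c i *: f i) (\sum_(j <- s) c j *: f j)) _ => [x ->|].
  exact.
apply: filterS2 (L2_ZE (c i) (f i)) ih => x -> ->.
by rewrite big_cons.
Qed.

(** The sums of squares over [fset_upto n] have integral at most |psi|^2, so at almost every x they
    stay bounded. *)
Lemma pointwise_ell2 (psi : hsum I (L2 mu)) :
  {ae mu, forall x, exists z : ell2 R I, forall i, z i = L2_to_fun (psi i) x}.
Proof.
pose g n x := \sum_(i <- @fset_upto I n) cabs (L2_to_fun (psi i) x) ^+ 2.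
have mi i : measurable_fun setT (fun x => cabs (L2_to_fun (psi i) x) ^+ 2).
  by have [a b] := L2fun_measurable (repr (psi i)); exact: cabs_sqr_measurable a b.
have mg n : measurable_fun setT (g n) by apply: measurable_sum => i.
have g0 n x : 0 <= g n x by apply: sumr_ge0 => i _; exact: sqr_ge0.
have le_sum (A B : {fset I}) x : (A `<=` B)%fset ->
    \sum_(i <- A) cabs (L2_to_fun (psi i) x) ^+ 2 <=
    \sum_(i <- B) cabs (L2_to_fun (psi i) x) ^+ 2.
  move=> AB; rewrite [leRHS](big_fset_split _ _ AB) lerDr sumr_ge0// => i _.
  exact: sqr_ge0.
have gnd x n m : (n <= m)%N -> g n x <= g m x.
  by move=> nm; apply: le_sum; exact: fset_upto_subset.
have gint n : (\int[mu]_x (g n x)%:E <= (rnorm psi ^+ 2)%:E)%E.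
  under eq_integral do rewrite /g -sumEFin.
  rewrite ge0_integral_sum//; last 2 first.
  - by move=> i; apply/measurable_EFinP.
  - by move=> i x _; rewrite lee_fin sqr_ge0.
  under eq_bigr do rewrite -L2_normE.
  by rewrite sumEFin lee_fin hsum_sum_le.
apply: filterS (ae_bounded mg g0 gnd gint) => x [B gB].
have zs : (fun i => L2_to_fun (psi i) x : R[i]^o) \in @hsum_pred R I R[i]^o.
  apply/hsum_predP/square_summableP; exists B => A.
  rewrite (eq_bigl _ _ (fun i => in_setT i)).
  have [n An] := fset_upto_cofinal A.
  exact: le_trans (le_sum _ _ x An) (gB n).
by exists (Hsum zs).
Qed.

(** The partial sums tend to c in norm and, at almost every x, to (psi(x) | y); [L2_cvg_ae] says
    that the two limits agree. *)
Lemma pointwise_contraction (psi : hsum I (L2 mu)) (y : ell2 R I) (c : L2 mu) :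
  (fun A : {fset I} => \sum_(i <- A) (y i : R[i])^* *: psi i) @ totally --> c ->
  {ae mu, forall x, forall z : ell2 R I, (forall i, z i = L2_to_fun (psi i) x) ->
    dotp z y = L2_to_fun c x}.
Proof.
move=> Ac; pose u n := \sum_(i <- @fset_upto I n) (y i : R[i])^* *: psi i.
have uc : u n @[n --> \oo] --> c by exact: cvg_comp fset_upto_cvg Ac.
(* The pointwise limit has to be a function on all of X: z is the sequence of values where that is
   square summable, and 0 elsewhere. *)
have /choice[z zP] x : exists z : ell2 R I,
    (exists z' : ell2 R I, forall i, z' i = L2_to_fun (psi i) x) ->
    forall i, z i = L2_to_fun (psi i) x.
  have [[z' z'P]|nz] := pselect (exists z' : ell2 R I, forall i, z' i = L2_to_fun (psi i) x).
    by exists z'.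
  by exists 0 => /nz.
have uE : {ae mu, forall x, forall n, L2_to_fun (u n) x =
    \sum_(i <- @fset_upto I n) (y i : R[i])^* * L2_to_fun (psi i) x}.
  by apply: ae_foralln => n; exact: L2_lincombE.
have [||l ul lE] := @L2_cvg_ae _ _ _ mu u (fun x => dotp (z x) y).
- by move=> e e0; exact: cvg_cauchy_seq uc e e0.
- apply: filterS2 uE (pointwise_ell2 psi) => x ux zx.
  have c1 := cvg_comp _ _ fset_upto_cvg (@hsum_dotp_cvg _ _ _ (z x) y).
  rewrite (_ : (fun n => L2_to_fun (u n) x) =
    (fun A : {fset I} => \sum_(i <- A) dotp (z x i : R[i]^o) (y i) : R[i]^o) \o fset_upto)//.
  apply/funext => n /=; rewrite ux; apply: eq_bigr => i _.
  by rewrite -(zP x zx) mulrC.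
have -> : c = l by exact: cvg_unique_norm uc ul.
apply: filterS lE => x -> z' z'E; have zx := zP x (ex_intro _ z' z'E).
suff -> : z' = z x by [].
by apply: hsum_ext => i; rewrite z'E zx.
Qed.

(** Both sides say that the contractions of psi with v_k, for k in J, vanish: on the left through
    their values, on the right through their pairings with all g. *)
Lemma pointwise_inP (v : I -> ell2 R I) (J : set I) (Y : set (ell2 R I)) psi :
  (forall y, Y y <-> forall k, J k -> dotp y (v k) = 0) ->
  pointwise_in mu Y psi <-> perp v J (L2 mu) psi.
Proof.
move=> YE; have [c cP] := tensor_contraction psi (@L2_complete _ _ _ mu).
have cE k := pointwise_contraction (cP (v k)).2.
split=> [psiY k g Jk|psiJ].
  rewrite (cP _).1 (_ : c (v k) = 0) ?dotp0l//.
  apply: L2_ext; apply: filterS3 psiY (cE k) (L2_0E mu) => x [y /YE yJ yE] cx ->.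
  by rewrite -(cx _ yE) yJ.
have c0 k : J k -> c (v k) = 0.
  by move=> Jk; apply: dotp_eq0 => g; rewrite -(cP _).1 psiJ.
(* Quantifying over the codes n of indices makes a single null set serve all k. *)
have cn : {ae mu, forall x, forall n, forall k, choice.unpickle n = Some k -> J k ->
    forall z : ell2 R I, (forall i, z i = L2_to_fun (psi i) x) -> dotp z (v k) = 0}.
  apply: ae_foralln => n; case: (choice.unpickle n) => [k|]; last by apply: nearW => x k.
  have [Jk|nJk] := pselect (J k); last by apply: nearW => x _ [<-] /nJk.
  apply: filterS2 (cE k) (L2_0E mu) => x; rewrite c0// => cx c0x _ [<-] _ z zE.
  by rewrite (cx z zE).
apply: filterS2 (pointwise_ell2 psi) cn => x [z zE] zJ; exists z => //.
by apply/YE => k Jk; apply: (zJ (choice.pickle k)) => //; rewrite choice.pickleK.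
Qed.

End Pointwise.

Section OrthogonalSpan.
Context {R : realType} {I : choiceType}.

(** Subtract from y its projection on Y: the remainder lies in the orthogonal complement and is
    orthogonal to a basis of it, hence to itself. *)
Lemma basis_memP (v : I -> ell2 R I) (J J' : set I) (Y : set (ell2 R I)) :
  submod_closed (mem Y) -> closed Y ->
  hilbert_basis J v Y -> hilbert_basis J' v (orthocomplement Y) ->
  forall y, Y y <-> forall k, J' k -> dotp y (v k) = 0.
Proof.
move=> [Y0 Yl] Yc [_ YJ] [_ YJ'].
have vJ' k : J' k -> orthocomplement Y (v k).
  move=> J'k; rewrite -YJ'; apply: subset_closure.
  exists [fset k]%fset, (fun=> 1); rewrite big_mkcond big_seq_fset1.
  by rewrite mem_set// scale1r.
move=> y; split=> [Yy k J'k|yJ'].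
  by apply: dotp_eq0C; exact: vJ'.
have [|||p Yp pP] := projection (K := Y) y (hsum_complete (@complex_seq_complete R)).
- exact/set_mem.
- by move=> c x z Yx Yz; apply/set_mem/Yl; exact/mem_set.
- by move=> u l uY; apply: (closed_cvg Y Yc); exact: nearW.
suff q0 : y - p = 0.
  by move/eqP : q0; rewrite subr_eq0 => /eqP ->.
have qY : orthocomplement Y (y - p) by move=> k Yk; exact: pP.
have qv k : J' k -> dotp (y - p) (v k) = 0.
  by move=> J'k; rewrite dotpBl yJ'// dotp_eq0C ?subrr//; exact: vJ'.
apply: rnorm_eq0; apply/eqP; rewrite -sqrf_eq0 -rdotxx /rdot.
rewrite (_ : dotp (y - p) (y - p) = 0)//.
move: qY; rewrite -YJ'; set q := y - p in qv *.
apply: (@closure_span_ind _ _ v J' (fun z => dotp q z = 0)) => //.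
- exact: dotp0r.
- by move=> c z w z0 w0; rewrite dotpDr dotpZr z0 w0 mulr0 addr0.
- by move=> z; exact: dotp_eq0_approx.
Qed.

End OrthogonalSpan.

(** * Forms *)

Section BoundedForm.
Context {R : realType} {V : preHilbertType R} (a : sesquilinear_form R V).
Hypothesis a_cont : form_continuous a.

Lemma sesqDl x y z : a (x + y) z = a x z + a y z.
Proof. exact: linearDl. Qed.
Lemma sesqDr x y z : a x (y + z) = a x y + a x z.
Proof. exact: linearD. Qed.
Lemma sesqBl x y z : a (x - y) z = a x z - a y z.
Proof. exact: linearBl. Qed.
Lemma sesqBr x y z : a x (y - z) = a x y - a x z.
Proof. exact: linearB. Qed.
Lemma sesqZl c x z : a (c *: x) z = c * a x z.
Proof. exact: linearZl_LR. Qed.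
Lemma sesqZr c x z : a x (c *: z) = c^* * a x z.
Proof. exact: linearZr_LR. Qed.
Lemma sesq0l z : a 0 z = 0.
Proof. exact: linear0l. Qed.
Lemma sesq0r z : a z 0 = 0.
Proof. exact: linear0r. Qed.

Lemma sesq_suml (I : Type) (s : seq I) (P : pred I) (f : I -> V) z :
  a (\sum_(i <- s | P i) f i) z = \sum_(i <- s | P i) a (f i) z.
Proof.
by elim/big_rec2: _ => [|i y x _ <-]; rewrite ?sesq0l ?sesqDl.
Qed.

Lemma sesq_sumr (I : Type) (s : seq I) (P : pred I) (f : I -> V) z :
  a z (\sum_(i <- s | P i) f i) = \sum_(i <- s | P i) a z (f i).
Proof.
by elim/big_rec2: _ => [|i y x _ <-]; rewrite ?sesq0r ?sesqDr.
Qed.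

Lemma form_bound : exists2 M : R, 0 <= M &
  forall x y, cabs (a x y) <= M * rnorm x * rnorm y.
Proof.
have [M aM] := a_cont; exists `|M| => // x y.
rewrite -lecR cabsE (le_trans (aM x y))// -!rnormE -!rmorphM/= lecR.
by rewrite !ler_wpM2r ?rnorm_ge0// ler_norm.
Qed.

Lemma form_cvgl (T : Type) (F : set_system T) {FF : Filter F} (u : T -> V) l z :
  u @ F --> l -> (fun t => a (u t) z : R[i]^o) @ F --> (a l z : R[i]^o).
Proof.
move=> ul; have [M M0 aM] := form_bound.
have c : continuous (fun x => a x z : R[i]^o).
  apply: (@rnorm_continuous_linear _ _ _ _ (M * rnorm z)) => [x y|x].
    exact: sesqBl.
  by rewrite mulrAC; exact: aM.
exact: (cvg_comp _ _ ul (c l)).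
Qed.

Lemma form_cvgr (T : Type) (F : set_system T) {FF : Filter F} (u : T -> V) l z :
  u @ F --> l -> (fun t => a z (u t) : R[i]^o) @ F --> (a z l : R[i]^o).
Proof.
move=> ul; have [M M0 aM] := form_bound.
have c : continuous (fun x => a z x : R[i]^o).
  apply: (@rnorm_continuous_linear _ _ _ _ (M * rnorm z)) => [x y|x].
    exact: sesqBr.
  exact: aM.
exact: (cvg_comp _ _ ul (c l)).
Qed.

End BoundedForm.

Section UsumForm.
Context {R : realType} {I : choiceType} {E : preHilbertType R}.
Variables (a : sesquilinear_form R (hsum I E)) (v : I -> ell2 R I).
Hypothesis a_cont : form_continuous a.

Lemma hsum_single_continuous i : continuous (@hsum_single R I E i).
Proof.
apply: (@rnorm_continuous_linear _ _ _ _ 1) => [x y|x].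
  by rewrite [x - y]addrC -[- y]scaleN1r hsum_single_linear scaleN1r addrC.
by rewrite mul1r rnorm_single.
Qed.

Lemma expansion_coord_cvg (J : set I) (psi : I -> E) (w : hsum I E) i :
  partial_expansion v J psi @ totally --> w ->
  (fun A : {fset I} => hsum_single i (\sum_(l <- A | l \in J) (v l i : R[i]) *: psi l)
    : hsum I E) @ totally --> (hsum_single i (w i) : hsum I E).
Proof.
move=> /(hsum_coord_cvg (i := i)) wi.
have := cvg_comp _ _ wi (@hsum_single_continuous i (w i)).
rewrite (_ : _ \o _ = (fun A : {fset I} => hsum_single i
  (\sum_(l <- A | l \in J) (v l i : R[i]) *: psi l)))//.
by apply/funext => A /=; rewrite /partial_expansion hsum_sumE.
Qed.

Lemma hsum_single_sum i (s : seq I) (P : pred I) (f : I -> E) :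
  hsum_single i (\sum_(k <- s | P k) f k) = \sum_(k <- s | P k) hsum_single i (f k) :> hsum I E.
Proof.
have s0 : hsum_single i 0 = 0 :> hsum I E.
  by apply: hsum_ext => j; rewrite hsum_singleE; case: ifP.
elim/big_rec2: _ => [//|k y x _ <-].
by rewrite -[f k]scale1r hsum_single_linear !scale1r.
Qed.

Lemma hsum_singleZ i c (g : E) : hsum_single i (c *: g) = c *: hsum_single i g :> hsum I E.
Proof.
apply: hsum_ext => j; rewrite hsumZE !hsum_singleE.
by case: ifP => // _; rewrite scaler0.
Qed.

(** The sums are evaluated from the inside out. Each is the image of a norm convergent expansion
    under [a] with its other argument fixed, so every [usum] is a genuine limit and no joint
    summability of the four indices enters. *)
Lemma usum_form (J J' : set I) (psi psi' : I -> E) (w w' : hsum I E) :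
  partial_expansion v J psi @ totally --> w ->
  partial_expansion v J' psi' @ totally --> w' ->
  usum setT (fun i => usum setT (fun j => usum J (fun l => usum J' (fun k =>
    v l j * (v k i)^* * form_entry a i j (psi l) (psi' k))))) = a w w'.
Proof.
move=> ww ww'.
have e1 i j l : usum J' (fun k => v l j * (v k i)^* * form_entry a i j (psi l) (psi' k)) =
    v l j * a (hsum_single j (psi l)) (hsum_single i (w' i)).
  apply: usumP; rewrite -sesqZl; set z := _ *: _.
  rewrite (_ : psum _ _ = fun A : {fset I} => a z (hsum_single i
    (\sum_(k <- A | k \in J') (v k i : R[i]) *: psi' k)) : R[i]^o).
    exact: (form_cvgr a_cont (expansion_coord_cvg (i := i) ww')).
  apply/funext => A; rewrite /psum hsum_single_sum sesq_sumr; apply: eq_bigr => k _.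
  by rewrite hsum_singleZ sesqZr sesqZl mulrCA mulrA.
have e2 i j : usum J (fun l => v l j * a (hsum_single j (psi l)) (hsum_single i (w' i))) =
    a (hsum_single j (w j)) (hsum_single i (w' i)).
  apply: usumP; set z := hsum_single i (w' i).
  rewrite (_ : psum _ _ = fun A : {fset I} => a (hsum_single j
    (\sum_(l <- A | l \in J) (v l j : R[i]) *: psi l)) z : R[i]^o).
    exact: (form_cvgl a_cont (expansion_coord_cvg (i := j) ww)).
  apply/funext => A; rewrite /psum hsum_single_sum sesq_suml; apply: eq_bigr => k _.
  by rewrite hsum_singleZ sesqZl.
have e3 i : usum setT (fun j => a (hsum_single j (w j)) (hsum_single i (w' i))) =
    a w (hsum_single i (w' i)).
  apply: usumP; set z := hsum_single i (w' i).
  rewrite (_ : psum _ _ = fun A : {fset I} =>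
    a (\sum_(j <- A) hsum_single j (w j)) z : R[i]^o).
    exact: (form_cvgl a_cont (@hsum_single_cvg _ _ _ w)).
  by apply/funext => A; rewrite /psum sesq_suml (eq_bigl _ _ (fun i => in_setT i)).
apply: usumP.
rewrite (_ : psum _ _ = fun A : {fset I} =>
  a w (\sum_(i <- A) hsum_single i (w' i)) : R[i]^o).
  exact: (form_cvgr a_cont (@hsum_single_cvg _ _ _ w')).
apply/funext => A; rewrite /psum sesq_sumr (eq_bigl _ _ (fun i => in_setT i)).
apply: eq_bigr => i _; rewrite -e3; congr (usum _ _); apply/funext => j.
by rewrite -e2; congr (usum _ _); apply/funext => l; rewrite e1.
Qed.

End UsumForm.

(** * Semigroups *)

Section RightDerivatives.
Context {R : realType}.

Lemma near_at_right0 (P : R -> Prop) :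
  (\forall h \near (0 : R)^'+, P h) <->
  exists2 d : R, 0 < d & forall h, 0 < h -> h < d -> P h.
Proof.
split=> [[d /= d0 dP]|[d d0 dP]].
  exists d => // h h0 hd; apply: dP => //=.
  by rewrite sub0r normrN gtr0_norm.
exists d => //= h; rewrite /= sub0r normrN => hd h0; apply: dP => //.
by rewrite -(gtr0_norm h0).
Qed.

Lemma near_at_left (t : R) (P : R -> Prop) :
  (\forall s \near t^'-, P s) <->
  exists2 d : R, 0 < d & forall s, t - d < s -> s < t -> P s.
Proof.
split=> [[d /= d0 dP]|[d d0 dP]].
  exists d => // s ds st; apply: dP => //=.
  by rewrite gtr0_norm ?subr_gt0//; lra.
exists d => //= s /= sd st; apply: dP => //.
by move: sd; rewrite gtr0_norm ?subr_gt0//; lra.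
Qed.

(** All from 1 + z <= e^z: taking z = -y gives e^y <= 1 / (1 - y), which is at most 1 + y + 2 y^2
    for y <= 1/2. *)
Lemma expR_quadratic (y : R) : `|y| <= 2^-1 -> `|expR y - 1 - y| <= 2 * y ^+ 2.
Proof.
rewrite ler_norml => /andP[y1 y2].
have h1 : 1 + y <= expR y by exact: expR_ge1Dx.
have h2 : 1 - y <= expR (- y) by exact: expR_ge1Dx.
have h3 : expR y * expR (- y) = 1 by rewrite -expRD subrr expR0.
have h4 : 0 < expR y by exact: expR_gt0.
have h5 : expR y * (1 - y) <= 1 by rewrite -[leRHS]h3 ler_wpM2l // ltW.
have h6 : expR y <= 1 + y + 2 * y ^+ 2.
  have y3 : 0 < 1 - y by lra.
  rewrite -(ler_pM2r y3) (le_trans h5)//.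
  have : 0 <= y ^+ 2 * (1 - 2 * y) by rewrite mulr_ge0 ?sqr_ge0//; lra.
  by move=> *; lra.
have y20 := sqr_ge0 y.
by rewrite ler_norml; apply/andP; split; lra.
Qed.

Lemma expR_right_derivative (c t : R) :
  h^-1 * (expR (- (c * (t + h))) - expR (- (c * t))) @[h --> 0^'+] -->
  - c * expR (- (c * t)).
Proof.
set E := expR (- (c * t)); have E0 : 0 < E by exact: expR_gt0.
have C0 : 0 < 2 * c ^+ 2 * E + 1.
  by rewrite ltr_wpDl// mulr_ge0 ?(ltW E0)// mulr_ge0 ?sqr_ge0.
apply/cvgrPdist_lt => e e0; apply/near_at_right0.
have d1 : 0 < e / (2 * c ^+ 2 * E + 1) by rewrite divr_gt0.
have c1 : 0 < 2 * `|c| + 1 by rewrite ltr_wpDl// mulr_ge0.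
have d2 : 0 < (2 * `|c| + 1)^-1 by rewrite invr_gt0.
(* The first bound keeps the error 2 c^2 E h below e, the second keeps |c h| within 1/2; the added 1
   avoids a zero denominator when c = 0. *)
exists (Num.min (e / (2 * c ^+ 2 * E + 1)) (2 * `|c| + 1)^-1); first by rewrite lt_min d1 d2.
move=> h h0; rewrite lt_min => /andP[he hc].
have ch : `|- (c * h)| <= 2^-1.
  rewrite normrN normrM (gtr0_norm h0).
  have : h * (2 * `|c| + 1) <= 1 by rewrite -ler_pdivlMr// mul1r ltW.
  have := mulr_ge0 (normr_ge0 c) (ltW h0).
  by move: (`|c|) h0 => *; lra.
rewrite (_ : - (c * (t + h)) = - (c * t) + - (c * h)); last by ring.
rewrite expRD -/E.
rewrite (_ : _ - _ = - (h^-1 * E) * (expR (- (c * h)) - 1 - (- (c * h)))); last first.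
  by field; rewrite gt_eqF.
rewrite normrM normrN (gtr0_norm (mulr_gt0 _ E0)) ?invr_gt0//.
rewrite (le_lt_trans (ler_wpM2l _ (expR_quadratic ch))) ?mulr_ge0 ?invr_ge0 ?(ltW h0) ?(ltW E0)//.
have -> : h^-1 * E * (2 * (- (c * h)) ^+ 2) = 2 * c ^+ 2 * E * h.
  by field; rewrite gt_eqF.
move: he; rewrite ltr_pdivlMr//; move: (2 * c ^+ 2 * E) => k; rewrite mulrDr mulr1.
by rewrite mulrC => q; rewrite (lt_trans _ q)// ltrDl.
Qed.

(** The function e^(-c s) f(s) has right derivative e^(-c s) (f' - c f) <= 0 and is continuous from
    the left, so [right_dini_nonincreasing] applies to it. *)
Lemma right_gronwall (f f' : R -> R) (c : R) :
  (forall t, 0 <= t -> h^-1 * (f (t + h) - f t) @[h --> 0^'+] --> f' t) ->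
  (forall t, 0 < t -> f s @[s --> t^'-] --> f t) ->
  (forall t, 0 <= t -> f' t <= c * f t) ->
  forall t, 0 <= t -> f t <= expR (c * t) * f 0.
Proof.
move=> fr fl fc.
pose g s := expR (- (c * s)) * f s.
have expc (s : R) : expR (- (c * u)) @[u --> s] --> expR (- (c * s)).
  apply: continuous_cvg; first exact: continuous_expR.
  by apply: cvgN; apply: cvgMr; exact: cvg_id.
have g0 t : 0 <= t -> g t <= g 0.
  apply: right_dini_nonincreasing => {}t e t0 e0.
    apply/near_at_right0.
    have c1 : h^-1 * (g (t + h) - g t) @[h --> 0^'+] -->
        expR (- (c * t)) * f' t + f t * (- c * expR (- (c * t))).
      have -> : (fun h => h^-1 * (g (t + h) - g t)) = (fun h =>
          expR (- (c * (t + h))) * (h^-1 * (f (t + h) - f t)) +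
          f t * (h^-1 * (expR (- (c * (t + h))) - expR (- (c * t))))).
        by apply/funext => h; rewrite /g; ring.
      apply: cvgD; last by apply: cvgMr; exact: expR_right_derivative.
      apply: cvgM; last exact: fr.
      apply: cvg_at_right_filter.
      have th : t + h @[h --> 0] --> t.
        by rewrite -[X in _ --> X]addr0; apply: cvgD; [exact: cvg_cst|exact: cvg_id].
      exact: (cvg_comp _ _ th (expc t)).
    have neg : expR (- (c * t)) * f' t + f t * (- c * expR (- (c * t))) < e.
      rewrite (le_lt_trans _ e0)//.
      rewrite (_ : _ + _ = expR (- (c * t)) * (f' t - c * f t)); last by ring.
      by rewrite pmulr_rle0 ?expR_gt0// subr_le0 fc.
    have lt_e : \forall h \near 0^'+, h^-1 * (g (t + h) - g t) < e.
      move: c1; set l := (X in _ --> X) => c1.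
      have : \forall y \near l, y < e by exact: lt_nbhsl.
      exact: c1.
    have h0 : \forall h \near (0 : R)^'+, 0 < h.
      by apply/near_at_right0; exists 1.
    apply: filterS2 h0 lt_e => h h0.
    rewrite mulrC ltr_pdivrMr// => ge; move: (ltW ge).
    by rewrite lerBlDl mulrC.
  have gl : g s @[s --> t^'-] --> g t.
    by apply: cvgM; [exact: cvg_at_left_filter (expc t)|exact: fl].
  move/cvgrPdist_lt/(_ e e0)/near_at_left : gl => [d d0 dP].
  exists d => // s s0 ds st; have := dP s ds st; rewrite ltr_norml => /andP[_].
  by rewrite ltrBlDr addrC => /ltW.
move=> t t0; have := g0 t t0; rewrite /g mulr0 oppr0 expR0 mul1r.
by rewrite expRN ler_pdivrMl ?expR_gt0.
Qed.

End RightDerivatives.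

Section Semigroup.
Context {R : realType} {H : preHilbertType R}.
Variable T : R -> H -> H.
Hypothesis Tsg : C0_semigroup T.
Hypothesis Hc : seq_complete H.

(** Otherwise some times t_n < 1/(n+1) have T(t_n) of norm above n, while strong continuity at 0
    bounds T(t_n) x for each x, against uniform boundedness. *)
Lemma semigroup_local_bound : exists2 d : R, 0 < d &
  exists M : R, forall t x, 0 <= t -> t < d -> rnorm (T t x) <= M * rnorm x.
Proof.
apply: contrapT => h.
have bad n : exists t, 0 <= t < n.+1%:R^-1 /\ exists x, n%:R * rnorm x < rnorm (T t x).
  apply: contrapT => /forallNP g; apply: h; exists n.+1%:R^-1; first by rewrite invr_gt0.
  exists n%:R => t x t0 tn; rewrite leNgt; apply/negP => tx; apply: (g t).
  by rewrite t0 tn; split => //; exists x.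
have [t tP] := choice bad.
have t0 n : 0 <= t n by have [/andP[]] := tP n.
have [|||M MP] := banach_steinhaus (T := fun n => T (t n)) Hc.
- by move=> n; exact: semigroup_linear.
- by move=> n; exact: semigroup_bounded.
- move=> x; have := semigroup_cvg Tsg (x := x) => /cvg_rnormP/(_ _ ltr01)/near_at_right0[d d0 dP].
  have /cvgrPdist_lt/(_ _ d0)[N _ NP] := @cvg_harmonic R.
  (* The sum takes care of the finitely many n for which t_n may be too large. *)
  exists (rnorm x + 1 + \sum_(n < N) rnorm (T (t n) x)) => n.
  have [nN|Nn] := ltnP n N.
    rewrite (bigD1 (Ordinal nN))//= addrCA lerDl addr_ge0 ?addr_ge0 ?rnorm_ge0//.
    by apply: sumr_ge0 => k _; exact: rnorm_ge0.
  rewrite (@le_trans _ _ (rnorm x + 1))//; last first.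
    by rewrite lerDl sumr_ge0// => k _; exact: rnorm_ge0.
  have [/andP[_ tn] _] := tP n.
  have := t0 n; rewrite le_eqVlt => /predU1P[<-|tn0].
    by rewrite (semigroup0 Tsg) lerDl.
  have td : t n < d.
    rewrite (lt_trans tn)//; have := NP n Nn.
    by rewrite /harmonic/= sub0r normrN ger0_norm.
  have /= := dP _ tn0 td; rewrite rnorm_distC => xt.
  rewrite -[T (t n) x](subrK x) (le_trans (rnormD _ _))// addrC lerD2l.
  exact: ltW.
have [n Mn] : exists n : nat, M < n%:R by exists (Num.truncn M).+1; exact: truncnS_gt.
have [_ [x]] := tP n; apply/negP; rewrite -leNgt (le_trans (MP n x))//.
by rewrite ler_wpM2r ?rnorm_ge0// ltW.
Qed.

Lemma semigroup_bound (b : R) : exists2 M : R, 0 < M &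
  forall t x, 0 <= t -> t <= b -> rnorm (T t x) <= M * rnorm x.
Proof.
have [d d0 [M0 M0P]] := semigroup_local_bound.
(* With M >= 1, a time that needs fewer than k steps of length d / 2 still obeys the bound M^k. *)
pose M := Num.max 1 M0.
have M1 : 1 <= M by rewrite le_max lexx.
have MP t x : 0 <= t -> t < d -> rnorm (T t x) <= M * rnorm x.
  move=> t0 td; rewrite (le_trans (M0P _ _ t0 td))// ler_wpM2r ?rnorm_ge0//.
  by rewrite le_max lexx orbT.
have d2 : 0 < d / 2 by rewrite divr_gt0.
have key k t x : 0 <= t -> t <= k%:R * (d / 2) -> rnorm (T t x) <= M ^+ k * rnorm x.
  elim: k t x => [|k ih] t x t0.
    rewrite mul0r expr0 mul1r => t1; rewrite (_ : t = 0) ?(semigroup0 Tsg)//.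
    by apply/eqP; rewrite eq_le t0 t1.
  move=> tk; have [td|dt] := ltP t d.
    rewrite (le_trans (MP _ _ t0 td))// ler_wpM2r ?rnorm_ge0// exprS.
    by rewrite ler_peMr ?exprn_ege1// (le_trans ler01).
  have t1 : 0 <= t - d / 2 by lra.
  rewrite -[t](subrK (d / 2)) addrC (semigroupD Tsg) ?(ltW d2)// exprS -mulrA.
  rewrite (le_trans (MP _ _ (ltW d2) _))//; first by lra.
  rewrite ler_wpM2l ?(le_trans ler01)//; apply: ih => //.
  by move: tk; rewrite -natr1 mulrDl mul1r; lra.
have [k bk] : exists k : nat, b / (d / 2) < k%:R.
  by exists (Num.truncn (b / (d / 2))).+1; exact: truncnS_gt.
exists (M ^+ k) => [|t x t0 tb]; first by rewrite exprn_gt0// (lt_le_trans ltr01).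
apply: key => //; rewrite (le_trans tb)// -ler_pdivrMr//.
exact: ltW.
Qed.

(** T(t) x - T(s) x = T(s) (T(t - s) x - x), and T(s) is bounded uniformly for s in [0, t]. *)
Lemma semigroup_left_cvg x t : 0 < t -> T s x @[s --> t^'-] --> T t x.
Proof.
move=> t0; have [M M0 MP] := semigroup_bound t.
apply/cvg_rnormP => e e0.
have /cvg_rnormP/(_ _ (divr_gt0 e0 M0))/near_at_right0[d d0 dP] := semigroup_cvg Tsg (x := x).
apply/near_at_left; exists (Num.min d t) => [|s]; first by rewrite lt_min d0.
rewrite ltrBlDr -ltrBlDl lt_min => /andP[sd st] s_t.
have s0 : 0 <= s by lra.
have ts : 0 < t - s by rewrite subr_gt0.
have tE : T t x = T s (T (t - s) x).
  by rewrite -(semigroupD Tsg) ?(ltW ts)// addrC subrK.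
have := semigroup_linear Tsg s0 => Tl.
have TB y z : T s (y - z) = T s y - T s z.
  by rewrite [y - z]addrC -[- z]scaleN1r Tl scaleN1r addrC.
rewrite tE -TB (le_lt_trans (MP _ _ s0 (ltW s_t)))//.
by rewrite mulrC -ltr_pdivlMr// rnorm_distC; exact: dP.
Qed.

Lemma generator_shift x y t : 0 <= t -> generator T (x, y) -> generator T (T t x, T t y).
Proof.
move=> t0; rewrite /generator/= => xy.
have := semigroup_linear Tsg t0 => Tl.
have TB u w : T t (u - w) = T t u - T t w.
  by rewrite [u - w]addrC -[- w]scaleN1r Tl scaleN1r addrC.
have TZ c u : T t (c *: u) = c *: T t u.
  have T0 : T t 0 = 0 by have := Tl (- 1) 0 0; rewrite scaler0 addr0 scaleN1r addNr.
  by have := Tl c u 0; rewrite T0 !addr0.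
have := cvg_comp _ _ xy (semigroup_bounded Tsg t0 (x := y)).
apply: cvg_trans; apply: near_eq_cvg.
apply/near_at_right0; exists 1 => // h h0 _ /=.
rewrite TZ TB -!(semigroupD Tsg) ?(ltW h0)//.
by rewrite [t + h]addrC.
Qed.

Lemma generator_right_derivative x y t : 0 <= t -> generator T (x, y) ->
  (h^-1)%:C%C *: (T (t + h) x - T t x) @[h --> 0^'+] --> T t y.
Proof.
move=> t0 xy; have := generator_shift t0 xy; rewrite /generator/=.
apply: cvg_trans; apply: near_eq_cvg.
apply/near_at_right0; exists 1 => // h h0 _ /=.
by rewrite [t + h]addrC (semigroupD Tsg) ?(ltW h0).
Qed.

End Semigroup.

Section RightDerivativeNorm.
Context {R : realType} {H : preHilbertType R}.

Lemma rdot_cvgr (S : Type) (F : set_system S) {FF : Filter F} (w : S -> H) z l :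
  w @ F --> l -> rdot z (w s) @[s --> F] --> rdot z l.
Proof.
move=> wl; apply/cvgrPdist_lt => e e0.
have s0 : 0 < rnorm z + 1 by rewrite ltr_wpDl// rnorm_ge0.
have /cvg_rnormP/(_ _ (divr_gt0 e0 s0)) := wl; apply: filterS => s ws.
rewrite -rdotNr -rdotDr (le_lt_trans (ler_rdot _ _))//.
rewrite (@le_lt_trans _ _ ((rnorm z + 1) * rnorm (l - w s)))//.
  by rewrite ler_wpM2r ?rnorm_ge0// lerDl.
by rewrite mulrC -ltr_pdivlMr.
Qed.

Lemma right_derivative_rdot (u : R -> H) (t : R) (w z : H) :
  (h^-1)%:C%C *: (u (t + h) - u t) @[h --> 0^'+] --> w ->
  h^-1 * (rdot z (u (t + h)) - rdot z (u t)) @[h --> 0^'+] --> rdot z w.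
Proof.
move=> /(rdot_cvgr (z := z)); apply: cvg_trans; apply: near_eq_cvg.
by apply: nearW => h; rewrite rdotZr rdotDr rdotNr.
Qed.

(** With w_h the difference quotient of u, that of |u|^2 equals 2 Re(u | w_h) + h |w_h|^2. *)
Lemma right_derivative_sqr_norm (u : R -> H) (t : R) (w : H) :
  (h^-1)%:C%C *: (u (t + h) - u t) @[h --> 0^'+] --> w ->
  h^-1 * (rnorm (u (t + h)) ^+ 2 - rnorm (u t) ^+ 2) @[h --> 0^'+] --> 2 * rdot (u t) w.
Proof.
move=> uw; rewrite -[X in _ --> X]addr0.
have -> : 2 * rdot (u t) w + 0 = 2 * rdot (u t) w + 0 * (rnorm w * rnorm w).
  by rewrite mul0r.
have h0 : (h : R) @[h --> 0^'+] --> (0 : R).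
  by apply: cvg_at_right_filter; exact: cvg_id.
set w_ := fun h : R => (h^-1)%:C%C *: (u (t + h) - u t) in uw.
have c1 : 2 * rdot (u t) (w_ h) + h * (rnorm (w_ h) * rnorm (w_ h)) @[h --> 0^'+] -->
    2 * rdot (u t) w + 0 * (rnorm w * rnorm w).
  apply: cvgD; first by apply: cvgMr; exact: rdot_cvgr uw.
  by apply: cvgM => //; apply: cvgM; exact: cvg_rnorm uw.
apply: cvg_trans c1; apply: near_eq_cvg.
apply/near_at_right0; exists 1 => // h hp _ /=; rewrite /w_.
have hn : h != 0 by rewrite gt_eqF.
have uE : u (t + h) = u t + (u (t + h) - u t) by rewrite [u t + _]addrC subrK.
have sq := rnorm_sqrD (u t) (u (t + h) - u t); rewrite -uE in sq.
rewrite sq rdotZr rnormZr gtr0_norm ?invr_gt0//.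
by move: (rnorm _) (rdot _ _) (rnorm _) => p q r; field.
Qed.

End RightDerivativeNorm.

(** * Invariant subspaces *)

Section Invariance.
Context {R : realType} {V H : preHilbertType R}.
Hypotheses (Vc : seq_complete V) (Hc : seq_complete H).
Variable emb : V -> H.
Hypotheses (emb_linear : linear emb) (emb_cont : continuous emb) (emb_inj : injective emb).
Hypothesis emb_dense : forall x (e : R), 0 < e -> exists w, rnorm (x - emb w) < e.
Variable a : sesquilinear_form R V.
Hypotheses (a_cont : form_continuous a) (a_elliptic : form_elliptic emb a).

Lemma embB u w : emb (u - w) = emb u - emb w.
Proof. by rewrite [u - w]addrC -[- w]scaleN1r emb_linear scaleN1r addrC. Qed.

Lemma embD u w : emb (u + w) = emb u + emb w.
Proof. by rewrite -[u]scale1r emb_linear !scale1r. Qed.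

Lemma form_coercive : exists2 alpha : R, 0 < alpha & exists omega : R, forall u,
  alpha * rnorm u ^+ 2 <= complex.Re (a u u) + omega * rnorm (emb u) ^+ 2.
Proof.
have [alpha a0 [omega h]] := a_elliptic; exists alpha => //; exists omega => u.
have := h u; rewrite -complexRe -!rnormE -!(rmorphXn (real_complex R))/=.
by rewrite -!(rmorphM (real_complex R))/= -(rmorphD (real_complex R))/= lecR.
Qed.

Section Coercive.
Variables (alpha omega : R).
Hypothesis alpha0 : 0 < alpha.
Hypothesis coercive : forall u,
  alpha * rnorm u ^+ 2 <= complex.Re (a u u) + omega * rnorm (emb u) ^+ 2.

(** For lam >= omega, ellipticity makes a + lam ( | ) coercive on V; Riesz rewrites the right-hand
    side as an inner product of V, as Lax-Milgram requires. *)
Lemma resolvent_exists (lam : R) z : omega <= lam ->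
  exists u, forall v, a u v + lam%:C%C * dotp (emb u) (emb v) = dotp z (emb v).
Proof.
move=> ol; have [N N0 eN] := continuous_linear_rnorm emb_linear emb_cont.
have [M M0 aM] := form_bound a_cont.
have [||z' z'P] := riesz (phi := fun v => dotp (emb v) z) (M := N * rnorm z) Vc.
- by move=> c x y; rewrite emb_linear dotpDl dotpZl.
- by move=> x; rewrite (le_trans (cabs_dotp _ _))// mulrAC ler_wpM2r ?rnorm_ge0.
pose b u v := a u v + lam%:C%C * dotp (emb u) (emb v).
have [|||||u uP] := @lax_milgram R V b (M + `|lam| * N * N) alpha Vc _ _ _ _ _ z'.
- by move=> v c x y; rewrite /b/= sesqDl sesqZl emb_linear dotpDl dotpZl; ring.
- by move=> u c x y; rewrite /b/= sesqDr sesqZr emb_linear dotpDr dotpZr; ring.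
- move=> u v; rewrite (le_trans (@rnormD R R[i]^o _ _))// !mulrDl.
  apply: lerD; first exact: aM.
  rewrite -[X in X <= _]/(cabs (_ * _)) cabsM cabs_real.
  rewrite (le_trans (ler_wpM2l (normr_ge0 _) (cabs_dotp _ _)))//.
  have := ler_pM (rnorm_ge0 _) (rnorm_ge0 _) (eN u) (eN v).
  move=> /(ler_wpM2l (normr_ge0 lam))/le_trans; apply.
  by rewrite le_eqVlt; apply/orP; left; apply/eqP; ring.
- exact: alpha0.
- move=> u; rewrite (le_trans (coercive u))//.
  have -> : complex.Re (b u u) = complex.Re (a u u) + lam * rnorm (emb u) ^+ 2.
    by rewrite /b dotpxx; case: (a u u) => r s /=; rewrite mul0r subr0.
  by rewrite lerD2l ler_wpM2r// sqr_ge0.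
by exists u => v; rewrite -/(b u v) uP dotpC -z'P [RHS]dotpC.
Qed.

(** B does not depend on e or lam0: differences bounded in V and small in H are what [weak_small]
    takes as input. *)
Lemma resolvent_approx (w : V) : exists B : R, forall e lam0 : R, 0 < e ->
  exists lam u, [/\ lam0 < lam,
    forall v, a u v + lam%:C%C * dotp (emb u) (emb v) = lam%:C%C * dotp (emb w) (emb v),
    rnorm (u - w) <= B & rnorm (emb (u - w)) <= e].
Proof.
have [M M0 aM] := form_bound a_cont.
(* The constants come from the estimate [en] below: it bounds |r| by B in V, hence (lam - omega)
   |emb r|^2 by K = M |w| B, and lam is taken beyond omega + K / e^2. *)
pose B := M * rnorm w / alpha.
have B0 : 0 <= B by rewrite divr_ge0 ?mulr_ge0 ?rnorm_ge0// ltW.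
exists B => e lam0 e0.
pose K := M * rnorm w * B.
have K0 : 0 <= K by rewrite /K; apply: mulr_ge0 => //; rewrite mulr_ge0 ?rnorm_ge0.
pose lam := Num.max lam0 omega + K / e ^+ 2 + 1.
have Ke : 0 <= K / e ^+ 2 by rewrite divr_ge0// sqr_ge0.
have m1 : lam0 <= Num.max lam0 omega by rewrite le_max lexx.
have m2 : omega <= Num.max lam0 omega by rewrite le_max lexx orbT.
have [l1 l2] : lam0 < lam /\ omega + K / e ^+ 2 < lam.
  rewrite /lam; move: (Num.max lam0 omega) (K / e ^+ 2) m1 m2 Ke => p q m1 m2 q0.
  by split; lra.
have l3 : omega <= lam by lra.
have [u uP] := resolvent_exists (lam%:C%C *: emb w) l3.
exists lam, u; set r := u - w.
have uP' v : a u v + lam%:C%C * dotp (emb u) (emb v) = lam%:C%C * dotp (emb w) (emb v).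
  by rewrite uP dotpZl.
(* Test the equations for u with v = r. *)
have rr : a r r + lam%:C%C * dotp (emb r) (emb r) = - a w r.
  have -> : a r r = a u r - a w r by rewrite -sesqBl.
  have -> : dotp (emb r) (emb r) = dotp (emb u) (emb r) - dotp (emb w) (emb r).
    by rewrite -dotpBl -embB.
  by rewrite mulrBr addrACA uP' addrCA subrr addr0.
have en : alpha * rnorm r ^+ 2 + (lam - omega) * rnorm (emb r) ^+ 2 <= M * rnorm w * rnorm r.
  have := congr1 (@complex.Re R) rr.
  have -> : complex.Re (a r r + lam%:C%C * dotp (emb r) (emb r)) =
      complex.Re (a r r) + lam * rnorm (emb r) ^+ 2.
    by rewrite dotpxx; case: (a r r) => p q /=; rewrite mul0r subr0.
  have h1 : complex.Re (- a w r) <= M * rnorm w * rnorm r.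
    rewrite (le_trans _ (aM w r))// (le_trans (ler_norm _))//.
    by rewrite (le_trans (Re_le_cabs _))// /cabs normrN.
  have h2 := coercive r.
  by move: h1 h2; move: (M * rnorm w * rnorm r) (rnorm (emb r) ^+ 2)
     (alpha * rnorm r ^+ 2) (complex.Re _) (complex.Re _) => *; lra.
have rB : rnorm r <= B.
  have [r0|/eqP r0] := eqVneq (rnorm r) 0; first by rewrite r0.
  have {}r0 : 0 < rnorm r by rewrite lt_neqAle rnorm_ge0 andbT eq_sym; exact/eqP.
  rewrite /B ler_pdivlMr// -(ler_pM2r r0) mulrAC -expr2 mulrC.
  rewrite (le_trans _ en)// lerDl mulr_ge0 ?sqr_ge0//.
  by rewrite subr_ge0.
split => //.
rewrite -ler_sqr ?nnegrE ?rnorm_ge0 ?(ltW e0)//.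
have lo : 0 < lam - omega.
  by rewrite subr_gt0; lra.
rewrite -(ler_pM2l lo) (@le_trans _ _ K)//.
  rewrite (le_trans (_ : _ <= M * rnorm w * rnorm r))//.
    by rewrite (le_trans _ en)// lerDr mulr_ge0 ?sqr_ge0// ltW.
  by rewrite ler_wpM2l// mulr_ge0 ?rnorm_ge0.
rewrite -ler_pdivrMr ?exprn_gt0//.
by lra.
Qed.

(** Here f is the image of psi under -A, which explains the signs below. *)
Definition associated psi f := forall v, a psi v = dotp f (emb v).

Lemma domain_dense x (e : R) : 0 < e ->
  exists psi f, associated psi f /\ rnorm (x - emb psi) < e.
Proof.
have e2 : 0 < e -> 0 < e / 2 by move=> e0; rewrite divr_gt0.
move=> e0; have [w xw] := emb_dense x (e2 e0).
have [B BP] := resolvent_approx w.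
have e3 : 0 < e / 3 by rewrite divr_gt0.
have [lam [u [_ uP _ uw]]] := BP _ 0 e3.
(* The resolvent equation itself puts u in the domain, with f = lam (w - u). *)
exists u, (lam%:C%C *: (emb w - emb u)); split.
  by move=> v; rewrite dotpZl dotpBl mulrBr -uP addrK.
rewrite (le_lt_trans (rnorm_dist _ (emb w) _))//.
rewrite [rnorm (emb w - emb u)]rnorm_distC -embB.
move: uw xw; move: (rnorm (emb (u - w))) (rnorm (x - emb w)) => p q pe qe.
by lra.
Qed.

Variable T : R -> H -> H.
Hypotheses (T_semigroup : C0_semigroup T) (T_generator : generator T = form_operator emb a).

Lemma associated_generator psi f : associated psi f -> generator T (emb psi, - f).
Proof. by move=> pf; rewrite T_generator; exists psi, f; split. Qed.

Lemma semigroup_associated psi f t : associated psi f -> 0 <= t ->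
  exists psi' f', [/\ associated psi' f', T t (emb psi) = emb psi' & T t (- f) = - f'].
Proof.
move=> /associated_generator pf t0.
have := generator_shift T_semigroup t0 pf; rewrite T_generator => -[psi' [f' [/= e1 e2 e3]]].
by exists psi', f'; split.
Qed.

(** N stands for an orthogonal projection: the identity for the growth bound, the projection on Q
    for invariance. On the domain this is Gronwall for |N T(s) x|^2; density and the local bound
    give the rest. *)
Lemma energy_estimate (N : H -> H) :
  linear N -> (forall x, rnorm (N x) <= rnorm x) ->
  (forall x y, rdot (N x) (N y) = rdot (N x) y) ->
  (forall psi f, associated psi f ->
    - rdot (N (emb psi)) f <= omega * rnorm (N (emb psi)) ^+ 2) ->
  forall x t, 0 <= t -> rnorm (N (T t x)) <= expR (omega * t) * rnorm (N x).
Proof.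
move=> Nl N1 Nsym Nen.
have NB x y : N (x - y) = N x - N y.
  by rewrite [x - y]addrC -[- y]scaleN1r Nl scaleN1r addrC.
have N0 : N 0 = 0 by have := Nl (- 1) 0 0; rewrite scaler0 addr0 scaleN1r addNr.
have NZ c x : N (c *: x) = c *: N x by have := Nl c x 0; rewrite N0 !addr0.
have Nc : continuous N.
  by apply: (@rnorm_continuous_linear _ _ _ _ 1) => // x; rewrite mul1r.
have dom psi f t : associated psi f -> 0 <= t ->
    rnorm (N (T t (emb psi))) <= expR (omega * t) * rnorm (N (emb psi)).
  move=> pf t0; set x := emb psi.
  rewrite -ler_sqr ?nnegrE ?mulr_ge0 ?rnorm_ge0 ?expR_ge0// exprMn.
  have -> : expR (omega * t) ^+ 2 = expR (2 * omega * t).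
    by rewrite expr2 -expRD; congr expR; ring.
  have -> : rnorm (N x) ^+ 2 = rnorm (N (T 0 x)) ^+ 2 by rewrite (semigroup0 T_semigroup).
  apply: (@right_gronwall R (fun s => rnorm (N (T s x)) ^+ 2)
    (fun s => 2 * rdot (N (T s x)) (N (T s (- f))))) t0 => {}t t0.
  - apply: (right_derivative_sqr_norm (u := fun s => N (T s x))).
    have := cvg_comp _ _ (generator_right_derivative T_semigroup t0
      (associated_generator pf)) (Nc _).
    apply: cvg_trans; apply: near_eq_cvg; apply: nearW => h /=.
    by rewrite NZ NB.
  - have c : rnorm (N (T s x)) @[s --> t^'-] --> rnorm (N (T t x)).
      apply: cvg_rnorm.
      exact: (cvg_comp _ _ (semigroup_left_cvg T_semigroup Hc t0) (Nc _)).
    by rewrite expr2; exact: cvgM.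
  - have [psi' [f' [pf' -> ->]]] := semigroup_associated pf t0.
    rewrite -mulrA ler_pM2l// Nsym rdotNr.
    exact: Nen.
move=> x t t0; have [M M0 TM] := semigroup_bound T_semigroup Hc t.
have E0 : 0 < expR (omega * t) by exact: expR_gt0.
apply/ler_addgt0Pr => e e0.
(* The approximation error counts M times through T(t) and e^(omega t) times through the initial
   value. *)
have D0 : 0 < M + expR (omega * t) by rewrite addr_gt0.
have [psi [f [pf xpsi]]] := domain_dense x (divr_gt0 e0 D0).
have Tl := semigroup_linear T_semigroup t0.
have TB y z : T t (y - z) = T t y - T t z.
  by rewrite [y - z]addrC -[- z]scaleN1r Tl scaleN1r addrC.
have h1 : rnorm (N (T t x)) <= rnorm (N (T t (emb psi))) + M * rnorm (x - emb psi).
  rewrite -[N (T t x)](subrK (N (T t (emb psi)))) addrC (le_trans (rnormD _ _))//.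
  by rewrite lerD2l -NB -TB (le_trans (N1 _))// TM.
have h2 : rnorm (N (emb psi)) <= rnorm (N x) + rnorm (x - emb psi).
  rewrite -[N (emb psi)](subrK (N x)) addrC (le_trans (rnormD _ _))//.
  by rewrite lerD2l -NB (le_trans (N1 _))// rnorm_distC.
have h3 := dom _ _ _ pf t0.
have h4 := ler_wpM2l (ltW E0) h2.
move: xpsi; rewrite ltr_pdivlMr// => xpsi.
move: (rnorm (N (T t x))) (rnorm (N (T t (emb psi)))) (rnorm (x - emb psi))
  (rnorm (N (emb psi))) (rnorm (N x)) (expR (omega * t)) h1 h2 h3 h4 xpsi => *.
by lra.
Qed.

(** P is the space tested for invariance and Q its complement; PV and QV are their counterparts in
    V, linked to them only through the embedding. *)
Variables (P Q : set H) (PV QV : set V).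
Hypotheses (P_linear : forall c x y, P x -> P y -> P (c *: x + y)).
Hypotheses (Q_linear : forall c x y, Q x -> Q y -> Q (c *: x + y)).
Hypothesis PQ_orthogonal : forall x y, P x -> Q y -> dotp x y = 0.
Hypothesis PQ_decomposition : forall x, exists p q, [/\ x = p + q, P p & Q q].
Hypothesis PV_emb : forall u, PV u -> P (emb u).
Hypothesis QV_emb : forall u, QV u -> Q (emb u).
Hypothesis PQV_decomposition : forall u, exists p q, [/\ u = p + q, PV p & QV q].

Lemma orthogonal_mem x : (forall y, Q y -> rdot x y = 0) -> P x.
Proof.
move=> xQ; have [p [q [xE Pp Qq]]] := PQ_decomposition x.
have q0 : q = 0.
  apply: rnorm_eq0; apply/eqP; rewrite -sqrf_eq0 -rdotxx.
  by have := xQ q Qq; rewrite xE rdotDl {1}/rdot PQ_orthogonal// add0r => ->.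
by rewrite xE q0 addr0.
Qed.

Lemma semigroup_growth x t : 0 <= t -> rnorm (T t x) <= expR (omega * t) * rnorm x.
Proof.
apply: (@energy_estimate id) => // psi f pf.
have h := coercive psi.
have : rdot (emb psi) f = complex.Re (a psi psi) by rewrite rdotC /rdot -pf.
move=> ->; have := mulr_ge0 (ltW alpha0) (sqr_ge0 (rnorm psi)).
by move=> *; lra.
Qed.

(* For y in Q, the function s |-> (y | T s (emb u)) solves l' = lam l, hence
   grows faster than the semigroup unless it vanishes. *)
Lemma resolvent_invariant : (forall t x, 0 <= t -> P x -> P (T t x)) ->
  forall lam u g, omega < lam -> P g ->
  (forall v, a u v + lam%:C%C * dotp (emb u) (emb v) = dotp g (emb v)) -> P (emb u).
Proof.
move=> TP lam u g ol Pg uP; apply: orthogonal_mem => y Qy.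
set x := emb u.
have ug : associated u (g - lam%:C%C *: x).
  by move=> v; rewrite dotpBl dotpZl -uP addrK.
have gx := associated_generator ug.
pose l s := rdot y (T s x).
(* The generator maps x to lam x - g, and T(t) g remains in P, hence orthogonal to y. *)
have lder t : 0 <= t -> h^-1 * (l (t + h) - l t) @[h --> 0^'+] --> lam * l t.
  move=> t0.
  have := right_derivative_rdot (u := T^~ x) (z := y)
    (generator_right_derivative T_semigroup t0 gx).
  suff -> : rdot y (T t (- (g - lam%:C%C *: x))) = lam * l t by [].
  have Tl := semigroup_linear T_semigroup t0.
  rewrite opprB addrC -scaleN1r addrC -[- 1 *: g]addr0.
  have -> : T t (lam%:C%C *: x + (-1 *: g + 0)) = lam%:C%C *: T t x - T t g + T t 0.
    by rewrite Tl Tl scaleN1r addrA.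
  have -> : T t 0 = 0.
    by have := Tl (- 1) 0 0; rewrite scaler0 addr0 scaleN1r addNr.
  rewrite addr0 rdotDr rdotNr rdotZr [rdot y (T t g)]rdotC {2}/rdot.
  by rewrite PQ_orthogonal ?subr0//; exact: TP.
have lleft (t : R) : 0 < t -> l s @[s --> t^'-] --> l t.
  by move=> t0; apply: rdot_cvgr; exact: semigroup_left_cvg.
have l0E : l 0 = rdot x y by rewrite /l (semigroup0 T_semigroup) rdotC.
have upper t : 0 <= t -> l t <= expR (lam * t) * l 0.
  by apply: (@right_gronwall R l (fun t => lam * l t)).
have lower t : 0 <= t -> - l t <= expR (lam * t) * - l 0.
  apply: (@right_gronwall R (fun t => - l t) (fun t => - (lam * l t))).
  - move=> s s0.
    have c : - (h^-1 * (l (s + h) - l s)) @[h --> 0^'+] --> - (lam * l s).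
      by apply: cvgN; exact: lder.
    apply: cvg_trans c; apply: near_eq_cvg; apply: nearW => h /=.
    by rewrite -mulrN opprB opprK addrC.
  - by move=> s s0; apply: cvgN; exact: lleft.
  - by move=> s s0; rewrite mulrN.
have lE t : 0 <= t -> l t = expR (lam * t) * l 0.
  move=> t0; apply/eqP; rewrite eq_le upper//=.
  by have := lower t t0; rewrite mulrN lerN2.
have bound t : 0 <= t -> expR (lam * t) * `|l 0| <= expR (omega * t) * rnorm x * rnorm y.
  move=> t0; rewrite -(ger0_norm (expR_ge0 (lam * t))) -normrM -lE//.
  rewrite (le_trans (ler_rdot _ _))// mulrC ler_wpM2r ?rnorm_ge0//.
  exact: semigroup_growth.
rewrite -l0E; apply/eqP; rewrite -normr_le0; apply/ler_addgt0Pr => e e0; rewrite add0r.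
pose K := rnorm x * rnorm y.
have K0 : 0 <= K by rewrite mulr_ge0 ?rnorm_ge0.
have ol' : 0 < lam - omega by rewrite subr_gt0.
(* Chosen so that 1 + (lam - omega) t = 1 + K / e; if |l 0| > e, the left side of [b3] would be at
   least K + e. *)
pose t := K / (e * (lam - omega)).
have t0 : 0 <= t by rewrite divr_ge0// mulr_ge0// ltW.
have := bound t t0; rewrite -mulrA -/K => b.
have b2 : expR ((lam - omega) * t) * `|l 0| <= K.
  rewrite -(ler_pM2l (expR_gt0 (omega * t))) mulrA -expRD.
  by rewrite (_ : omega * t + _ = lam * t)//; ring.
have b3 : (1 + (lam - omega) * t) * `|l 0| <= K.
  by rewrite (le_trans _ b2)// ler_wpM2r// expR_ge1Dx.
have tE : (lam - omega) * t = K / e.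
  by rewrite /t; field; rewrite !gt_eqF.
rewrite tE in b3.
rewrite leNgt; apply/negP => el.
have : (1 + K / e) * e <= K.
  by rewrite (le_trans _ b3)// ler_wpM2l ?(ltW el)// addr_ge0// divr_ge0// ltW.
by rewrite mulrDl mul1r divfK ?gt_eqF// gerDr leNgt e0.
Qed.

Lemma form_zero_of_invariant : (forall t x, 0 <= t -> P x -> P (T t x)) ->
  forall u v, PV u -> QV v -> a u v = 0.
Proof.
move=> TP u v uP vQ; apply: (@rnorm_eq0 R R[i]^o); apply/eqP.
rewrite eq_le rnorm_ge0 andbT; apply/ler_addgt0Pr => e e0; rewrite add0r.
have [B BP] := resolvent_approx u; have [M M0 aM] := form_bound a_cont.
have [||d d0 dP] := @weak_small R V H emb (fun x => a x v) (M * rnorm v) B e Vc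
  emb_linear emb_cont emb_inj _ _ e0.
- by move=> c x y; rewrite /= sesqDl sesqZl.
- by move=> x; rewrite mulrAC.
have [lam [w [ol wP wB wd]]] := BP d omega d0.
have Pw : P (emb w).
  have Pu : P (lam%:C%C *: emb u).
    have P0 : P 0 by have := P_linear (-1) (PV_emb uP) (PV_emb uP); rewrite scaleN1r addNr.
    by rewrite -[_ *: _]addr0; apply: P_linear => //; exact: PV_emb.
  by apply: (resolvent_invariant TP ol Pu) => z; rewrite wP dotpZl.
have aw : a w v = 0.
  have := wP v; rewrite !PQ_orthogonal ?mulr0 ?addr0//; [exact: PV_emb|exact: QV_emb..].
have := dP (w - u) wB wd; rewrite sesqBl aw sub0r.
by rewrite /cabs normrN.
Qed.

Lemma invariant_of_form_zero : (forall u v, PV u -> QV v -> a u v = 0) ->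
  forall t x, 0 <= t -> P x -> P (T t x).
Proof.
have ex x : exists q, Q q /\ P (x - q).
  by have [p [q [-> Pp Qq]]] := PQ_decomposition x; exists q; rewrite addrK.
(* N is the orthogonal projection on Q; [uniq] frees it from the choice made here, whence its
   linearity. *)
move=> aPQ; have [N NP] := choice ex.
have PB x y : P x -> P y -> P (x - y).
  by move=> Px Py; rewrite addrC -scaleN1r; exact: P_linear.
have QB x y : Q x -> Q y -> Q (x - y).
  by move=> Qx Qy; rewrite addrC -scaleN1r; exact: Q_linear.
have uniq x q : Q q -> P (x - q) -> N x = q.
  move=> Qq Pq; have [QN PN] := NP x; apply/eqP; rewrite -subr_eq0; apply/eqP.
  apply: rnorm_eq0; apply/eqP; rewrite -sqrf_eq0 -rdotxx /rdot PQ_orthogonal ?eqxx//.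
    rewrite (_ : N x - q = (x - q) - (x - N x)); first exact: PB.
    by rewrite opprB [RHS]addrC addrA subrK.
  exact: QB.
have Nl : linear N.
  move=> c x y; have [Qx Px] := NP x; have [Qy Py] := NP y.
  apply: uniq; first exact: Q_linear.
  by rewrite opprD addrACA -scalerBr; exact: P_linear.
have orth x y : rdot (N x) (y - N y) = 0.
  by rewrite rdotC /rdot PQ_orthogonal//; [exact: (NP y).2|exact: (NP x).1].
have N1 x : rnorm (N x) <= rnorm x.
  rewrite -ler_sqr ?nnegrE ?rnorm_ge0// -[in leRHS](subrK (N x) x) addrC rnorm_sqrD orth.
  by rewrite mulr0 addr0 lerDl sqr_ge0.
have Nsym x y : rdot (N x) (N y) = rdot (N x) y.
  by apply/eqP; rewrite eq_sym -subr_eq0 -rdotNr -rdotDr orth.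
have Nen psi f : associated psi f ->
    - rdot (N (emb psi)) f <= omega * rnorm (N (emb psi)) ^+ 2.
  (* The splitting takes place in V, where q is an admissible test vector: a(psi, q) = a(q, q)
     because a(p, q) = 0. *)
  move=> pf; have [p [q [psiE Pp Qq]]] := PQV_decomposition psi.
  have -> : N (emb psi) = emb q.
    by apply: uniq; [exact: QV_emb|rewrite psiE embD addrK; exact: PV_emb].
  have -> : rdot (emb q) f = complex.Re (a q q).
    by rewrite rdotC /rdot -pf psiE sesqDl aPQ// add0r.
  have := mulr_ge0 (ltW alpha0) (sqr_ge0 (rnorm q)); have := coercive q.
  by move=> *; lra.
move=> t x t0 Px.
have Nx : N x = 0.
  apply: uniq; last by rewrite subr0.
  by have [q [Qq _]] := ex 0; have := Q_linear (-1) Qq Qq; rewrite scaleN1r addNr.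
have := energy_estimate Nl N1 Nsym Nen x t0.
rewrite Nx rnorm0 mulr0 => NT.
have N0 : N (T t x) = 0 by apply: rnorm_eq0; apply/eqP; rewrite eq_le NT rnorm_ge0.
by have [_] := NP (T t x); rewrite N0 subr0.
Qed.

End Coercive.
End Invariance.

(** * Lifting the embedding to Hilbert sums *)

Section HilbertSumMap.
Context {R : realType} {I : choiceType} {E F : preHilbertType R}.
Variables (f : {linear E -> F}) (f_cont : continuous f).

Lemma hsum_map_linear : linear (@hsum_map R I E F f f_cont).
Proof.
move=> c u w; apply: hsum_ext => i; rewrite hsumDE hsumZE.
by rewrite -[LHS]/(f ((c *: u + w) i)) hsumDE hsumZE linearP.
Qed.

Lemma hsum_map_continuous : continuous (@hsum_map R I E F f f_cont).
Proof.
have [M M0 fM] := continuous_linear_rnorm (linearP f) f_cont.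
have l := hsum_map_linear.
apply: (@rnorm_continuous_linear _ _ _ _ M) => [x y|x].
  by rewrite [x - y]addrC -[- y]scaleN1r l scaleN1r addrC.
rewrite -ler_sqr ?nnegrE ?mulr_ge0 ?rnorm_ge0 ?(ltW M0)// exprMn.
apply: hsum_norm_le => A.
rewrite (le_trans _ (ler_wpM2l (sqr_ge0 M) (hsum_sum_le x A)))// mulr_sumr.
apply: ler_sum => i _; rewrite -exprMn ler_sqr ?nnegrE ?mulr_ge0 ?rnorm_ge0 ?(ltW M0)//.
exact: fM.
Qed.

Lemma hsum_map_injective : injective f -> injective (@hsum_map R I E F f f_cont).
Proof.
move=> fi u w uw; apply: hsum_ext => i; apply: fi.
by have := congr1 (fun h : hsum I F => h i) uw.
Qed.

Lemma hsum_map_single i (g : E) :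
  hsum_map f_cont (hsum_single i g) = hsum_single i (f g) :> hsum I F.
Proof.
apply: hsum_ext => j; rewrite hsum_singleE.
rewrite -[LHS]/(f (hsum_single i g j)) hsum_singleE.
by case: ifP; rewrite ?linear0.
Qed.

Lemma hsum_map_dense : dense (range f) -> forall (x : hsum I F) (e : R), 0 < e ->
  exists w, rnorm (x - hsum_map f_cont w) < e.
Proof.
move=> fd x e e0.
have approx (z : F) (r : R) : 0 < r -> exists g, rnorm (z - f g) < r.
  move=> r0; have zr : nbhs z [set y | rnorm (z - y) < r].
    apply/nbhs_normP; exists r%:C%C => /=; first by rewrite ltcR.
    by move=> y /=; rewrite -rnormE ltcR.
  have [||y [/interior_subset yr [g _ gy]]] := fd ([set y | rnorm (z - y) < r]°).
  - by exists z.
  - exact: open_interior.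
  by exists g; rewrite gy.
have e2 : 0 < e / 2 by rewrite divr_gt0.
have /cvg_rnormP/(_ _ e2)[A _ /(_ A (fsubset_refl A))/= xA] := @hsum_single_cvg _ _ _ x.
(* The successor allows A to be empty and keeps the total error strictly below e / 2. *)
have s0 : 0 < (size (enum_fset A)).+1%:R :> R by [].
have [g gP] := choice (fun i => approx (x i) _ (divr_gt0 e2 s0)).
exists (\sum_(i <- A) hsum_single i (g i)).
have -> : hsum_map f_cont (\sum_(i <- A) hsum_single i (g i)) =
    \sum_(i <- A) hsum_single i (f (g i)).
  elim: (A : seq I) => [|i s ih]; rewrite ?big_nil ?big_cons.
    by apply: hsum_ext => j; rewrite -[LHS]/(f 0) linear0.
  by rewrite -[hsum_single i (g i)]scale1r hsum_map_linear ih scale1r hsum_map_single.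
rewrite (le_lt_trans (rnorm_dist _ (\sum_(i <- A) hsum_single i (x i)) _))//.
rewrite [e]splitr ltrD// -sumrB.
rewrite (le_lt_trans (rnorm_sum _ _ _))//.
rewrite (@le_lt_trans _ _ (\sum_(i <- A) e / 2 / (size (enum_fset A)).+1%:R))//.
  apply: ler_sum => i _.
  have -> : hsum_single i (x i) - hsum_single i (f (g i)) =
      hsum_single i (x i - f (g i)) :> hsum I F.
    apply: hsum_ext => j; rewrite hsumBE !hsum_singleE.
    by case: ifP => // _; rewrite subr0.
  exact: le_trans (rnorm_single _ _) (ltW (gP i)).
rewrite big_const_seq count_predT iter_addr_0 -[ltLHS]mulr_natr -mulrA gtr_pMr//.
by rewrite ltr_pdivrMl// mulr1 ltr_nat.
Qed.

End HilbertSumMap.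

(** Square summability of the families in (b) makes their expansions along v converge in V, and
    every element of the two parts of V arises from such a family. *)
Theorem theorem34 (R : realType) (d : measure_display) (X : measurableType d)
    (mu : {sigma_finite_measure set X -> \bar R})
    (m : option nat) (V0 : hilbertType R)
    (iota : {linear V0 -> L2 mu}) (iota_cont : continuous iota)
    (iota_inj : injective iota) (iota_dense : dense (range iota))
    (Y : set (ell2 R (index_type m)))
    (Y_linear : submod_closed (mem Y)) (Y_closed : closed Y)
    (a : sesquilinear_form R (hsum (index_type m) V0))
    (a_cont : form_continuous a)
    (a_elliptic : form_elliptic (hsum_map iota_cont) a)
    (T : R -> hsum (index_type m) (L2 mu) -> hsum (index_type m) (L2 mu))
    (T_semigroup : C0_semigroup T)
    (T_generator : generator T = form_operator (hsum_map iota_cont) a)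
    (I' I'' : set (index_type m))
    (I_cover : I' `|` I'' = setT) (I_disjoint : I' `&` I'' = set0)
    (v : index_type m -> ell2 R (index_type m))
    (v_basis : hilbert_basis setT v setT)
    (v_basisY : hilbert_basis I' v Y)
    (v_basisYperp : hilbert_basis I'' v (orthocomplement Y)) :
  (forall t : R, 0 <= t -> T t @` pointwise_in mu Y `<=` pointwise_in mu Y) <->
  (forall psi psi' : index_type m -> V0,
    square_summable I' psi -> square_summable I'' psi' ->
    usum setT (fun i => usum setT (fun j =>
      usum I' (fun l => usum I'' (fun k =>
        v l j * (v k i)^* * form_entry a i j (psi l) (psi' k))))) = 0).
Proof.
have V0c : seq_complete V0 by exact: (@complete_seq_complete R V0).
have Vc : seq_complete (hsum (index_type m) V0) by exact: hsum_complete.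
have L2c : seq_complete (L2 mu) by exact: L2_complete.
have Hc : seq_complete (hsum (index_type m) (L2 mu)) by exact: hsum_complete.
have YE := basis_memP Y_linear Y_closed v_basisY v_basisYperp.
have PE (psi : hsum (index_type m) (L2 mu)) := pointwise_inP psi YE.
have I_cover' : I'' `|` I' = setT by rewrite setUC.
have I_disjoint' : I'' `&` I' = set0 by rewrite setIC.
have emb_linear := @hsum_map_linear _ (index_type m) _ _ _ iota_cont.
have emb_cont := @hsum_map_continuous _ (index_type m) _ _ _ iota_cont.
have emb_inj := @hsum_map_injective _ (index_type m) _ _ _ iota_cont iota_inj.
have emb_dense := @hsum_map_dense _ (index_type m) _ _ _ iota_cont iota_dense.
have [alpha alpha0 [omega coercive]] := form_coercive a_elliptic.
(* The index sets cross over: [perp v I''] holds the functions with values in Y, being orthogonality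
   to the basis of the complement, and plays the role of P; [perp v I'] is Q. *)
have H_orth x y : perp v I'' (L2 mu) x -> perp v I' (L2 mu) y -> dotp x y = 0.
  exact: perp_orthogonal.
have H_dec x : exists p q,
    [/\ x = p + q, perp v I'' (L2 mu) p & perp v I' (L2 mu) q].
  have [p [q [-> pP qP _]]] := perp_decomposition v_basis x L2c I_disjoint'.
  by exists p, q.
have V_dec w : exists p q, [/\ w = p + q, perp v I'' V0 p & perp v I' V0 q].
  have [p [q [-> pP qP _]]] := perp_decomposition v_basis w V0c I_disjoint'.
  by exists p, q.
have emb_perp J w : perp v J V0 w -> perp v J (L2 mu) (hsum_map iota_cont w).
  exact: perp_map.
have invE : (forall t, 0 <= t -> T t @` pointwise_in mu Y `<=` pointwise_in mu Y) <->
    (forall t x, 0 <= t -> perp v I'' (L2 mu) x -> perp v I'' (L2 mu) (T t x)).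
  split=> [TY t x t0 /PE xY|TP t t0 _ [x /PE xY <-]].
    by apply/PE/(TY t t0); exists x.
  by apply/PE/TP.
have formE : (forall u w, perp v I'' V0 u -> perp v I' V0 w -> a u w = 0) <->
    (forall t x, 0 <= t -> perp v I'' (L2 mu) x -> perp v I'' (L2 mu) (T t x)).
  split=> [a0|TP].
    exact: (invariant_of_form_zero Vc Hc emb_linear emb_cont emb_dense a_cont alpha0
      coercive T_semigroup T_generator (@perp_linear _ _ v I'' _)
      (@perp_linear _ _ v I' _) H_orth H_dec (emb_perp I'') (emb_perp I') V_dec a0).
  exact: (form_zero_of_invariant Vc Hc emb_linear emb_cont emb_inj emb_dense a_cont alpha0
      coercive T_semigroup T_generator (@perp_linear _ _ v I'' _)
      H_orth H_dec (emb_perp I'') (emb_perp I') TP).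
rewrite invE -formE; split=> [a0 psi psi' psis psi's|b u w uP wP].
  have /cvg_ex[u psiu] := expansion_cvg v_basis V0c psis.
  have /cvg_ex[w psiw] := expansion_cvg v_basis V0c psi's.
  rewrite (usum_form a_cont psiu psiw); apply: a0.
    exact: expansion_perp I_disjoint psiu.
  exact: expansion_perp I_disjoint' psiw.
have [psi psis psiu] := perp_expansion v_basis V0c I_cover I_disjoint uP.
have [psi' psi's psiw] := perp_expansion v_basis V0c I_cover' I_disjoint' wP.
by rewrite -(usum_form a_cont psiu psiw); exact: b.
Qed.
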